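(* Let $f:\mathbb{R}\to\mathbb{R}$ satisfy $f(x)=f(x+1)$ for all $x$, $\int_0^1 f(x)\,dx=0$, and $\operatorname{Var}_{[0,1]} f\le 2$, and assume $\|f\|:=\left(\int_0^1 f(x)^2\,dx\right)^{1/2}>0$. Then for any sequence $(s_n)_{n\ge1}$ of distinct positive integers, any $\xi>0$ and any nonempty interval $[A,B]\subset(1,\infty)$, $$ \mathbb{P}\left( x \in [A,B]:~\frac{1}{\|f\|\sqrt{N}} \sum_{n=1}^N f(\xi x^{s_n}) \leq t\right) \to \Phi(t) \qquad \text{as } N \to \infty, $$ uniformly in $t\in\mathbb{R}$.
   Context: $\mathbb{P}$ denotes normalized Lebesgue measure on $[A,B]$ and $\Phi$ the standard normal distribution function. $\operatorname{Var}_{[0,1]} f$ denotes the total variation of $f$ over one period. *)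

(* Defs.v *)
From HB Require Import structures.
From mathcomp Require Export all_boot all_order all_algebra.
From mathcomp Require Export all_classical all_reals all_analysis.
Export Order.TTheory GRing.Theory Num.Theory.
Export numFieldNormedType.Exports.

Set Implicit Arguments.
Unset Strict Implicit.
Unset Printing Implicit Defensive.

Local Open Scope classical_set_scope.
Local Open Scope ring_scope.

(* For f of period 1 this is the L^2 norm over one period.  [Rintegral] sends
   an infinite integral to 0; functions of bounded variation on [0, 1] are
   Borel measurable and bounded, so for them the integral is the genuine one. *)
Definition L2norm_period (R : realType) (f : R -> R) : R :=
  Num.sqrt (\int[lebesgue_measure]_(x in `[0, 1]) (f x ^+ 2)).

(* Only meaningful for A < B. *)
Definition normalized_lebesgue (R : realType) (A B : R) (S : set R) : R :=
  fine (lebesgue_measure (`[A, B] `&` S)) / (B - A).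

Definition std_normal_cdf (R : realType) (t : R) : R :=
  fine (normal_prob 0 1 `]-oo, t]).

(* Main.v *)
(* Let g be a trigonometric polynomial of mean 0.  The moments of the sum of the
   g (xi x ^ k) are combinations of integrals of cos (2 pi xi phi + b), where
   phi = a0 x ^ K + lower terms has integer coefficients.  Its derivative is
   K x ^ (K - 1) (c0 + sum_i c_i x ^ - d_i), which may vanish; the set where the second
   factor psi is small is controlled by the integral of eta ^ 2 / (psi ^ 2 + eta ^ 2), by
   induction on the number of terms: the operator x d/dx + d removes the term of
   exponent - d.  As x >= A > 1, each such integral is exponentially small in K, and
   adding the exponents in increasing order yields the Gaussian recursion for the
   moments, up to summable errors.

   Taylor's formula turns Gaussian moments into convergence for cosines, hence for
   Lipschitz test functions, uniformly over all lists of exponents of given length.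

   A function f of bounded variation lies within w_D of a trigonometric polynomial
   g_D, where w_D is a nonnegative trigonometric polynomial of mean O(1 / D ^ 2).
   The correlation of f - g_D at the exponents of ranks i and j is
   O(1 / max(|i - j|, D) ^ 2), which bounds the second moment of the error by O(N / D)
   uniformly in the exponents.  Smoothing the indicator of a half-line concludes. *)
Require Import Defs.
From mathcomp Require Import measurable_realfun.
From mathcomp Require Import ring lra zify.

Set Implicit Arguments.
Unset Strict Implicit.
Unset Printing Implicit Defensive.

Local Open Scope classical_set_scope.
Local Open Scope ring_scope.

(** * Calculus on a segment *)

(** Every estimate is uniform over all strictly increasing lists of positive exponents of a given
    length. This is what admits arbitrary distinct exponents: the sum does not see their order, so
    they can be sorted separately for each [N], although the sorted lists for different [N] are in
    general not prefixes of one another. In the oscillatory integrals the lower coefficients are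
    arbitrary integers, so the zeros of the derivative of the phase cannot be located; only its
    leading coefficient, a nonzero integer, is under control. For [f] with jumps the coefficient
    norms of the approximants grow with [D], and error bounds through them would be useless.
    Nonnegativity of the majorant [w_D] helps: a primitive of [w_D] minus its mean oscillates by at
    most that mean, so the average of [w_D (xi x ^ k)] is a bounded multiple of the mean for every
    [k >= 1]. Pairs of exponents at a large distance [d] get an approximant of their own, depending
    on [d]; its norm and degree are polynomial in [d] and lose against [A ^ - d]. The parameter [D]
    is fixed from [eps] before [N] grows. *)

Section derivative_rules.
Context {R : realType}.
Implicit Types (f g : R -> R) (x a b : R).

Lemma dv_eq f x a b : is_derive x 1 f a -> a = b -> is_derive x 1 f b.
Proof. by move=> fa <-. Qed.

Lemma dv_cst (c x : R) : is_derive x 1 (fun=> c) 0.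
Proof. exact: is_derive_cst. Qed.

Lemma dv_id x : is_derive x 1 (fun y : R => y) 1.
Proof. exact: is_derive_id. Qed.

Lemma dvD f g x a b : is_derive x 1 f a -> is_derive x 1 g b ->
  is_derive x 1 (fun y => f y + g y) (a + b).
Proof. exact: is_deriveD. Qed.

Lemma dvN f x a : is_derive x 1 f a -> is_derive x 1 (fun y => - f y) (- a).
Proof. exact: is_deriveN. Qed.

Lemma dvB f g x a b : is_derive x 1 f a -> is_derive x 1 g b ->
  is_derive x 1 (fun y => f y - g y) (a - b).
Proof. by move=> fa gb; apply: dvD => //; exact: dvN. Qed.

Lemma dvM f g x a b : is_derive x 1 f a -> is_derive x 1 g b ->
  is_derive x 1 (fun y => f y * g y) (f x * b + g x * a).
Proof. exact: is_deriveM. Qed.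

Lemma dvZ (c : R) f x a : is_derive x 1 f a ->
  is_derive x 1 (fun y => c * f y) (c * a).
Proof.
by move=> fa; apply: (dv_eq (dvM (dv_cst c x) fa)); rewrite mulr0 addr0.
Qed.

Lemma dvX f n x a : is_derive x 1 f a ->
  is_derive x 1 (fun y => f y ^+ n) (n%:R * f x ^+ n.-1 * a).
Proof.
move=> fa; have := @is_deriveX _ _ f n x 1 a fa.
by rewrite (_ : (fun y => f y ^+ n) = f ^+ n)//; apply/funext => y; rewrite fctE.
Qed.

Lemma dvV f x a : f x != 0 -> is_derive x 1 f a ->
  is_derive x 1 (fun y => (f y)^-1) (- a / f x ^+ 2).
Proof.
move=> fx0 fa; apply: (dv_eq (is_deriveV fx0 fa)).
by rewrite /GRing.scale/= mulNr mulNr mulrC.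
Qed.

Lemma dv_comp f g x a b : is_derive (g x) 1 f a -> is_derive x 1 g b ->
  is_derive x 1 (fun y => f (g y)) (a * b).
Proof. exact: is_derive1_comp. Qed.

Lemma dv_cos f x a : is_derive x 1 f a ->
  is_derive x 1 (fun y => cos (f y)) (- sin (f x) * a).
Proof. by apply: dv_comp; exact: is_derive_cos. Qed.

Lemma dv_sin f x a : is_derive x 1 f a ->
  is_derive x 1 (fun y => sin (f y)) (cos (f x) * a).
Proof. by apply: dv_comp; exact: is_derive_sin. Qed.

Lemma dv_atan f x a : is_derive x 1 f a ->
  is_derive x 1 (fun y => atan (f y)) ((1 + f x ^+ 2)^-1 * a).
Proof. by apply: dv_comp; exact: is_derive1_atan. Qed.

Lemma dv_sum (I : Type) (s : seq I) (F : I -> R -> R) (F' : I -> R) x :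
  (forall i, is_derive x 1 (F i) (F' i)) ->
  is_derive x 1 (fun y => \sum_(i <- s) F i y) (\sum_(i <- s) F' i).
Proof.
move=> H; elim: s => [|i s ih].
  rewrite big_nil (_ : (fun y => _) = fun=> 0); first exact: dv_cst.
  by apply/funext => y; rewrite big_nil.
rewrite big_cons (_ : (fun y => _) = fun y => F i y + \sum_(i <- s) F i y).
  exact: dvD.
by apply/funext => y; rewrite big_cons.
Qed.

Lemma dv_continuous f x a : is_derive x 1 f a -> {for x, continuous f}.
Proof. by case=> df _; exact/differentiable_continuous/derivable1_diffP. Qed.

(** One-sided mean value inequality. It is the comparison tool behind the Taylor bound for the
    cosine, the lower bound for the sine and the oscillation of a primitive. *)
Lemma derive_bound_le f (f' : R -> R) (C a b : R) : a <= b ->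
  (forall x, a <= x <= b -> is_derive x 1 f (f' x)) ->
  (forall x, a <= x <= b -> C <= f' x) -> C * (b - a) <= f b - f a.
Proof.
move=> ab df Cf; have [|c|c cab ->] := @MVT_segment _ f f' a b ab.
- by move=> x /[!in_itv]/= /andP[ax xb]; apply: df; rewrite !ltW.
- apply/continuous_in_subspaceT => x /set_mem/=; rewrite in_itv/= => xab.
  exact: dv_continuous (df _ xab).
- by rewrite ler_wpM2r ?subr_ge0// Cf// -in_itv.
Qed.

End derivative_rules.

Section Rintegral_rules.
Context {d} {T : measurableType d} {R : realType}.
Variables (mu : {measure set T -> \bar R}) (D : set T).
Hypothesis mD : measurable D.
Implicit Types f g : T -> R.

Definition ig f := mu.-integrable D (EFin \o f).

Lemma igD f g : ig f -> ig g -> ig (fun x => f x + g x).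
Proof. by move=> If Ig; have := integrableD mD If Ig. Qed.

Lemma igZ (c : R) f : ig f -> ig (fun x => c * f x).
Proof. by move=> If; have := integrableZl mD c If. Qed.

Lemma igN f : ig f -> ig (fun x => - f x).
Proof. by move=> /integrableN. Qed.

Lemma igB f g : ig f -> ig g -> ig (fun x => f x - g x).
Proof. by move=> If Ig; apply: igD => //; exact: igN. Qed.

Lemma ig_abs f : ig f -> ig (fun x => `|f x|).
Proof. by move=> /integrable_abse. Qed.

Lemma ig0 : ig (fun=> 0).
Proof. exact: integrable0. Qed.

Lemma ig_sum (I : eqType) (s : seq I) (F : I -> T -> R) :
  (forall i, i \in s -> ig (F i)) -> ig (fun x => \sum_(i <- s) F i x).
Proof.
elim: s => [|i s ih] H.
  rewrite (_ : (fun x => _) = fun=> 0); first exact: ig0.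
  by apply/funext => y; rewrite big_nil.
rewrite (_ : (fun x => _) = fun x => F i x + \sum_(i <- s) F i x).
  apply: igD; first by apply: H; rewrite mem_head.
  by apply: ih => j js; apply: H; rewrite in_cons js orbT.
by apply/funext => y; rewrite big_cons.
Qed.

Lemma Rintegral_sum (I : eqType) (s : seq I) (F : I -> T -> R) :
  (forall i, i \in s -> ig (F i)) ->
  \int[mu]_(x in D) (\sum_(i <- s) F i x) = \sum_(i <- s) \int[mu]_(x in D) F i x.
Proof.
elim: s => [|i s ih] H.
  rewrite big_nil (eq_Rintegral _ (g := fun=> 0)); last first.
    by move=> x _; rewrite big_nil.
  by rewrite Rintegral_cst// mul0r.
have Hs j : j \in s -> ig (F j) by move=> js; apply: H; rewrite in_cons js orbT.
rewrite big_cons -ih// -RintegralD//.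
- by apply: eq_Rintegral => x _; rewrite big_cons.
- by apply: H; rewrite mem_head.
- exact: ig_sum.
Qed.

Lemma Rintegral_abs_le f g : ig f -> ig g -> (forall x, D x -> `|f x| <= g x) ->
  `|\int[mu]_(x in D) f x| <= \int[mu]_(x in D) g x.
Proof.
move=> If Ig fg; apply: (le_trans (le_normr_Rintegral _ _)) => //.
by apply: le_Rintegral => //; exact: ig_abs.
Qed.

Hypothesis Dfin : (mu D < +oo)%E.

Lemma ig_bounded f (C : R) : measurable_fun D f ->
  (forall x, D x -> `|f x| <= C) -> ig f.
Proof.
move=> mf fC; apply: measurable_bounded_integrable => //.
exists C; split; first exact: num_real.
by move=> M CM x Dx; exact: le_trans (fC _ Dx) (ltW CM).
Qed.

Lemma Rintegral_abs_bound f (C : R) : ig f ->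
  (forall x, D x -> `|f x| <= C) ->
  `|\int[mu]_(x in D) f x| <= C * fine (mu D).
Proof.
move=> If fC; rewrite -Rintegral_cst//; apply: Rintegral_abs_le => //.
apply: (@ig_bounded _ `|C|); first exact: measurable_cst.
by move=> x _.
Qed.

End Rintegral_rules.

Section segment_integral.
Context {R : realType}.
Variables (A B : R).
Hypothesis AB : A < B.
Local Notation mu := (@lebesgue_measure R).
Implicit Types f g F : R -> R.

(** Continuity is two-sided even at the end points: all functions live on the whole line, and this
    is what differentiability on the closed segment provides through [con_dv]. *)
Definition con f := forall x, A <= x <= B -> {for x, continuous f}.

Lemma segment_measureE : fine (mu `[A, B]) = B - A.
Proof. by rewrite lebesgue_measure_itv/= lte_fin AB. Qed.

Lemma segment_measure_fin : (mu `[A, B] < +oo)%E.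
Proof. by rewrite lebesgue_measure_itv/= lte_fin AB -EFinD ltry. Qed.

Lemma con_within f : con f -> {within `[A, B], continuous f}.
Proof.
move=> cf; apply/continuous_in_subspaceT => x /set_mem/=.
by rewrite in_itv/=; exact: cf.
Qed.

Lemma con_ig f : con f -> ig mu `[A, B] f.
Proof.
move=> cf; apply: continuous_compact_integrable; first exact: segment_compact.
exact: con_within.
Qed.

Lemma con_cst (c : R) : con (fun=> c).
Proof. by move=> x _; exact: cst_continuous. Qed.

Lemma conD f g : con f -> con g -> con (fun x => f x + g x).
Proof. by move=> cf cg x xAB; apply: continuousD; [exact: cf|exact: cg]. Qed.

Lemma conN f : con f -> con (fun x => - f x).
Proof. by move=> cf x xAB; apply: continuousN; exact: cf. Qed.

Lemma conB f g : con f -> con g -> con (fun x => f x - g x).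
Proof. by move=> cf cg; exact: (conD cf (conN cg)). Qed.

Lemma conM f g : con f -> con g -> con (fun x => f x * g x).
Proof. by move=> cf cg x xAB; apply: continuousM; [exact: cf|exact: cg]. Qed.

Lemma conV f : (forall x, A <= x <= B -> f x != 0) -> con f ->
  con (fun x => (f x)^-1).
Proof. by move=> f0 cf x xAB; apply: continuousV; [exact: f0|exact: cf]. Qed.

Lemma conX f n : con f -> con (fun x => f x ^+ n).
Proof.
move=> cf; elim: n => [|n ih]; first exact: con_cst.
rewrite (_ : (fun x => _) = fun x => f x * f x ^+ n); first exact: conM.
by apply/funext => x; rewrite exprS.
Qed.

Lemma con_dv f (f' : R -> R) :
  (forall x, A <= x <= B -> is_derive x 1 f (f' x)) -> con f.
Proof. by move=> df x xAB; exact: dv_continuous (df x xAB). Qed.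

Lemma Rintegral_FTC F f : con f ->
  (forall x, A <= x <= B -> is_derive x 1 F (f x)) ->
  \int[mu]_(x in `[A, B]) f x = F B - F A.
Proof.
move=> cf dF; rewrite /Rintegral (@continuous_FTC2 _ f F)//.
- exact: con_within.
- have cF := con_dv dF; split.
  + move=> x /[!in_itv]/= /andP[Ax xB].
    by have [] : is_derive x 1 F (f x) by apply: dF; rewrite !ltW.
  + by apply: cvg_at_right_filter; apply: cF; rewrite lexx ltW.
  + by apply: cvg_at_left_filter; apply: cF; rewrite lexx ltW.
- move=> x /[!in_itv]/= /andP[Ax xB]; rewrite derive1E.
  by have [] : is_derive x 1 F (f x) by apply: dF; rewrite !ltW.
Qed.

End segment_integral.

(** * Soft sublevel estimates and oscillatory integrals *)

Section soft_sublevel.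
Context {R : realType}.
Variables (A B : R).
Hypotheses (A1 : 1 < A) (AB : A < B).
Local Notation mu := (@lebesgue_measure R).

Let mAB : measurable `[A, B]%classic. Proof. exact: measurable_itv. Qed.

Lemma atan_abs_lt2 (x : R) : `|atan x| <= 2.
Proof.
have := atan_ltpi2 x; have := atan_gtNpi2 x; have := @pihalf_lt2 R.
rewrite ler_norml; lra.
Qed.

(* The integrand is, up to a bounded term, the derivative of
   [eta * phi' * atan (phi / eta)]. *)
Lemma deriv_soft_sublevel (p p1 p2 : R -> R) (M1 M2 eta : R) : 0 < eta ->
  (forall x, A <= x <= B -> is_derive x 1 p (p1 x)) ->
  (forall x, A <= x <= B -> is_derive x 1 p1 (p2 x)) ->
  con A B p2 ->
  (forall x, A <= x <= B -> `|p1 x| <= M1) ->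
  (forall x, A <= x <= B -> `|p2 x| <= M2) ->
  \int[mu]_(x in `[A, B]) (p1 x ^+ 2 * (eta ^+ 2 / (p x ^+ 2 + eta ^+ 2)))
    <= eta * (2 * (2 * M1 + (B - A) * M2)).
Proof.
move=> eta0 dp dp1 cp2 M1P M2P.
have den0 x : p x ^+ 2 + eta ^+ 2 != 0.
  by rewrite gt_eqF// ltr_wpDl ?sqr_ge0// exprn_gt0.
have cp := con_dv dp; have cp1 := con_dv dp1.
have dat x : A <= x <= B -> is_derive x 1 (fun x => atan (p x * eta^-1))
    (p1 x * eta / (p x ^+ 2 + eta ^+ 2)).
  move=> xAB; have := dv_atan (dvM (dp _ xAB) (dv_cst eta^-1 x)).
  move/dv_eq; apply; rewrite mulr0 add0r.
  have e0 : eta != 0 by rewrite gt_eqF.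
  have h : 1 + (p x * eta^-1) ^+ 2 != 0.
    by rewrite gt_eqF// ltr_wpDr// sqr_ge0.
  have := den0 x => den0x.
  by field; rewrite e0/= den0x.
have cat := con_dv dat.
pose G x := p1 x * atan (p x * eta^-1).
have cK : con A B (fun x => p1 x ^+ 2 * (eta ^+ 2 / (p x ^+ 2 + eta ^+ 2))).
  apply: conM; first exact: conX.
  apply: conM; first exact: con_cst.
  apply: conV => [x _|]; first exact: den0.
  by apply: conD; [exact: conX|exact: con_cst].
have cI : con A B (fun x => eta * (p2 x * atan (p x * eta^-1))).
  by apply: conM; [exact: con_cst|exact: conM].
have FTC : \int[mu]_(x in `[A, B]) (p1 x ^+ 2 * (eta ^+ 2 / (p x ^+ 2 + eta ^+ 2))
     + eta * (p2 x * atan (p x * eta^-1))) = eta * G B - eta * G A.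
  apply: (@Rintegral_FTC _ _ _ AB (fun x => eta * G x)); first exact: conD.
  move=> x xAB; apply: (dv_eq (dvZ eta (dvM (dp1 _ xAB) (dat _ xAB)))).
  ring.
rewrite RintegralD// in FTC; try exact: con_ig.
have b1 x : A <= x <= B -> `|G x| <= 2 * M1.
  move=> xAB; rewrite normrM mulrC ler_pM//; first exact: atan_abs_lt2.
  exact: M1P.
have bI : `|\int[mu]_(x in `[A, B]) (eta * (p2 x * atan (p x * eta^-1)))|
    <= eta * (M2 * 2) * (B - A).
  rewrite -segment_measureE//; apply: Rintegral_abs_bound => //.
  - exact: segment_measure_fin.
  - exact: con_ig.
  - move=> x /=; rewrite in_itv/= => xAB.
    rewrite normrM gtr0_norm// ler_wpM2l ?(ltW eta0)// normrM ler_pM//.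
      exact: M2P.
    exact: atan_abs_lt2.
have GB : `|G B| <= 2 * M1 by apply: b1; rewrite lexx (ltW AB).
have GA : `|G A| <= 2 * M1 by apply: b1; rewrite lexx (ltW AB).
have h1 : eta * G B <= eta * (2 * M1).
  by rewrite ler_wpM2l ?(ltW eta0)// (le_trans (ler_norm _)).
have h2 : - (eta * G A) <= eta * (2 * M1).
  by rewrite -mulrN ler_wpM2l ?(ltW eta0)// (le_trans (ler_norm _))// normrN.
move: bI; rewrite ler_norml => /andP[bI _].
lra.
Qed.

(** A polynomial in [1 / x] given by a list of terms. Exponents may repeat, so no normal form has to
    be maintained when terms are transformed one by one. *)
Definition laurent (l : seq (R * nat)) (x : R) : R :=
  \sum_(p <- l) p.1 * x^-1 ^+ p.2.

Definition dlaurent (l : seq (R * nat)) : seq (R * nat) :=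
  [seq (- (p.1 * p.2%:R), p.2.+1) | p <- l].

Definition coef_norm (I : Type) (l : seq (R * I)) : R := \sum_(p <- l) `|p.1|.

Lemma coef_norm_ge0 (I : Type) (l : seq (R * I)) : 0 <= coef_norm l.
Proof. by apply: sumr_ge0 => p _. Qed.

Lemma dv_laurent l (x : R) : x != 0 ->
  is_derive x 1 (laurent l) (laurent (dlaurent l) x).
Proof.
move=> x0; rewrite /laurent big_map; apply: dv_sum => -[c n] /=.
apply: (dv_eq (dvZ c (dvX n (dvV x0 (dv_id x))))) => /=.
case: n => [|n]; first by rewrite !(mulr0, mul0r) oppr0 mul0r.
rewrite -pred_Sn mulNr mul1r -exprVn !exprS expr0; ring.
Qed.

Lemma laurent_bound l (x : R) : 1 <= x -> `|laurent l x| <= coef_norm l.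
Proof.
move=> x1; apply: (le_trans (ler_norm_sum _ _ _)); apply: ler_sum => p _.
rewrite normrM ler_piMr// normrX exprn_ile1//.
by rewrite normfV invf_le1 ?ger0_norm ?(le_trans _ x1)// (lt_le_trans _ x1).
Qed.

Lemma coef_norm_dlaurent l (K : nat) : (forall p, p \in l -> (p.2 <= K)%N) ->
  coef_norm (dlaurent l) <= coef_norm l * K%:R.
Proof.
move=> lK; rewrite /coef_norm big_map mulr_suml big_seq [leRHS]big_seq.
apply: ler_sum => p pl /=; rewrite normrN normrM ler_wpM2l//.
by rewrite ger0_norm// ler_nat lK.
Qed.

(** Smooth substitute for the measure of the set where [c0 + laurent l] is at most [eta] in absolute
    value: the integrand is at least 1/2 there. Unlike the sublevel set, it can be treated by
    integration by parts. *)
Definition soft c0 l eta : R :=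
  \int[mu]_(x in `[A, B]) (eta ^+ 2 / ((c0 + laurent l x) ^+ 2 + eta ^+ 2)).

End soft_sublevel.

Section soft_sublevel_bound.
Context {R : realType}.
Variables (A B : R).
Hypotheses (A1 : 1 < A) (AB : A < B).
Local Notation mu := (@lebesgue_measure R).

Let mAB : measurable `[A, B]%classic. Proof. exact: measurable_itv. Qed.

Lemma con_laurent l : con A B (laurent l).
Proof.
apply: con_dv => x /andP[Ax _]; apply: dv_laurent.
by rewrite gt_eqF// (lt_trans _ (lt_le_trans A1 Ax)).
Qed.

Lemma con_soft (f : R -> R) (eta : R) : 0 < eta -> con A B f ->
  con A B (fun x => eta ^+ 2 / (f x ^+ 2 + eta ^+ 2)).
Proof.
move=> eta0 cf; apply: conM; first exact: con_cst.
apply: conV => [x _|].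
  by rewrite gt_eqF// ltr_wpDl ?sqr_ge0// exprn_gt0.
by apply: conD; [exact: conX|exact: con_cst].
Qed.

(** Where [g = x f1 + d f] is large against [nu], one of [f1] and [f] is large. Call the left side
    [s] and split it as [s nu^2 / (g^2 + nu^2) + s g^2 / (g^2 + nu^2)]. The second part is at most
    [s g^2 / nu^2], where [g^2 <= 2 x^2 f1^2 + 2 d^2 f^2], and [s f^2 <= eta^2]. *)
Lemma soft_pointwise (f f1 g eta nu x d K : R) :
  0 < eta -> 0 < nu -> 0 <= x <= B -> 0 <= d <= K ->
  g = x * f1 + d * f ->
  eta ^+ 2 / (f ^+ 2 + eta ^+ 2) <= nu ^+ 2 / (g ^+ 2 + nu ^+ 2)
    + (2 * B ^+ 2 / nu ^+ 2 * (f1 ^+ 2 * (eta ^+ 2 / (f ^+ 2 + eta ^+ 2)))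
    + 2 * K ^+ 2 / nu ^+ 2 * eta ^+ 2).
Proof.
move=> eta0 nu0 /andP[x0 xB] /andP[d0 dK] ->.
have e2 : 0 < eta ^+ 2 by rewrite exprn_gt0.
have n2 : 0 < nu ^+ 2 by rewrite exprn_gt0.
have den : 0 < f ^+ 2 + eta ^+ 2 by rewrite ltr_wpDl ?sqr_ge0.
set s := eta ^+ 2 / _.
have s0 : 0 <= s by rewrite divr_ge0// ltW.
have s1 : s <= 1 by rewrite ler_pdivrMr// mul1r lerDr sqr_ge0.
have sf : s * f ^+ 2 <= eta ^+ 2.
  rewrite /s mulrAC ler_pdivrMr//; apply: ler_wpM2l; first exact: ltW.
  by rewrite lerDl ltW.
set w := x * f1 + d * f.
have den2 : 0 < w ^+ 2 + nu ^+ 2 by rewrite ltr_wpDl ?sqr_ge0.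
have x2 : x ^+ 2 <= B ^+ 2 by rewrite ler_sqr ?nnegrE// (le_trans x0).
have d2 : d ^+ 2 <= K ^+ 2 by rewrite ler_sqr ?nnegrE// (le_trans d0).
have g2 : w ^+ 2 <= 2 * B ^+ 2 * f1 ^+ 2 + 2 * K ^+ 2 * f ^+ 2.
  have h1 : x ^+ 2 * f1 ^+ 2 <= B ^+ 2 * f1 ^+ 2 by rewrite ler_wpM2r ?sqr_ge0.
  have h2 : d ^+ 2 * f ^+ 2 <= K ^+ 2 * f ^+ 2 by rewrite ler_wpM2r ?sqr_ge0.
  have := sqr_ge0 (x * f1 - d * f).
  rewrite /w !expr2 in h1 h2 *; lra.
have sE : s = s * (nu ^+ 2 / (w ^+ 2 + nu ^+ 2)) + s * (w ^+ 2 / (w ^+ 2 + nu ^+ 2)).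
  by rewrite -mulrDr -mulrDl addrC divff ?mulr1// gt_eqF.
rewrite [leLHS]sE; apply: lerD.
  by rewrite ler_piMl// divr_ge0// ltW.
have h3 : s * (w ^+ 2 / (w ^+ 2 + nu ^+ 2)) <= s * (w ^+ 2 / nu ^+ 2).
  apply: ler_wpM2l => //; apply: ler_wpM2l; first exact: sqr_ge0.
  by rewrite lef_pV2 ?posrE// lerDr sqr_ge0.
apply: (le_trans h3).
rewrite [leLHS]mulrA ler_pdivrMr// mulrDl.
have -> : 2 * B ^+ 2 / nu ^+ 2 * (f1 ^+ 2 * s) * nu ^+ 2 = 2 * B ^+ 2 * (f1 ^+ 2 * s).
  by field; rewrite gt_eqF.
have -> : 2 * K ^+ 2 / nu ^+ 2 * eta ^+ 2 * nu ^+ 2 = 2 * K ^+ 2 * eta ^+ 2.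
  by field; rewrite gt_eqF.
have h4 : s * w ^+ 2 <= s * (2 * B ^+ 2 * f1 ^+ 2 + 2 * K ^+ 2 * f ^+ 2).
  exact: ler_wpM2l.
have h5 : 2 * K ^+ 2 * (s * f ^+ 2) <= 2 * K ^+ 2 * eta ^+ 2.
  by apply: ler_wpM2l => //; rewrite mulr_ge0// sqr_ge0.
lra.
Qed.

Lemma laurent_cons p l (x : R) :
  laurent (p :: l) x = p.1 * x^-1 ^+ p.2 + laurent l x.
Proof. by rewrite /laurent big_cons. Qed.

Lemma coef_norm_cons (I : Type) (p : R * I) l :
  coef_norm (p :: l) = `|p.1| + coef_norm l.
Proof. by rewrite /coef_norm big_cons. Qed.

(* Applying [x d/dx + d] removes the term of exponent [- d]. *)
Lemma soft_step (c0 : R) (c : R) (d K : nat) l (M nu : R) :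
  (1 <= d <= K)%N -> (forall p, p \in l -> (1 <= p.2 <= K)%N) ->
  coef_norm ((c, d) :: l) <= M -> 0 < nu ->
  soft A B c0 ((c, d) :: l) (nu ^+ 3) <=
    soft A B (c0 * d%:R) [seq (p.1 * (d%:R - p.2%:R), p.2) | p <- l] nu
    + (2 * B ^+ 2 * nu * (2 * (2 * (M * K%:R) + (B - A) * (M * (K%:R * K.+1%:R))))
    + 2 * K%:R ^+ 2 * nu ^+ 4 * (B - A)).
Proof.
move=> /andP[d1 dK] lK lM nu0.
set L := (c, d) :: l; set l' := [seq _ | p <- l].
pose f x := c0 + laurent L x; pose f1 := laurent (dlaurent L).
pose f2 := laurent (dlaurent (dlaurent L)).
pose g x := c0 * d%:R + laurent l' x.
have LK p : p \in L -> (p.2 <= K)%N.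
  by rewrite in_cons => /predU1P[->//|/lK/andP[]].
have x0 x : A <= x <= B -> x != 0.
  by move=> /andP[Ax _]; rewrite gt_eqF// (lt_trans _ (lt_le_trans A1 Ax)).
have x1 x : A <= x <= B -> 1 <= x.
  by move=> /andP[Ax _]; rewrite (le_trans (ltW A1)).
have M0 : 0 <= M by rewrite (le_trans _ lM)// coef_norm_ge0.
have df x : A <= x <= B -> is_derive x 1 f (f1 x).
  move=> xAB; apply: (dv_eq (dvD (dv_cst c0 x) (dv_laurent L (x0 _ xAB)))).
  by rewrite add0r.
have df1 x : A <= x <= B -> is_derive x 1 f1 (f2 x).
  by move=> xAB; apply: dv_laurent; exact: x0.
have n1 : coef_norm (dlaurent L) <= M * K%:R.
  by apply: (le_trans (coef_norm_dlaurent LK)); rewrite ler_wpM2r.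
have n2 : coef_norm (dlaurent (dlaurent L)) <= M * (K%:R * K.+1%:R).
  apply: (@le_trans _ _ (coef_norm (dlaurent L) * K.+1%:R)).
    apply: coef_norm_dlaurent => p /mapP[q qL ->] /=.
    by rewrite ltnS LK.
  by rewrite mulrA ler_wpM2r.
(* Choosing [eta = nu^3] beats the factor [nu^-2] of [soft_pointwise]: the error with the derivative
   becomes of order [nu], the other one of order [nu^4]. Each removed term thus costs a cube, whence
   the scale [rho ^+ (3 ^ m)] below. *)
have eta0 : 0 < nu ^+ 3 by rewrite exprn_gt0.
have := @deriv_soft_sublevel _ _ _ AB f f1 f2 (M * K%:R) (M * (K%:R * K.+1%:R)) _
  eta0 df df1 (@con_laurent _).
move=> /(_ (fun x xAB => le_trans (laurent_bound _ (x1 _ xAB)) n1)).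
move=> /(_ (fun x xAB => le_trans (laurent_bound _ (x1 _ xAB)) n2)) H.
have gE x : A <= x <= B -> g x = x * f1 x + d%:R * f x.
  move=> /x0 xn0.
  have e1 : laurent l' x = x * laurent (dlaurent l) x + d%:R * laurent l x.
    rewrite /laurent /dlaurent /l' !big_map !mulr_sumr -big_split/=.
    apply: eq_bigr => p _; rewrite exprS; move: (x^-1 ^+ p.2) => z.
    by field.
  rewrite /g /f1 /f /L /dlaurent map_cons -/(dlaurent l) !laurent_cons/= e1 exprS.
  by move: (x^-1 ^+ d) => z; field.
have cf : con A B f by exact: con_dv df.
have cg : con A B g by apply: conD; [exact: con_cst|exact: con_laurent].
have cf1 : con A B f1 by exact: con_laurent.
have cs := con_soft eta0 cf; have cs' := con_soft nu0 cg.
have c2 : con A B (fun x => f1 x ^+ 2 * ((nu ^+ 3) ^+ 2 / (f x ^+ 2 + (nu ^+ 3) ^+ 2))).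
  by apply: conM => //; exact: conX.
pose k1 := 2 * B ^+ 2 / nu ^+ 2; pose k2 := 2 * K%:R ^+ 2 / nu ^+ 2 * (nu ^+ 3) ^+ 2.
have c3 : con A B (fun x => k1 * (f1 x ^+ 2 * ((nu ^+ 3) ^+ 2 / (f x ^+ 2 + (nu ^+ 3) ^+ 2)))).
  by apply: conM => //; exact: con_cst.
have c4 : con A B (fun x : R => k2) by exact: con_cst.
have : soft A B c0 L (nu ^+ 3) <=
  \int[mu]_(x in `[A, B]) (nu ^+ 2 / (g x ^+ 2 + nu ^+ 2) +
   (k1 * (f1 x ^+ 2 * ((nu ^+ 3) ^+ 2 / (f x ^+ 2 + (nu ^+ 3) ^+ 2))) + k2)).
  apply: le_Rintegral => //; first exact: con_ig.
    by apply: con_ig; apply: conD => //; exact: conD.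
  move=> x /=; rewrite in_itv/= => xAB.
  apply: soft_pointwise (gE _ xAB) => //.
    by case/andP: (xAB) => _ ->; rewrite (le_trans _ (x1 _ xAB)).
  by rewrite ler0n ler_nat.
rewrite RintegralD//; [|exact: con_ig|by apply: con_ig; exact: conD].
rewrite RintegralD//; [|exact: con_ig|exact: con_ig].
rewrite (RintegralZl k1)//; last exact: con_ig.
rewrite Rintegral_cst// segment_measureE// => /le_trans; apply.
rewrite lerD2l; apply: lerD; last first.
  rewrite /k2; have -> : 2 * K%:R ^+ 2 / nu ^+ 2 * (nu ^+ 3) ^+ 2 = 2 * K%:R ^+ 2 * nu ^+ 4.
    by field; rewrite gt_eqF.
  by [].
apply: (@le_trans _ _ (k1 * (nu ^+ 3 *
    (2 * (2 * (M * K%:R) + (B - A) * (M * (K%:R * K.+1%:R))))))).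
  by apply: ler_wpM2l => //; rewrite /k1 divr_ge0// ?sqr_ge0// mulr_ge0// sqr_ge0.
rewrite le_eqVlt; apply/predU1P; left; rewrite /k1.
by field; rewrite gt_eqF.
Qed.

(** The first summand serves the empty list, the other two absorb the two error terms of
    [soft_step]. *)
Definition soft_const : R := (B - A) + 8 * B ^+ 2 * (2 + 2 * (B - A)) + 2 * (B - A).

(** Induction on the number of terms, with [c0] and [M] varying. Removing the term of exponent
    [d >= 1] multiplies [c0] by [d], so it stays at least 1 in absolute value, and multiplies the
    other coefficients by [d - e], so their norm grows by at most the factor [K]. When no term is
    left the integrand is at most [rho], since the constant is at least 1 in absolute value. *)
Lemma soft_bound (m : nat) l (c0 M rho : R) (K : nat) :
  size l = m -> (forall p, p \in l -> (1 <= p.2 <= K)%N) ->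
  coef_norm l <= M -> 1 <= M -> (1 <= K)%N -> 1 <= `|c0| -> 0 < rho <= 1 ->
  soft A B c0 l (rho ^+ (3 ^ m)) <= soft_const * m.+1%:R * M * K%:R ^+ (m + 2) * rho.
Proof.
move=> + + + + K1 + /andP[rho0 rho1].
have K1' : 1 <= K%:R :> R by rewrite ler1n.
have BA : 0 <= B - A by rewrite subr_ge0 ltW.
have B0 : 0 <= B ^+ 2 by exact: sqr_ge0.
have C0 : B - A <= soft_const.
  have : 0 <= B ^+ 2 * (B - A) by exact: mulr_ge0.
  rewrite /soft_const; lra.
have C1 : 8 * B ^+ 2 * (2 + 2 * (B - A)) + 2 * (B - A) <= soft_const.
  rewrite /soft_const; lra.
have pge1 n : 1 <= K%:R ^+ n :> R by exact: exprn_ege1.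
elim: m l c0 M => [|m ih] l c0 M.
  move=> /size0nil -> _ _ M1 c01; rewrite expn0 expr1 add0n mulr1.
  apply: (@le_trans _ _ (rho * (B - A))); last first.
    rewrite mulrC; apply: ler_wpM2r; first exact: ltW.
    apply: (le_trans C0); rewrite -mulrA ler_peMr ?(le_trans BA)//.
    by rewrite (le_trans M1)// ler_peMr// (le_trans _ M1).
  have cl : con A B (fun x => c0 + laurent [::] x).
    by apply: conD; [exact: con_cst|exact: con_laurent].
  rewrite /soft -segment_measureE//.
  apply: (le_trans (ler_norm _)); apply: Rintegral_abs_bound => //.
  - exact: segment_measure_fin.
  - exact/con_ig/con_soft.
  - move=> x _; rewrite /laurent big_nil addr0.
    have c2 : 1 <= c0 ^+ 2 by rewrite -real_normK ?num_real// exprn_ege1.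
    have den : 0 < c0 ^+ 2 + rho ^+ 2 by rewrite (lt_le_trans ltr01)// ler_wpDr// sqr_ge0.
    rewrite ger0_norm; last by rewrite divr_ge0 ?sqr_ge0// ltW.
    rewrite ler_pdivrMr// [leLHS]expr2 ler_wpM2l ?(ltW rho0)//.
    by rewrite (le_trans rho1)// ler_wpDr// sqr_ge0.
case: l => [//|[c d] l] /= [sl] lK lM M1 c01.
have /andP[d1 dK] : (1 <= d <= K)%N by exact: (lK (c, d) (mem_head _ _)).
have lK' p : p \in l -> (1 <= p.2 <= K)%N.
  by move=> pl; apply: lK; rewrite in_cons pl orbT.
set nu := rho ^+ (3 ^ m).
have nu0 : 0 < nu by rewrite exprn_gt0.
have nur : nu <= rho by rewrite -[leRHS]expr1 ler_wiXn2l// ?expn_gt0// ltW.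
have nu1 : nu <= 1 by rewrite (le_trans nur).
have nu4 : nu ^+ 4 <= rho.
  by rewrite (le_trans _ nur)// -[leRHS]expr1 ler_wiXn2l// ltW.
have -> : rho ^+ (3 ^ m.+1) = nu ^+ 3 by rewrite -exprM expnSr.
have d1K : (1 <= d <= K)%N by rewrite d1.
apply: (le_trans (soft_step c0 d1K lK' lM nu0)).
set l' := [seq _ | p <- l].
have := ih l' (c0 * d%:R) (M * K%:R); rewrite size_map => /(_ sl).
have h1 p : p \in l' -> (1 <= p.2 <= K)%N by move=> /mapP[q /lK' qK ->].
have h2 : coef_norm l' <= M * K%:R.
  have M0 : 0 <= M by rewrite (le_trans _ M1).
  apply: (@le_trans _ _ (coef_norm l * K%:R)); last first.
    rewrite ler_wpM2r//; apply: le_trans lM.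
    by rewrite coef_norm_cons/= lerDr.
  rewrite /coef_norm big_map mulr_suml big_seq [leRHS]big_seq.
  apply: ler_sum => p /lK'/andP[p1 pK] /=; rewrite normrM ler_wpM2l//.
  have pK' : (p.2%:R : R) <= K%:R by rewrite ler_nat.
  have dK' : (d%:R : R) <= K%:R by rewrite ler_nat.
  have := ler0n R p.2; have := ler0n R d.
  rewrite ler_norml; lra.
have h3 : 1 <= M * K%:R by rewrite (le_trans M1)// ler_peMr// (le_trans _ M1).
have h4 : 1 <= `|c0 * d%:R|.
  by rewrite normrM (le_trans c01)// ler_peMr// ger0_norm// ler1n.
move=> /(_ h1 h2 h3 h4) {}ih.
apply: (le_trans (lerD ih (lexx _))).
set P := K%:R ^+ (m + 2).
have PE : K%:R ^+ (m.+1 + 2) = K%:R * P by rewrite addSn exprS.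
have P1 : K%:R <= P.
  by rewrite -[leLHS]expr1; apply: ler_weXn2l => //; rewrite addn2.
have P2 : K%:R ^+ 2 <= P by rewrite ler_weXn2l// addn2.
set Q := M * (K%:R * P).
have M0 : 0 <= M by rewrite (le_trans _ M1).
have K0 : 0 <= K%:R :> R by [].
have Q1 : M * (K%:R * K.+1%:R) <= 2 * Q.
  rewrite /Q -natr1.
  have : M * (K%:R * K%:R) <= M * (K%:R * P) by rewrite !ler_wpM2l.
  have : M * (K%:R * 1) <= M * (K%:R * P).
    by rewrite !ler_wpM2l// (le_trans K1').
  lra.
have Q2 : M * K%:R <= Q.
  by rewrite /Q ler_wpM2l// ler_peMr// (le_trans K1').
have Q3 : K%:R ^+ 2 <= Q.
  rewrite /Q (le_trans P2)//.
  apply: (@le_trans _ _ (1 * (1 * P))); first by rewrite !mul1r.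
  have P0 : 0 <= P by rewrite (le_trans _ P1).
  by apply: ler_pM => //; [rewrite mul1r|exact: ler_wpM2r].
have Q0 : 0 <= Q by rewrite (le_trans _ Q3)// sqr_ge0.
rewrite PE.
have -> : soft_const * m.+2%:R * M * (K%:R * P) * rho =
   soft_const * m.+1%:R * Q * rho + soft_const * (Q * rho).
  by rewrite /Q -[m.+2%:R]natr1; ring.
have -> : soft_const * m.+1%:R * (M * K%:R) * P * rho = soft_const * m.+1%:R * Q * rho.
  by rewrite /Q; ring.
rewrite lerD2l.
apply: (@le_trans _ _ ((8 * B ^+ 2 * (2 + 2 * (B - A)) + 2 * (B - A)) * (Q * rho))); last first.
  by apply: ler_wpM2r => //; rewrite mulr_ge0// ltW.
rewrite [leRHS]mulrDl; apply: lerD.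
  have h5 : nu * (2 * (M * K%:R) + (B - A) * (M * (K%:R * K.+1%:R))) <=
     rho * ((2 + 2 * (B - A)) * Q).
    apply: ler_pM => //; first exact: ltW.
      by rewrite addr_ge0// mulr_ge0// mulr_ge0// mulr_ge0.
    have : (B - A) * (M * (K%:R * K.+1%:R)) <= (B - A) * (2 * Q) by rewrite ler_wpM2l.
    lra.
  have h6 : 0 <= B ^+ 2 * (rho * ((2 + 2 * (B - A)) * Q)).
    by apply: mulr_ge0 => //; apply: mulr_ge0; [exact: ltW|apply: mulr_ge0 => //; lra].
  have := ler_wpM2l B0 h5.
  set X := M * (K%:R * K.+1%:R) in h5 *; set Y := B ^+ 2 in h6 *; clearbody X Y.
  lra.
have h6 : K%:R ^+ 2 * nu ^+ 4 <= Q * rho.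
  by apply: ler_pM => //; rewrite exprn_ge0// ltW.
have := ler_wpM2r BA h6; lra.
Qed.

End soft_sublevel_bound.

(** * Oscillatory integrals with polynomial phase *)

Section oscillatory_integral.
Context {R : realType}.
Variables (A B : R).
Hypotheses (A1 : 1 < A) (AB : A < B).
Local Notation mu := (@lebesgue_measure R).

Let mAB : measurable `[A, B]%classic. Proof. exact: measurable_itv. Qed.

Let x_gt0 x : A <= x <= B -> 0 < x.
Proof. by move=> /andP[Ax _]; rewrite (lt_trans ltr01)// (lt_le_trans A1). Qed.

Definition spoly (l : seq (R * nat)) (x : R) : R := \sum_(p <- l) p.1 * x ^+ p.2.

Lemma dv_spoly l (x : R) :
  is_derive x 1 (spoly l) (\sum_(p <- l) p.1 * (p.2%:R * x ^+ p.2.-1)).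
Proof.
apply: dv_sum => p; apply: (dv_eq (dvZ p.1 (dvX p.2 (dv_id x)))).
by rewrite mulr1.
Qed.

(** The quotient is a regularised [1 / D], bounded also where [D] vanishes. The sharp bound would be
    [1 / (2 la)]; the weaker one has the same form as the bound for the derivative in the next
    lemma. *)
Lemma soft_kernel_bound (D la : R) : 0 < la <= 1 ->
  `|D / (D ^+ 2 + la ^+ 2)| <= la ^- 2.
Proof.
move=> /andP[la0 la1].
have l2 : 0 < la ^+ 2 by rewrite exprn_gt0.
have den : 0 < D ^+ 2 + la ^+ 2 by rewrite ltr_wpDl ?sqr_ge0.
rewrite normrM (gtr0_norm (x := _^-1)) ?invr_gt0// ler_pdivrMr//.
rewrite ler_pdivlMl//.
have h : `|D| * la ^+ 2 <= `|D| * la.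
  by rewrite ler_wpM2l// -[leRHS]expr1 ler_wiXn2l// ltW.
rewrite mulrC (le_trans h)//.
have := sqr_ge0 (`|D| - la); have := sqr_ge0 D; have := sqr_ge0 la.
rewrite -(real_normK (num_real D)) !expr2; nra.
Qed.

Lemma soft_kernel_deriv_bound (D la : R) : 0 < la ->
  `|(la ^+ 2 - D ^+ 2) / (D ^+ 2 + la ^+ 2) ^+ 2| <= la ^- 2.
Proof.
move=> la0.
have l2 : 0 < la ^+ 2 by rewrite exprn_gt0.
have den : 0 < D ^+ 2 + la ^+ 2 by rewrite ltr_wpDl ?sqr_ge0.
rewrite normrM (gtr0_norm (x := _^-1)) ?invr_gt0 ?exprn_gt0//.
rewrite ler_pdivrMr ?exprn_gt0// ler_pdivlMl//.
rewrite [leRHS]expr2; apply: ler_pM => //; first exact: ltW.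
  by rewrite lerDr sqr_ge0.
by have := sqr_ge0 D; rewrite ler_norml; lra.
Qed.

(** The derivative of the phase is [th x^(K-1) D], with [D] a nonzero constant plus negative powers
    of [x]. Split 1 as [D^2 / (D^2 + la^2) + la^2 / (D^2 + la^2)]. On the first part the integrand
    is the derivative of the sine of the phase times [h], the regularised reciprocal of the phase
    derivative, and integration by parts gains [A^-(K-1)]. The second part is a soft sublevel
    integral, whatever the oscillation. *)
Lemma osc_raw (m : nat) l (th a0 b M rho : R) (K : nat) :
  size l = m -> (forall p, p \in l -> (p.2 < K)%N) -> (1 <= K)%N ->
  0 < th -> 1 <= `|a0| -> coef_norm l <= M -> 1 <= M -> 0 < rho <= 1 ->
  `|\int[mu]_(x in `[A, B]) cos (th * (a0 * x ^+ K + spoly l x) + b)| <=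
    th^-1 * A^-1 ^+ K.-1 * (rho ^+ (3 ^ m)) ^- 2
      * (2 + (B - A) * (K%:R + M * K%:R ^+ 2)) +
    soft_const A B * m.+1%:R * (M * K%:R) * K%:R ^+ (m + 2) * rho.
Proof.
move=> sl lK K1 th0 a01 lM M1 rhoP; have /andP[rho0 rho1] := rhoP.
set la := rho ^+ _.
have la0 : 0 < la by rewrite exprn_gt0.
have la1 : la <= 1 by rewrite exprn_ile1// ltW.
have laP : 0 < la <= 1 by rewrite la0.
set Th := fun x => th * (a0 * x ^+ K + spoly l x) + b.
set lD := [seq (p.1 * p.2%:R, (K - p.2)%N) | p <- l].
set c0 := a0 * K%:R.
pose D x := c0 + laurent lD x; pose D1 := laurent (dlaurent lD).
have M0 : 0 <= M by rewrite (le_trans _ M1).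
have lDn : coef_norm lD <= M * K%:R.
  apply: (@le_trans _ _ (coef_norm l * K%:R)); last by rewrite ler_wpM2r.
  rewrite /coef_norm big_map mulr_suml big_seq [leRHS]big_seq.
  apply: ler_sum => p /lK pK /=; rewrite normrM ler_wpM2l//.
  by rewrite ger0_norm// ler_nat ltnW.
have lDK p : p \in lD -> (1 <= p.2 <= K)%N.
  by move=> /mapP[q /lK qK ->] /=; rewrite subn_gt0 qK leq_subr.
have c01 : 1 <= `|c0|.
  by rewrite normrM (le_trans a01)// ler_peMr// ger0_norm// ler1n.
have MK1 : 1 <= M * K%:R by rewrite (le_trans M1)// ler_peMr// ler1n.
have x0 x : A <= x <= B -> x != 0 by move=> /x_gt0; exact: lt0r_neq0.
have x1 x : A <= x <= B -> 1 <= x.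
  by move=> /andP[Ax _]; rewrite (le_trans (ltW A1)).
have dD x : A <= x <= B -> is_derive x 1 D (D1 x).
  move=> xAB; apply: (dv_eq (dvD (dv_cst c0 x) (dv_laurent lD (x0 _ xAB)))).
  by rewrite add0r.
have cD1 : con A B D1 by exact: con_laurent.
have D1b x : A <= x <= B -> `|D1 x| <= M * K%:R ^+ 2.
  move=> xAB; apply: (le_trans (laurent_bound _ (x1 _ xAB))).
  apply: (@le_trans _ _ (coef_norm lD * K%:R)).
    by apply: coef_norm_dlaurent => p /lDK/andP[].
  by rewrite expr2 mulrA ler_wpM2r.
have dTh x : A <= x <= B -> is_derive x 1 Th (th * (x ^+ K.-1 * D x)).
  move=> xAB; have xn0 := x0 _ xAB.
  apply: (dv_eq (dvD (dvZ th (dvD (dvZ a0 (dvX K (dv_id x))) (dv_spoly l x)))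
    (dv_cst b x))).
  rewrite addr0 mulr1 /D /c0 /laurent big_map; congr (th * _).
  rewrite mulrDr; congr (_ + _); first by ring.
  rewrite mulr_sumr big_seq [RHS]big_seq; apply: eq_bigr => p /lK pK /=.
  case: (p.2) pK => [|k] pK; first by rewrite !(mul0r, mulr0).
  have -> : x ^+ K.-1 = x ^+ k * x ^+ (K - k.+1).
    by rewrite -exprD -[in LHS](subnKC (ltnW pK)) addSn.
  rewrite exprVn /=; have : x ^+ (K - k.+1) != 0 by rewrite expf_neq0.
  by move: (x ^+ (K - k.+1)) (x ^+ k) => y z y0; field.
have cD := con_dv dD; have cTh := con_dv dTh.
have ccos : con A B (fun x => cos (Th x)).
  exact: (con_dv (fun x xAB => dv_cos (dTh x xAB))).
have csin : con A B (fun x => sin (Th x)).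
  exact: (con_dv (fun x xAB => dv_sin (dTh x xAB))).
have den x : 0 < D x ^+ 2 + la ^+ 2.
  by rewrite ltr_wpDl ?sqr_ge0// exprn_gt0.
pose q x := D x / (D x ^+ 2 + la ^+ 2).
pose q1 x := D1 x * ((la ^+ 2 - D x ^+ 2) / (D x ^+ 2 + la ^+ 2) ^+ 2).
have dq x : A <= x <= B -> is_derive x 1 q (q1 x).
  move=> xAB; have dx := dD _ xAB.
  have dd := dvD (dvX 2 dx) (dv_cst (la ^+ 2) x).
  have dn0 : D x ^+ 2 + la ^+ 2 != 0 by rewrite gt_eqF.
  apply: (dv_eq (dvM dx (@dvV _ (fun y => D y ^+ 2 + la ^+ 2) x _ dn0 dd))); rewrite /q1/=.
  by field.
have cq1 : con A B q1.
  apply: conM => //; apply: conM.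
    by apply: conB; [exact: con_cst|exact: conX].
  apply: conV => [x _|]; first by rewrite expf_neq0// gt_eqF.
  by apply: conX; apply: conD; [exact: conX|exact: con_cst].
pose y1 x : R := - (K.-1%:R * x^-1 ^+ K).
have dy x : A <= x <= B -> is_derive x 1 (fun x : R => x^-1 ^+ K.-1) (y1 x).
  move=> xAB; apply: (dv_eq (dvX K.-1 (dvV (x0 _ xAB) (dv_id x)))).
  rewrite /y1; case: (K) K1 => [//|[|k]] _; first by rewrite !mul0r oppr0.
  by rewrite -!pred_Sn mulNr mul1r -exprVn !exprS expr0; ring.
have cy := con_dv dy.
have cinv : con A B (fun x : R => x^-1).
  by apply: conV; [exact: x0|move=> x _; exact: cvg_id].
have cy1 : con A B y1.
  by apply: conN; apply: conM; [exact: con_cst|exact: conX].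
pose h x := th^-1 * (x^-1 ^+ K.-1 * q x).
pose h1 x := th^-1 * (x^-1 ^+ K.-1 * q1 x + q x * y1 x).
have dh x : A <= x <= B -> is_derive x 1 h (h1 x).
  by move=> xAB; exact: dvZ (dvM (dy _ xAB) (dq _ xAB)).
have cq := con_dv dq; have ch := con_dv dh.
have ch1 : con A B h1.
  apply: conM; first exact: con_cst.
  by apply: conD; exact: conM.
have cf1 : con A B (fun x => cos (Th x) * (D x ^+ 2 / (D x ^+ 2 + la ^+ 2))).
  apply: conM => //; apply: conM; first exact: conX.
  apply: conV => [x _|]; first by rewrite gt_eqF.
  by apply: conD; [exact: conX|exact: con_cst].
have cf2 := con_soft la0 cD.
have cf3 : con A B (fun x => cos (Th x) * (la ^+ 2 / (D x ^+ 2 + la ^+ 2))).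
  exact: conM.
have FTC : \int[mu]_(x in `[A, B]) (cos (Th x) * (D x ^+ 2 / (D x ^+ 2 + la ^+ 2))
   + sin (Th x) * h1 x) = sin (Th B) * h B - sin (Th A) * h A.
  apply: (@Rintegral_FTC _ _ _ AB (fun x => sin (Th x) * h x)).
    by apply: conD => //; exact: conM.
  move=> x xAB; apply: (dv_eq (dvM (dv_sin (dTh _ xAB)) (dh _ xAB))).
  rewrite addrC; congr (_ + _).
  rewrite /h /q exprVn; have := den x; have : x ^+ K.-1 != 0.
    by rewrite expf_neq0// x0.
  move: (x ^+ K.-1) => z z0 /lt0r_neq0 dn0; field.
  by rewrite dn0 z0 gt_eqF.
rewrite RintegralD// in FTC; [|exact: con_ig|by apply: con_ig; exact: conM].
set E := A^-1 ^+ K.-1.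
have A0 : 0 < A by rewrite (lt_trans ltr01).
have E0 : 0 <= E by rewrite exprn_ge0// invr_ge0 ltW.
have yb x : A <= x <= B -> 0 <= x^-1 ^+ K.-1 <= E.
  move=> xAB; have x00 := x_gt0 xAB; apply/andP; split.
    by rewrite exprn_ge0// invr_ge0 ltW.
  apply: lerXn2r; rewrite ?nnegrE ?invr_ge0 ?(ltW x00) ?(ltW A0)//.
  by rewrite lef_pV2 ?posrE//; case/andP: xAB.
have y1b x : A <= x <= B -> `|y1 x| <= K%:R * E.
  move=> xAB; have x00 := x_gt0 xAB; rewrite normrN normrM normr_nat.
  apply: ler_pM => //; first by rewrite ler_nat leq_pred.
  have /andP[y0 yE] := yb _ xAB.
  rewrite -(prednK K1) exprS ger0_norm ?mulr_ge0 ?invr_ge0 ?(ltW x00)//.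
  apply: le_trans yE; apply: ler_piMl => //.
  by rewrite invf_le1// x1.
have tE0 : 0 <= th^-1 * E * la ^- 2.
  by rewrite mulr_ge0 ?invr_ge0 ?sqr_ge0// mulr_ge0// invr_ge0 ltW.
have hb x : A <= x <= B -> `|h x| <= th^-1 * E * la ^- 2.
  move=> xAB; have /andP[y0 yE] := yb _ xAB.
  rewrite /h normrM gtr0_norm ?invr_gt0// -mulrA ler_wpM2l ?invr_ge0 ?(ltW th0)//.
  rewrite normrM ger0_norm// ler_pM//; exact: soft_kernel_bound.
have h1b x : A <= x <= B ->
    `|h1 x| <= th^-1 * E * la ^- 2 * (K%:R + M * K%:R ^+ 2).
  move=> xAB; have /andP[y0 yE] := yb _ xAB.
  have -> : th^-1 * E * la ^- 2 * (K%:R + M * K%:R ^+ 2) =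
      th^-1 * (E * (la ^- 2 * (K%:R + M * K%:R ^+ 2))) by rewrite !mulrA.
  rewrite /h1 normrM gtr0_norm ?invr_gt0// ler_wpM2l ?invr_ge0 ?(ltW th0)//.
  have -> : E * (la ^- 2 * (K%:R + M * K%:R ^+ 2)) =
      E * (M * K%:R ^+ 2 * la ^- 2) + la ^- 2 * (K%:R * E) by ring.
  apply: (le_trans (ler_normD _ _)); apply: lerD.
    rewrite normrM (ger0_norm y0) ler_pM// /q1 normrM ler_pM// ?D1b//.
    exact: soft_kernel_deriv_bound.
  have qb : `|q x| <= la ^- 2 by exact: soft_kernel_bound.
  have -> : `|q x * y1 x| = `|q x| * `|y1 x| by exact: normrM.
  by apply: ler_pM => //; exact: y1b.
have sinh x : A <= x <= B -> `|sin (Th x) * h x| <= th^-1 * E * la ^- 2.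
  move=> xAB; rewrite normrM -[leRHS]mul1r; apply: ler_pM => //; last exact: hb.
  by rewrite ler_norml sin_geN1 sin_le1.
have bI1 : `|\int[mu]_(x in `[A, B]) (sin (Th x) * h1 x)|
    <= th^-1 * E * la ^- 2 * (K%:R + M * K%:R ^+ 2) * (B - A).
  rewrite -segment_measureE//; apply: Rintegral_abs_bound => //.
  - exact: segment_measure_fin.
  - by apply: con_ig; exact: conM.
  - move=> x /=; rewrite in_itv/= => xAB.
    rewrite normrM -[leRHS]mul1r; apply: ler_pM => //; last exact: h1b.
    by rewrite ler_norml sin_geN1 sin_le1.
have bI2 : `|\int[mu]_(x in `[A, B]) (cos (Th x) * (la ^+ 2 / (D x ^+ 2 + la ^+ 2)))|
    <= soft_const A B * m.+1%:R * (M * K%:R) * K%:R ^+ (m + 2) * rho.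
  have slD : size lD = m by rewrite size_map.
  apply: le_trans (soft_bound A1 AB slD lDK lDn MK1 K1 c01 rhoP).
  apply: Rintegral_abs_le => //; [exact: con_ig|exact: con_ig|].
  move=> x _; have s0 : 0 <= la ^+ 2 / ((c0 + laurent lD x) ^+ 2 + la ^+ 2).
    by rewrite divr_ge0 ?sqr_ge0// addr_ge0// sqr_ge0.
  rewrite normrM (ger0_norm s0); apply: ler_piMl => //.
  by rewrite ler_norml cos_geN1 cos_le1.
have -> : \int[mu]_(x in `[A, B]) cos (Th x) =
   \int[mu]_(x in `[A, B]) (cos (Th x) * (D x ^+ 2 / (D x ^+ 2 + la ^+ 2))
     + cos (Th x) * (la ^+ 2 / (D x ^+ 2 + la ^+ 2))).
  apply: eq_Rintegral => x _; rewrite -mulrDr -mulrDl divff ?mulr1//.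
  by rewrite gt_eqF.
rewrite RintegralD//; try exact: con_ig.
apply: (le_trans (ler_normD _ _)); apply: lerD => //.
have AAB : A <= A <= B by rewrite lexx ltW.
have BAB : A <= B <= B by rewrite lexx ltW.
move/eqP: FTC; rewrite eq_sym -subr_eq => /eqP <-.
apply: (le_trans (ler_normB _ _)).
rewrite mulrDr; apply: lerD; last by rewrite [(B - A) * _]mulrC mulrA.
rewrite mulr_natr mulr2n; apply: (le_trans (ler_normB _ _)).
by apply: lerD; exact: sinh.
Qed.

Let osc_exponent (a K : nat) : ((2 * a + 1) * K = K + K * (a * 2))%N.
Proof. lia. Qed.

(* With [t ^+ (2 * 3 ^ m + 1) = A], the two error terms of [osc_raw] balance at
   [rho = t ^- K]. *)
Lemma osc_bound (th : R) (m : nat) : 0 < th ->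
  exists C r : R, [/\ 0 <= C, 0 < r < 1 & forall (K : nat) (a0 b M : R) l,
    (1 <= K)%N -> 1 <= `|a0| -> size l = m ->
    (forall p, p \in l -> (p.2 < K)%N) -> coef_norm l <= M -> 1 <= M ->
    `|\int[mu]_(x in `[A, B]) cos (th * (a0 * x ^+ K + spoly l x) + b)| <=
      C * M * K%:R ^+ (m + 3) * r ^+ K].
Proof.
move=> th0; set n := (2 * 3 ^ m + 1)%N.
have A0 : 0 < A by rewrite (lt_trans ltr01).
pose t := expR (ln A / n%:R).
have n0 : (n%:R : R) != 0 by rewrite pnatr_eq0 /n addn1.
have tn : t ^+ n = A by rewrite /t -expRM_natl mulrC divfK// lnK.
have t1 : 1 < t.
  by rewrite expR_gt1 divr_gt0 ?ln_gt0// ltr0n /n addn1.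
have t0 : 0 < t by rewrite (lt_trans ltr01).
have BA : 0 <= B - A by rewrite subr_ge0 ltW.
have sc0 : 0 <= soft_const A B.
  have : 0 <= B ^+ 2 * (B - A) by rewrite mulr_ge0 ?sqr_ge0.
  by have := sqr_ge0 B; rewrite /soft_const; nra.
set C1 := th^-1 * A * (2 + (B - A) * 2).
have C10 : 0 <= C1.
  by rewrite /C1 !mulr_ge0 ?invr_ge0 ?ltW// addr_gt0// ?mulr_gt0// subr_gt0.
exists (C1 + soft_const A B * m.+1%:R), t^-1; split.
- by rewrite addr_ge0// mulr_ge0.
- by rewrite invr_gt0 t0 invf_lt1.
move=> K a0 b M l K1 a01 sl lK lM M1.
have tK1 : 0 < t^-1 ^+ K <= 1.
  by rewrite exprn_gt0 ?invr_gt0//= exprn_ile1// ?invr_ge0 ?ltW// invf_lt1.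
apply: (le_trans (osc_raw b sl lK K1 th0 a01 lM M1 tK1)).
have K1' : 1 <= K%:R :> R by rewrite ler1n.
have M0 : 0 <= M by rewrite (le_trans _ M1).
set r := t^-1 ^+ K.
have r0 : 0 < r by case/andP: tK1.
set SC := soft_const A B in sc0 *.
have -> : (C1 + SC * m.+1%:R) * M * K%:R ^+ (m + 3) * r =
    C1 * M * K%:R ^+ (m + 3) * r + SC * m.+1%:R * (M * K%:R) * K%:R ^+ (m + 2) * r.
  by rewrite (_ : m + 3 = (m + 2).+1)%N ?addnS// exprS; ring.
apply: lerD; last by [].
have AE : A^-1 ^+ K.-1 * (r ^+ (3 ^ m)) ^- 2 = A * r.
  have h : A^-1 ^+ K.-1 = A * A^-1 ^+ K.
    by rewrite -[in RHS](prednK K1) exprS mulrA divff ?mul1r// gt_eqF.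
  have rn : A^-1 ^+ K = r * (r ^+ (3 ^ m)) ^+ 2.
    rewrite -tn /r -exprVn -!exprM -exprD; congr (_ ^+ _).
    exact: osc_exponent.
  rewrite h rn; have : r ^+ (3 ^ m) != 0 by rewrite expf_neq0// gt_eqF.
  by move: (r ^+ _) => z z0; field.
rewrite -(mulrA th^-1) AE /C1.
have KP : K%:R ^+ 2 <= K%:R ^+ (m + 3) :> R by rewrite ler_weXn2l// addn3.
have KP1 : K%:R <= K%:R ^+ 2 :> R by rewrite expr2 ler_peMr.
have K2 : 1 <= K%:R ^+ 2 :> R by rewrite exprn_ege1.
set P := K%:R ^+ (m + 3) in KP *.
have h : 2 + (B - A) * (K%:R + M * K%:R ^+ 2) <= (2 + (B - A) * 2) * (M * P).
  have h1 : K%:R ^+ 2 <= M * P by rewrite -[leLHS]mul1r ler_pM// sqr_ge0.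
  have h2 : K%:R + M * K%:R ^+ 2 <= 2 * (M * P).
    have : M * K%:R ^+ 2 <= M * P by rewrite ler_wpM2l.
    lra.
  have := ler_wpM2l BA h2; nra.
have ptr : 0 <= th^-1 * (A * r).
  by rewrite mulr_ge0// ?invr_ge0 ?(ltW th0)// mulr_ge0// ltW.
apply: (le_trans (ler_wpM2l ptr h)).
by rewrite le_eqVlt; apply/predU1P; left; ring.
Qed.
End oscillatory_integral.

(** * Moments of lacunary trigonometric sums *)

Section trig_polynomials.
Context {R : realType}.
Local Notation mu := (@lebesgue_measure R).

(* [(c, (a, b))] stands for the term [c * cos (2 pi a u + b)]. *)
Definition trigpoly := seq (R * (int * R)).

Implicit Types (g h : trigpoly) (u : R).

Definition tpeval g u : R :=
  \sum_(p <- g) p.1 * cos (2 * pi * p.2.1%:~R * u + p.2.2).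

(** Frequencies may repeat and may be negative, so each term of frequency 0 contributes the cosine
    of its phase. By [tpmeanE] this is the integral over one period. *)
Definition tpmean g : R := \sum_(p <- g | p.2.1 == 0) p.1 * cos p.2.2.

Definition tpmul g h : trigpoly :=
  [seq (p.1 * q.1 / 2, (p.2.1 + q.2.1, p.2.2 + q.2.2)) | p <- g, q <- h] ++
  [seq (p.1 * q.1 / 2, (p.2.1 - q.2.1, p.2.2 - q.2.2)) | p <- g, q <- h].

Definition tpcst (c : R) : trigpoly := [:: (c, (0, 0))].

Definition tpscale (c : R) g : trigpoly := [seq (c * p.1, p.2) | p <- g].

Definition tppow g n : trigpoly := iter n (tpmul g) (tpcst 1).

Definition tpshift (s : R) g : trigpoly :=
  [seq (p.1, (p.2.1, p.2.2 - 2 * pi * p.2.1%:~R * s)) | p <- g].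

Definition tpdeg_le (H : nat) g := forall p, p \in g -> (`|p.2.1| <= H)%N.

Lemma cosM (a b : R) : cos a * cos b = (cos (a + b) + cos (a - b)) / 2.
Proof. by rewrite cosD cosB; field. Qed.

Lemma tpeval_mul g h u : tpeval (tpmul g h) u = tpeval g u * tpeval h u.
Proof.
rewrite /tpeval /tpmul big_cat/= !big_allpairs_dep -big_split/= mulr_suml.
apply: eq_bigr => p _; rewrite -big_split/= mulr_sumr; apply: eq_bigr => q _ /=.
have -> : 2 * pi * (p.2.1 + q.2.1)%:~R * u + (p.2.2 + q.2.2) =
  (2 * pi * p.2.1%:~R * u + p.2.2) + (2 * pi * q.2.1%:~R * u + q.2.2).
  by rewrite intrD; ring.
have -> : 2 * pi * (p.2.1 - q.2.1)%:~R * u + (p.2.2 - q.2.2) =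
  (2 * pi * p.2.1%:~R * u + p.2.2) - (2 * pi * q.2.1%:~R * u + q.2.2).
  by rewrite intrB; ring.
by rewrite mulrACA cosM; field.
Qed.

Lemma tpeval_cst c u : tpeval (tpcst c) u = c.
Proof. by rewrite /tpeval big_seq1/= mulr0 mul0r addr0 cos0 mulr1. Qed.

Lemma tpeval_pow g n u : tpeval (tppow g n) u = tpeval g u ^+ n.
Proof.
elim: n => [|n ih]; first by rewrite tpeval_cst.
by rewrite exprS -ih -tpeval_mul.
Qed.

Lemma tpeval_cat g h u : tpeval (g ++ h) u = tpeval g u + tpeval h u.
Proof. by rewrite /tpeval big_cat. Qed.

Lemma tpeval_scale c g u : tpeval (tpscale c g) u = c * tpeval g u.
Proof.
by rewrite /tpeval big_map mulr_sumr; apply: eq_bigr => p _; rewrite mulrA.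
Qed.

Lemma tpeval_shift s g u : tpeval (tpshift s g) u = tpeval g (u - s).
Proof.
rewrite /tpeval big_map; apply: eq_bigr => p _ /=; congr (_ * cos _).
by rewrite mulrBr addrA addrAC.
Qed.

Lemma tpmean_cat g h : tpmean (g ++ h) = tpmean g + tpmean h.
Proof. by rewrite /tpmean big_cat. Qed.

Lemma tpmean_scale c g : tpmean (tpscale c g) = c * tpmean g.
Proof.
by rewrite /tpmean big_map mulr_sumr; apply: eq_bigr => p _; rewrite mulrA.
Qed.

Lemma tpmean_shift s g : tpmean (tpshift s g) = tpmean g.
Proof.
rewrite /tpmean big_map; apply: eq_bigr => p /= /eqP ->.
by rewrite mulr0 mul0r subr0.
Qed.

Lemma tpmean_cst c : tpmean (tpcst c) = c.
Proof. by rewrite /tpmean big_cons big_nil eqxx cos0 mulr1 addr0. Qed.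

Lemma coef_norm_cat (I : Type) (g h : seq (R * I)) :
  coef_norm (g ++ h) = coef_norm g + coef_norm h.
Proof. by rewrite /coef_norm big_cat. Qed.

Lemma coef_norm_mul g h : coef_norm (tpmul g h) = coef_norm g * coef_norm h.
Proof.
rewrite /coef_norm /tpmul big_cat/= !big_allpairs_dep -big_split/= mulr_suml.
apply: eq_bigr => p _; rewrite -big_split/= mulr_sumr; apply: eq_bigr => q _ /=.
by rewrite !normrM normfV normr_nat; field.
Qed.

Lemma coef_norm_scale c g : coef_norm (tpscale c g) = `|c| * coef_norm g.
Proof.
by rewrite /coef_norm big_map mulr_sumr; apply: eq_bigr => p _; rewrite normrM.
Qed.

Lemma coef_norm_shift s g : coef_norm (tpshift s g) = coef_norm g.
Proof. by rewrite /coef_norm big_map. Qed.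

Lemma coef_norm_cst (c : R) : coef_norm (tpcst c) = `|c|.
Proof. by rewrite /coef_norm big_seq1. Qed.

Lemma coef_norm_pow g n : coef_norm (tppow g n) = coef_norm g ^+ n.
Proof.
elim: n => [|n ih]; first by rewrite coef_norm_cst normr1.
by rewrite exprS -ih -coef_norm_mul.
Qed.

Lemma tpdeg_mul H1 H2 g h : tpdeg_le H1 g -> tpdeg_le H2 h ->
  tpdeg_le (H1 + H2) (tpmul g h).
Proof.
move=> gH hH p; rewrite mem_cat => /orP[] /allpairsP[[q r] /= [/gH + /hH + ->]] /=;
  by move: q.2.1 r.2.1 => a b; lia.
Qed.

Lemma tpdeg_pow H g n : tpdeg_le H g -> tpdeg_le (n * H) (tppow g n).
Proof.
move=> gH; elim: n => [|n ih]; first by move=> p; rewrite mem_seq1 => /eqP ->.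
by rewrite mulSn; exact: tpdeg_mul.
Qed.

Lemma tpdeg_scale H c g : tpdeg_le H g -> tpdeg_le H (tpscale c g).
Proof. by move=> gH p /mapP[q /gH qH ->]. Qed.

Lemma tpdeg_shift H s g : tpdeg_le H g -> tpdeg_le H (tpshift s g).
Proof. by move=> gH p /mapP[q /gH qH ->]. Qed.

Lemma tpdeg_cat H g h : tpdeg_le H g -> tpdeg_le H h -> tpdeg_le H (g ++ h).
Proof. by move=> gH hH p; rewrite mem_cat => /orP[/gH|/hH]. Qed.

Lemma tpdegW H H' g : (H <= H')%N -> tpdeg_le H g -> tpdeg_le H' g.
Proof. by move=> HH' gH p /gH /leq_trans; apply. Qed.

Lemma tpdeg_exists g : exists H, tpdeg_le H g.
Proof.
elim: g => [|p g [H gH]]; first by exists 0%N.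
exists (maxn `|p.2.1| H) => q; rewrite in_cons => /predU1P[->|/gH]; first exact: leq_maxl.
by move=> /leq_trans; apply; exact: leq_maxr.
Qed.

Lemma tpeval_bound g u : `|tpeval g u| <= coef_norm g.
Proof.
apply: (le_trans (ler_norm_sum _ _ _)); apply: ler_sum => p _.
by rewrite normrM ler_piMr// ler_norml cos_geN1 cos_le1.
Qed.

Lemma dv_tpeval g u : is_derive u 1 (tpeval g)
  (\sum_(p <- g) p.1 * (- sin (2 * pi * p.2.1%:~R * u + p.2.2) * (2 * pi * p.2.1%:~R))).
Proof.
apply: dv_sum => p; apply: dvZ; apply: dv_cos.
apply: (dv_eq (dvD (dvZ _ (dv_id u)) (dv_cst p.2.2 u))).
by rewrite mulr1 addr0.
Qed.

Lemma continuous_tpeval g : continuous (tpeval g).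
Proof. by move=> u; exact: dv_continuous (dv_tpeval g u). Qed.

Lemma cosD2piz (a : int) (x : R) : cos (x + 2 * pi * a%:~R) = cos x.
Proof.
have -> : 2 * pi * a%:~R = (pi *+ 2) *~ a :> R.
  by rewrite -[RHS]mulrzr mulr_natl.
have cn (n : nat) y : cos (y + pi *+ 2 *+ n) = cos y :> R.
  elim: n => [|n ih]; first by rewrite addr0.
  by rewrite mulrSr addrA cosD2pi ih.
case: a => n; first by rewrite -pmulrn cn.
by rewrite NegzE mulrNz -pmulrn -[in RHS](subrK (pi *+ 2 *+ n.+1) x) cn.
Qed.

Lemma tpmeanE g : \int[mu]_(x in `[0, 1]) tpeval g x = tpmean g.
Proof.
have H01 : (0 : R) < 1 by [].
pose P (p : R * (int * R)) (x : R) := p.1 *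
  (if p.2.1 == 0 then cos p.2.2 * x
   else sin (2 * pi * p.2.1%:~R * x + p.2.2) / (2 * pi * p.2.1%:~R)).
have dP p (x : R) : is_derive x 1 (P p)
    (p.1 * cos (2 * pi * p.2.1%:~R * x + p.2.2)).
  rewrite /P; case: (altP (p.2.1 =P 0)) => [->|a0].
    apply: (dv_eq (dvZ _ (dvZ _ (dv_id x)))).
    by rewrite mulr1 mulr0 mul0r add0r.
  have h := dvD (dvZ (2 * pi * p.2.1%:~R) (dv_id x)) (dv_cst p.2.2 x).
  have h2 := dvZ p.1 (dvM (dv_sin h) (dv_cst (2 * pi * p.2.1%:~R)^-1 x)).
  apply: (dv_eq h2).
  rewrite mulr0 add0r mulr1 addr0; congr (_ * _).
  by rewrite mulrC mulfK// !mulf_neq0 ?intr_eq0// gt_eqF// pi_gt0.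
have ct : con 0 1 (tpeval g) by move=> x _; exact: continuous_tpeval.
have dt (x : R) : 0 <= x <= 1 ->
    is_derive x 1 (fun x => \sum_(p <- g) P p x) (tpeval g x).
  by move=> _; exact: dv_sum.
rewrite (Rintegral_FTC H01 ct dt).
rewrite -sumrB /tpmean [RHS]big_mkcond/=; apply: eq_bigr => p _.
rewrite /P; case: ifPn => _; first by rewrite mulr1 mulr0 mulr0 subr0.
have -> : 2 * pi * p.2.1%:~R * 1 + p.2.2 = p.2.2 - pi / 2 + 2 * pi * p.2.1%:~R + pi / 2.
  by field.
have -> : 2 * pi * p.2.1%:~R * 0 + p.2.2 = p.2.2 - pi / 2 + pi / 2 by field.
by rewrite !sinDpihalf cosD2piz subrr.
Qed.

End trig_polynomials.

(** * Decorrelation of trigonometric sums along increasing powers *)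

Section trig_correlations.
Context {R : realType}.
Variables (A B xi : R).
Hypotheses (A1 : 1 < A) (AB : A < B) (xi0 : 0 < xi).
Local Notation mu := (@lebesgue_measure R).

Let mAB : measurable `[A, B]%classic. Proof. exact: measurable_itv. Qed.

Implicit Types (g h : @trigpoly R) (l : seq nat).

Definition tpsum g l (x : R) : R := \sum_(k <- l) tpeval g (xi * x ^+ k).

Lemma con_tpeval g k : con A B (fun x => tpeval g (xi * x ^+ k)).
Proof.
apply: con_dv => x _; apply: dv_comp; first exact: dv_tpeval.
exact: dvZ (dvX k (dv_id x)).
Qed.

Lemma con_sum (I : Type) (s : seq I) (F : I -> R -> R) :
  (forall i, con A B (F i)) -> con A B (fun x => \sum_(i <- s) F i x).
Proof.
move=> cF; elim: s => [|i s ih].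
  rewrite (_ : (fun x => _) = fun=> 0); first exact: con_cst.
  by apply/funext => y; rewrite big_nil.
rewrite (_ : (fun x => _) = fun x => F i x + \sum_(i <- s) F i x).
  exact: conD.
by apply/funext => y; rewrite big_cons.
Qed.

Lemma con_tpsum g l : con A B (tpsum g l).
Proof. by apply: con_sum => k; exact: con_tpeval. Qed.

Lemma con_cos_spoly (th a0 b : R) j acc :
  con A B (fun x => cos (th * (a0 * x ^+ j + spoly acc x) + b)).
Proof.
exact: (con_dv (fun x _ => dv_cos (dvD (dvZ th (dvD (dvZ a0 (dvX j (dv_id x)))
  (dv_spoly acc x))) (dv_cst b x)))).
Qed.

(** By the product-to-sum formula a factor [tpsum] only adds one entry to the list of lower terms of
    the phase. The family of integrands is therefore closed under multiplication by [tpsum], which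
    drives the next induction. *)
Lemma cos_tpsum g l (th a0 b x : R) j acc : th = 2 * pi * xi ->
  cos (th * (a0 * x ^+ j + spoly acc x) + b) * tpsum g l x =
  \sum_(k <- l) \sum_(p <- g) p.1 / 2 *
   (cos (th * (a0 * x ^+ j + spoly ((p.2.1%:~R, k) :: acc) x) + (b + p.2.2)) +
    cos (th * (a0 * x ^+ j + spoly ((- p.2.1%:~R, k) :: acc) x) + (b - p.2.2))).
Proof.
move=> ->; rewrite /tpsum mulr_sumr; apply: eq_bigr => k _.
rewrite /tpeval mulr_sumr; apply: eq_bigr => p _.
pose X := 2 * pi * xi * (a0 * x ^+ j + spoly acc x) + b.
pose Y := 2 * pi * p.2.1%:~R * (xi * x ^+ k) + p.2.2.
rewrite -/X -/Y.
rewrite [X in cos X + _](_ : _ = X + Y); last first.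
  by rewrite /X /Y /spoly big_cons/=; ring.
rewrite [X in _ + cos X](_ : _ = X - Y); last first.
  by rewrite /X /Y /spoly big_cons/=; ring.
by rewrite mulrCA cosM; field.
Qed.

(** The power is expanded one factor at a time while the leading term [a0 x^j] stays in place, all
    other exponents being smaller than [j]. The number of entries plus the number of remaining
    factors is constantly [n], so a single oscillatory bound for lists of length [n] serves all
    stages. Each factor brings at most [j] summands of total weight [coef_norm g] and enlarges the
    lower coefficients by at most [H]. *)
Lemma osc_tpsum g H (n : nat) (C r th : R) : 0 <= C -> 0 <= r ->
  th = 2 * pi * xi -> tpdeg_le H g ->
  (forall (K : nat) (a0 b M : R) (l : seq (R * nat)),
    (1 <= K)%N -> 1 <= `|a0| -> size l = n ->
    (forall p, p \in l -> (p.2 < K)%N) -> coef_norm l <= M -> 1 <= M ->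
    `|\int[mu]_(x in `[A, B]) cos (th * (a0 * x ^+ K + spoly l x) + b)| <=
      C * M * K%:R ^+ (n + 3) * r ^+ K) ->
  forall q m, (m + q = n)%N -> forall (j : nat) (a0 b M : R) (acc : seq (R * nat)) l,
    (1 <= j)%N -> 1 <= `|a0| -> size acc = m ->
    (forall p, p \in acc -> (p.2 < j)%N) -> coef_norm acc <= M -> 1 <= M ->
    (forall k, k \in l -> (k < j)%N) -> (size l <= j)%N ->
    `|\int[mu]_(x in `[A, B])
       (cos (th * (a0 * x ^+ j + spoly acc x) + b) * tpsum g l x ^+ q)| <=
    (j%:R * coef_norm g) ^+ q * (C * (M + (q * H)%:R) * j%:R ^+ (n + 3) * r ^+ j).
Proof.
move=> C0 r0 thE gH osc; elim=> [|q ih] m mqn j a0 b M acc l j1 a01 sacc accj accM M1 lj sl.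
  rewrite expr0 mul1r mul0n addr0.
  rewrite [X in `|X|](_ : _ =
      \int[mu]_(x in `[A, B]) cos (th * (a0 * x ^+ j + spoly acc x) + b)).
    by apply: osc => //; rewrite sacc -mqn addn0.
  by apply: eq_Rintegral => x _; rewrite expr0 mulr1.
set Bd := (j%:R * coef_norm g) ^+ q * (C * (M + (q.+1 * H)%:R) * j%:R ^+ (n + 3) * r ^+ j).
pose W (s : R) (p : R * (int * R)) k x :=
  cos (th * (a0 * x ^+ j + spoly ((s * p.2.1%:~R, k) :: acc) x) + (b + s * p.2.2))
  * tpsum g l x ^+ q.
have cW s p k : con A B (W s p k).
  apply: conM; first exact: con_cos_spoly.
  by apply: conX; exact: con_tpsum.
have bW s p k : (`|s| = 1) -> p \in g -> k \in l ->
    `|\int[mu]_(x in `[A, B]) W s p k x| <= Bd.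
  move=> s1 pg kl; have := ih m.+1; rewrite addSnnS => /(_ mqn) {}ih.
  apply: (le_trans (ih j a0 _ (M + H%:R) _ _ j1 a01 _ _ _ _ lj sl)).
  - by rewrite /= sacc.
  - by move=> p'; rewrite in_cons => /predU1P[->|/accj//]; exact: lj.
  - rewrite coef_norm_cons/= addrC; apply: lerD => //.
    by rewrite normrM s1 mul1r -intr_norm -natr_absz ler_nat; exact: gH.
  - by rewrite (le_trans M1)// lerDl.
  by rewrite /Bd mulSn natrD addrA.
rewrite [X in `|X|](_ : _ = \int[mu]_(x in `[A, B])
   (\sum_(k <- l) \sum_(p <- g) (p.1 / 2) * (W 1 p k x + W (- 1) p k x))); last first.
  apply: eq_Rintegral => x _; rewrite exprS mulrA (cos_tpsum g l _ _ _ _ _ thE) mulr_suml.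
  apply: eq_bigr => k _; rewrite mulr_suml; apply: eq_bigr => p _.
  by rewrite /W !mul1r !mulN1r -mulrDl mulrA.
have ctm p k : con A B (fun x => p.1 / 2 * (W 1 p k x + W (-1) p k x)).
  by apply: conM; [exact: con_cst|exact: conD].
rewrite Rintegral_sum//; last first.
  by move=> k _; apply: con_ig => //; apply: con_sum => p.
apply: (le_trans (ler_norm_sum _ _ _)).
have Bd0 : 0 <= Bd.
  rewrite /Bd !mulr_ge0// ?exprn_ge0// ?mulr_ge0 ?coef_norm_ge0//.
  by rewrite addr_ge0// (le_trans _ M1).
apply: (@le_trans _ _ (\sum_(k <- l) coef_norm g * Bd)); last first.
  rewrite big_const_seq count_predT iter_addr_0 -[leLHS]mulr_natl exprS.
  rewrite -[X in _ <= X]mulrA -/Bd mulrA.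
  apply: ler_wpM2r => //; apply: ler_wpM2r; first exact: coef_norm_ge0.
  by rewrite ler_nat.
rewrite big_seq [leRHS]big_seq; apply: ler_sum => k kl.
rewrite Rintegral_sum//; last by move=> p _; exact: con_ig.
apply: (le_trans (ler_norm_sum _ _ _)).
rewrite /coef_norm mulr_suml big_seq [leRHS]big_seq; apply: ler_sum => p pg.
rewrite RintegralZl//; last by apply: con_ig => //; exact: conD.
rewrite RintegralD//; try exact: con_ig.
rewrite normrM normrM normfV normr_nat -mulrA ler_wpM2l//.
rewrite ler_pdivrMl//; apply: (le_trans (ler_normD _ _)).
rewrite mulr_natl mulr2n.
by apply: lerD; apply: bW => //; rewrite ?normrN normr1.
Qed.

End trig_correlations.

Section moment_asymptotics.
Context {R : realType}.
Variables (A B xi : R).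
Hypotheses (A1 : 1 < A) (AB : A < B) (xi0 : 0 < xi).
Local Notation mu := (@lebesgue_measure R).

Let mAB : measurable `[A, B]%classic. Proof. exact: measurable_itv. Qed.
Let BA0 : 0 < B - A. Proof. by rewrite subr_gt0. Qed.

Definition avg (h : R -> R) : R := (B - A)^-1 * \int[mu]_(x in `[A, B]) h x.

Local Notation ig := (ig mu `[A, B]).

Lemma avg_eq f g : (forall x, A <= x <= B -> f x = g x) -> avg f = avg g.
Proof.
move=> fg; congr (_ * _); apply: eq_Rintegral => x /set_mem/=.
by rewrite in_itv/=; exact: fg.
Qed.

Lemma avgD f g : ig f -> ig g -> avg (fun x => f x + g x) = avg f + avg g.
Proof. by move=> If Ig; rewrite /avg RintegralD// mulrDr. Qed.

Lemma avgB f g : ig f -> ig g -> avg (fun x => f x - g x) = avg f - avg g.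
Proof. by move=> If Ig; rewrite /avg RintegralB// mulrBr. Qed.

Lemma avgZ c f : ig f -> avg (fun x => c * f x) = c * avg f.
Proof. by move=> If; rewrite /avg RintegralZl// mulrCA. Qed.

Lemma avg_cst c : avg (fun=> c) = c.
Proof.
rewrite /avg Rintegral_cst// segment_measureE// mulrC mulfK//.
by rewrite gt_eqF.
Qed.

Lemma avg_sum (I : eqType) (s : seq I) (F : I -> R -> R) :
  (forall i, i \in s -> ig (F i)) ->
  avg (fun x => \sum_(i <- s) F i x) = \sum_(i <- s) avg (F i).
Proof. by move=> IF; rewrite /avg Rintegral_sum// mulr_sumr. Qed.

Lemma avg_le f g : ig f -> ig g -> (forall x, A <= x <= B -> f x <= g x) ->
  avg f <= avg g.
Proof.
move=> If Ig fg; rewrite ler_wpM2l ?invr_ge0 ?(ltW BA0)//.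
by apply: le_Rintegral => // x /=; rewrite in_itv/=; exact: fg.
Qed.

Lemma avg_abs_le f g : ig f -> ig g -> (forall x, A <= x <= B -> `|f x| <= g x) ->
  `|avg f| <= avg g.
Proof.
move=> If Ig fg; rewrite normrM gtr0_norm ?invr_gt0// ler_wpM2l ?invr_ge0 ?(ltW BA0)//.
by apply: Rintegral_abs_le => // x /=; rewrite in_itv/=; exact: fg.
Qed.

Lemma ig_cst (c : R) : ig (fun=> c).
Proof. by apply: con_ig; exact: con_cst. Qed.

(** Induction on [e]: with [v] the square root of [r], one copy of [v^K] goes to the induction
    hypothesis, the other bounds [K v^K] through Bernoulli's inequality for [1 / v]. *)
Lemma natpow_geometric_bounded (e : nat) (r : R) : 0 < r < 1 ->
  exists C : R, 0 <= C /\ forall K : nat, K%:R ^+ e * r ^+ K <= C.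
Proof.
elim: e r => [|e ih] r /andP[r0 r1].
  by exists 1; split=> // K; rewrite expr0 mul1r exprn_ile1// ltW.
pose v := Num.sqrt r.
have v0 : 0 < v by rewrite sqrtr_gt0.
have vr : v ^+ 2 = r by rewrite sqr_sqrtr// ltW.
have v1 : v < 1 by rewrite -(@ltr_pXn2r _ 2%N) ?nnegrE ?(ltW v0)// vr expr1n.
have /ih[C [C0 CP]] : 0 < v < 1 by rewrite v0.
pose x := v^-1 - 1.
have x0 : 0 < x by rewrite subr_gt0 invf_gt1.
exists (C * x^-1); split; first by rewrite mulr_ge0// invr_ge0 ltW.
move=> K; have -> : K%:R ^+ e.+1 * r ^+ K = (K%:R ^+ e * v ^+ K) * (K%:R * v ^+ K).
  by rewrite -vr exprAC exprS; ring.
have h : K%:R * v ^+ K <= x^-1.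
  have : 1 + K%:R * x <= v^-1 ^+ K.
    have -> : v^-1 = 1 + x by rewrite /x addrC subrK.
    elim: K => [|K IH]; first by rewrite mul0r addr0.
    rewrite exprS (le_trans _ (ler_wpM2l _ IH))//; last by rewrite addr_ge0// ltW.
    have : 0 <= K%:R * (x * x) by rewrite mulr_ge0// mulr_ge0// ltW.
    rewrite -natr1; lra.
  rewrite exprVn => h.
  rewrite -ler_pdivlMr ?exprn_gt0//; apply: le_trans (_ : v ^- K / x <= _).
    by rewrite ler_pdivlMr//; lra.
  by rewrite mulrC.
apply: (le_trans (ler_pM _ _ (CP K) h)) => //.
  by rewrite mulr_ge0// ?exprn_ge0// ltW.
by rewrite mulr_ge0// exprn_ge0// ltW.
Qed.

(** The terms of [h] of frequency 0 give the mean exactly. Any other term puts a nonzero integer in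
    front of the highest power [x^j], and the resulting integral is exponentially small in [j]. Only
    the rate [j^-2] is kept, because it is summable. *)
Lemma trig_correlation (g h : @trigpoly R) q : exists C : R, 0 <= C /\
  forall (j : nat) (l : seq nat), (1 <= j)%N -> (forall k, k \in l -> (k < j)%N) ->
    (size l <= j)%N ->
  `|avg (fun x => tpeval h (xi * x ^+ j) * tpsum xi g l x ^+ q)
    - tpmean h * avg (fun x => tpsum xi g l x ^+ q)| <= C / j%:R ^+ 2.
Proof.
set th := 2 * pi * xi.
have th0 : 0 < th by rewrite !mulr_gt0// pi_gt0.
have [C [r [C0 r01 osc]]] := osc_bound A1 AB q th0.
have [H gH] := tpdeg_exists g.
(* The powers of [j] to be absorbed: [q] from the number of summands, [q + 3] from the oscillatory
   bound, 2 from the announced rate. *)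
have [C' [C'0 C'P]] := natpow_geometric_bounded (q + (q + 3) + 2) r01.
have /andP[r0 _] := r01.
set N := coef_norm g.
have N0 : 0 <= N by exact: coef_norm_ge0.
have qH0 : 0 <= 1 + (q * H)%:R :> R by rewrite addr_ge0.
have BAV0 : 0 <= (B - A)^-1 by rewrite invr_ge0 ltW.
have Nq0 : 0 <= N ^+ q by rewrite exprn_ge0.
have Z0 : 0 <= (B - A)^-1 * (N ^+ q * (C * (1 + (q * H)%:R) * C')).
  by do 3 (apply: mulr_ge0 => //); exact: mulr_ge0.
exists (coef_norm h * ((B - A)^-1 * (N ^+ q * (C * (1 + (q * H)%:R) * C')))).
split; first by rewrite mulr_ge0// coef_norm_ge0.
move=> j l j1 lj sl.
set S := fun x => tpsum xi g l x ^+ q.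
have cS : con A B S by apply: conX; exact: con_tpsum.
pose F (p : R * (int * R)) x := cos (2 * pi * p.2.1%:~R * (xi * x ^+ j) + p.2.2) * S x.
have cF p : con A B (F p).
  apply: conM => //; have := @con_cos_spoly R A B th p.2.1%:~R p.2.2 j [::].
  rewrite (_ : (fun x => cos (th * _ + _)) =
    fun x => cos (2 * pi * p.2.1%:~R * (xi * x ^+ j) + p.2.2))//.
  by apply/funext => x; congr cos; rewrite /spoly big_nil /th; ring.
rewrite (@avg_eq _ (fun x => \sum_(p <- h) p.1 * F p x)); last first.
  move=> x _; rewrite /tpeval mulr_suml; apply: eq_bigr => p _.
  by rewrite /F /S -mulrA.
rewrite avg_sum; last first.
  by move=> p _; exact: con_ig (conM (@con_cst _ A B p.1) (cF p)).
have -> : tpmean h * avg S = \sum_(p <- h) (if p.2.1 == 0 then p.1 * avg (F p) else 0).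
  rewrite /tpmean big_mkcond/= mulr_suml; apply: eq_bigr => p _.
  case: eqP => [p0|_]; last by rewrite mul0r.
  rewrite -mulrA; congr (_ * _); rewrite -avgZ; last exact: con_ig.
  by apply: avg_eq => x _; rewrite /F p0 mulr0 mul0r add0r.
rewrite -sumrB; apply: (le_trans (ler_norm_sum _ _ _)).
rewrite -[leRHS]mulrA /coef_norm mulr_suml; apply: ler_sum => p _.
rewrite avgZ; last exact: con_ig.
have Bd0 : 0 <= (B - A)^-1 * (N ^+ q * (C * (1 + (q * H)%:R) * C')) / j%:R ^+ 2.
  by rewrite divr_ge0// exprn_ge0.
case: eqP => [_|/eqP p0]; first by rewrite subrr normr0 mulr_ge0.
rewrite subr0 normrM; apply: ler_wpM2l => //.
rewrite /avg normrM gtr0_norm ?invr_gt0// -[leRHS]mulrA; apply: ler_wpM2l => //.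
have a01 : 1 <= `|p.2.1%:~R : R|.
  by rewrite -intr_norm ler1z -gtz0_ge1 normr_gt0.
have nil_lt (p' : R * nat) : p' \in [::] -> (p'.2 < j)%N by [].
have nil_norm : coef_norm ([::] : seq (R * nat)) <= 1 by rewrite /coef_norm big_nil.
have bd := osc_tpsum C0 (ltW r0) (erefl th) gH osc (erefl (0 + q)%N) p.2.2 j1 a01
  (erefl (size ([::] : seq (R * nat)))) nil_lt nil_norm (lexx 1) lj sl.
have {bd} : `|\int[mu]_(x in `[A, B]) F p x| <=
   (j%:R * N) ^+ q * (C * (1 + (q * H)%:R) * j%:R ^+ (q + 3) * r ^+ j).
  rewrite (_ : \int[mu]_(x in `[A, B]) F p x = \int[mu]_(x in `[A, B])
    (cos (th * (p.2.1%:~R * x ^+ j + spoly [::] x) + p.2.2) *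
      tpsum xi g l x ^+ q)).
    exact: bd.
  apply: eq_Rintegral => x _; rewrite /F /S; congr (cos _ * _).
  by rewrite /spoly big_nil /th; ring.
move=> /le_trans; apply.
have j0 : (0 : R) < j%:R by rewrite ltr0n.
rewrite exprMn ler_pdivlMr ?exprn_gt0//.
have -> : j%:R ^+ q * N ^+ q * (C * (1 + (q * H)%:R) * j%:R ^+ (q + 3) * r ^+ j) * j%:R ^+ 2
 = N ^+ q * (C * (1 + (q * H)%:R) * (j%:R ^+ (q + (q + 3) + 2) * r ^+ j)) :> R.
  by rewrite !exprD; ring.
apply: ler_wpM2l => //; apply: ler_wpM2l; first exact: mulr_ge0.
exact: C'P.
Qed.

End moment_asymptotics.

Section increasing_lists.

Lemma path_le_last (l : seq nat) k : path ltn 0 l -> k \in l -> (k <= last 0 l)%N.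
Proof.
elim/last_ind: l k => [//|l j ih] k; rewrite rcons_path last_rcons => /andP[pl lj].
rewrite mem_rcons in_cons => /predU1P[->//|/(ih _ pl) kl].
exact: leq_trans kl (ltnW lj).
Qed.

(** Strictly increasing positive integers are at least as large as their rank. An error in terms of
    the exponent thus becomes one in terms of the number of terms, summable uniformly in the
    list. *)
Lemma path_size_last (l : seq nat) : path ltn 0 l -> (size l <= last 0 l)%N.
Proof.
elim/last_ind: l => [//|l j ih]; rewrite rcons_path last_rcons size_rcons.
by move=> /andP[/ih pl]; exact: leq_ltn_trans.
Qed.

Lemma path_rcons_lt (l : seq nat) j : path ltn 0 (rcons l j) ->
  [/\ path ltn 0 l, (size l < j)%N & forall k, k \in l -> (k < j)%N].
Proof.
rewrite rcons_path => /andP[pl lj]; split=> //.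
  by rewrite (leq_ltn_trans (path_size_last pl)).
by move=> k kl; rewrite (leq_ltn_trans (path_le_last pl kl)).
Qed.

End increasing_lists.

(** * The Gaussian recursion in the number of terms *)

Section gaussian_growth.
Context {R : realType}.

(** Moments of the standard normal law, by the recursion that integration by parts gives; [gexp_pow]
    identifies them. *)
Fixpoint gauss_moment (r : nat) : R :=
  match r with
  | 0 => 1
  | 1 => 0
  | r'.+2 => r'.+1%:R * gauss_moment r'
  end.

Lemma gauss_moment_ge0 r : 0 <= gauss_moment r.
Proof.
suff : 0 <= gauss_moment r /\ 0 <= gauss_moment r.+1 by case.
elim: r => [//|r [h0 h1]]; split=> //=.
by rewrite mulr_ge0.
Qed.

Lemma gauss_moment_odd r : odd r -> gauss_moment r = 0.
Proof.
suff : (odd r -> gauss_moment r = 0) /\ (odd r.+1 -> gauss_moment r.+1 = 0) by case.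
elim: r => [//|r [h0 h1]]; split=> //= h; rewrite h0 ?mulr0//.
by move: h; rewrite /= negbK.
Qed.

(** The falling factorial replaces the power [n^(r/2)] so that the difference equation below holds
    exactly. For odd [r] the factor [gauss_moment r] vanishes, so the rounding in [r./2] is
    harmless. *)
Definition gauss_growth (s2 : R) (r n : nat) : R :=
  s2 ^+ r./2 * gauss_moment r * (n ^_ r./2)%:R.

(** For [r = 2 q] the difference of falling factorials of order [q + 1] is [q + 1] times that of
    order [q], and the binomial coefficient equals [(q + 1) (r + 1)], where [r + 1] is the factor in
    the recursion for the moments. *)
Lemma gauss_growthS s2 r n :
  gauss_growth s2 r.+2 n.+1 - gauss_growth s2 r.+2 n =
  'C(r.+2, 2)%:R * s2 * gauss_growth s2 r n.
Proof.
have [ro|re] := boolP (odd r).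
  rewrite /gauss_growth (gauss_moment_odd ro) gauss_moment_odd/= ?negbK//.
  by rewrite !(mulr0, mul0r) subrr.
rewrite /gauss_growth /=; set q := r./2.
have rE : r = (q + q)%N by rewrite addnn -[LHS]odd_double_half (negbTE re).
have hf : ((n.+1 ^_ q.+1)%:R - (n ^_ q.+1)%:R : R) = q.+1%:R * (n ^_ q)%:R.
  rewrite ffactSS ffactnSr; have [nq|qn] := ltnP n q.
    by rewrite ffact_small// !muln0 mul0n mulr0 subrr.
  by rewrite !natrM natrB// -!natr1; ring.
have hC : 'C(r.+2, 2)%:R = q.+1%:R * r.+1%:R :> R.
  apply: (mulfI (_ : 2%:R != 0 :> R)); first by rewrite pnatr_eq0.
  rewrite -[LHS]natrM -[2%N]/(2`!)%N mulnC bin_ffact !ffactnS ffactn0 muln1.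
  rewrite mulrA -!natrM; congr ((_ * _)%:R).
  by rewrite rE mulnS mul2n -addnn.
rewrite hC exprS.
transitivity (s2 * s2 ^+ q * (r.+1%:R * gauss_moment r) *
  ((n.+1 ^_ q.+1)%:R - (n ^_ q.+1)%:R)); first by ring.
by rewrite hf; ring.
Qed.

Lemma gauss_growth_bound s2 r n : 0 <= s2 ->
  `|gauss_growth s2 r n| <= s2 ^+ r./2 * gauss_moment r * n.+1%:R ^+ r./2.
Proof.
move=> s20; have gm := gauss_moment_ge0 r.
rewrite ger0_norm; last by rewrite mulr_ge0// mulr_ge0// exprn_ge0.
rewrite ler_wpM2l ?mulr_ge0 ?exprn_ge0// -natrX ler_nat.
elim: r./2 => [//|q ih]; rewrite ffactnSr expnSr.
by apply: leq_mul => //; rewrite (leq_trans (leq_subr _ _)).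
Qed.

Lemma ffact_ratio (n q : nat) : (0 < n)%N ->
  `|(n ^_ q)%:R / n%:R ^+ q - 1| <= q%:R ^+ 2 / n%:R :> R.
Proof.
move=> n0; have n0' : 0 < n%:R :> R by rewrite ltr0n.
have H : (n ^_ q)%:R <= n%:R ^+ q :> R /\
    (n%:R ^+ q - (n ^_ q)%:R) * n%:R <= q%:R ^+ 2 * n%:R ^+ q :> R.
  elim: q => [|q [ih1 ih2]]; first by rewrite expr0 expr0n ffactn0 subrr !mul0r.
  rewrite ffactnSr natrM exprSr.
  have h1 : (n - q)%:R <= n%:R :> R by rewrite ler_nat leq_subr.
  have h2 : n%:R - q%:R <= (n - q)%:R :> R.
    have [qn|nq] := leqP q n; first by rewrite natrB.
    by rewrite (@le_trans _ _ 0)// subr_le0 ler_nat ltnW.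
  split; first exact: ler_pM.
  have h3 : (n ^_ q)%:R * (n%:R - q%:R) <= (n ^_ q)%:R * (n - q)%:R :> R.
    exact: ler_wpM2l.
  have h4 := ler_wpM2r (ltW n0') ih2.
  have h5 : q%:R * (n ^_ q)%:R * n%:R <= q%:R * n%:R ^+ q * n%:R :> R.
    by rewrite ler_wpM2r ?(ltW n0')// ler_wpM2l.
  have h6 := ler_wpM2r (ltW n0') h3.
  have h7 : 0 <= n%:R ^+ q * n%:R :> R by rewrite mulr_ge0// exprn_ge0.
  have h8 : 0 <= q%:R * (n%:R ^+ q * n%:R) :> R by rewrite mulr_ge0.
  rewrite -natr1 expr2 in h4 *; lra.
have [H1 H2] := H.
have nq0 : 0 < n%:R ^+ q :> R by rewrite exprn_gt0.
rewrite distrC ger0_norm; last by rewrite subr_ge0 ler_pdivrMr// mul1r.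
rewrite ler_pdivlMr//.
have -> : (1 - (n ^_ q)%:R / n%:R ^+ q) * n%:R =
    (n%:R ^+ q - (n ^_ q)%:R) * n%:R / n%:R ^+ q :> R.
  by field; rewrite gt_eqF.
by rewrite ler_pdivrMr.
Qed.

End gaussian_growth.

(** * Moments of the trigonometric sums *)

Section moment_limit.
Context {R : realType}.
Variables (A B xi : R).
Hypotheses (A1 : 1 < A) (AB : A < B) (xi0 : 0 < xi).
Variable g : @trigpoly R.
Hypothesis g0 : tpmean g = 0.

Definition moment (r : nat) (l : seq nat) : R :=
  avg A B (fun x => tpsum xi g l x ^+ r).

Definition tpvar : R := tpmean (tppow g 2).

Lemma tpvar_ge0 : 0 <= tpvar.
Proof.
rewrite /tpvar -tpmeanE; apply: Rintegral_ge0 => x _.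
by rewrite tpeval_pow sqr_ge0.
Qed.

Lemma tpmean_pow0 : tpmean (tppow g 0) = 1.
Proof. exact: tpmean_cst. Qed.

Lemma tpmean_pow1 : tpmean (tppow g 1) = 0.
Proof.
rewrite -tpmeanE -[RHS]g0 -tpmeanE; apply: eq_Rintegral => x _.
by rewrite tpeval_pow expr1.
Qed.

Lemma con_tpsumX l r : con A B (fun x => tpsum xi g l x ^+ r).
Proof. by apply: conX; exact: con_tpsum. Qed.

Lemma moment_nil r : moment r [::] = (r == 0)%:R.
Proof.
rewrite /moment (@avg_eq _ _ _ _ (fun=> (r == 0)%:R)) ?avg_cst// => x _.
by rewrite /tpsum big_nil expr0n.
Qed.

Lemma moment0 l : moment 0 l = 1.
Proof. by rewrite /moment avg_cst. Qed.

(** Binomial expansion of the power of the old sum plus the new term: [trig_correlation] replaces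
    every power of the new term by its mean. The new exponent exceeds the length of [l], hence the
    denominator. *)
Lemma moment_rcons r : exists C : R, 0 <= C /\
  forall l j, path ltn 0 (rcons l j) ->
  `|moment r (rcons l j) -
     \sum_(i < r.+1) 'C(r, i)%:R * (tpmean (tppow g i) * moment (r - i) l)|
  <= C / (size l).+1%:R ^+ 2.
Proof.
pose Ci i := projT1 (cid (trig_correlation A1 AB xi0 g (tppow g i) (r - i))).
have CiP i := projT2 (cid (trig_correlation A1 AB xi0 g (tppow g i) (r - i))).
exists (\sum_(i < r.+1) 'C(r, i)%:R * Ci i); split.
  by apply: sumr_ge0 => i _; rewrite mulr_ge0//; have [] := CiP i.
move=> l j /path_rcons_lt[pl lj kj].
have j1 : (1 <= j)%N by rewrite (leq_trans _ lj).
pose F i x := tpeval (tppow g i) (xi * x ^+ j) * tpsum xi g l x ^+ (r - i).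
have cF i : con A B (F i).
  by apply: conM; [exact: con_tpeval|exact: con_tpsumX].
have -> : moment r (rcons l j) = \sum_(i < r.+1) 'C(r, i)%:R * avg A B (F i).
  rewrite /moment (@avg_eq _ _ _ _ (fun x => \sum_(i < r.+1) 'C(r, i)%:R * F i x)).
    rewrite avg_sum//; last first.
      by move=> i _; apply: con_ig => //; apply: conM => //; exact: con_cst.
    by apply: eq_bigr => i _; rewrite avgZ//; exact: con_ig.
  move=> x _; rewrite /tpsum -cats1 big_cat/= big_seq1 exprDn.
  by apply: eq_bigr => i _; rewrite /F tpeval_pow -mulr_natl [_ * tpeval _ _ ^+ _]mulrC.
rewrite -sumrB; apply: (le_trans (ler_norm_sum _ _ _)).
rewrite mulr_suml; apply: ler_sum => i _; rewrite -mulrBr normrM normr_nat -mulrA.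
apply: ler_wpM2l => //; have [C0 CP] := CiP i.
apply: (le_trans (CP j l j1 kj (ltnW lj))).
rewrite ler_wpM2l// lef_pV2 ?posrE ?exprn_gt0 ?ltr0n//.
by rewrite lerXn2r ?nnegrE// ler_nat.
Qed.

Local Notation G := (gauss_growth tpvar).

(* The main term reproduces the recursion [gauss_growthS], the terms with
   [i >= 3] are of lower order, and the correlation errors are summable. *)
Lemma moment_increment r' (C : R) :
  (forall s l, (s <= r'.+1)%N -> path ltn 0 l ->
    `|moment s l - G s (size l)| <= C * (size l).+1%:R ^+ (s.-1)./2) ->
  exists K C2 : R, [/\ 0 <= K, 0 <= C2 & forall l j, path ltn 0 (rcons l j) ->
    `|(moment r'.+2 (rcons l j) - G r'.+2 (size l).+1) -
      (moment r'.+2 l - G r'.+2 (size l))| <=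
      (0 < r')%:R * (K * (size l).+1%:R ^+ (r'.-1)./2) + C2 / (size l).+1%:R ^+ 2].
Proof.
move=> IH.
have C0 : 0 <= C.
  have := IH 0%N [::] (leq0n _) isT; rewrite expr0 mulr1; exact: le_trans.
have [C2 [C20 C2P]] := moment_rcons r'.+2.
pose gb s := tpvar ^+ s./2 * gauss_moment s.
have gb0 s : 0 <= gb s by rewrite mulr_ge0 ?gauss_moment_ge0// exprn_ge0// tpvar_ge0.
pose b i : R := 'C(r'.+2, i.+3)%:R * `|tpmean (tppow g i.+3)|.
pose K := 'C(r'.+2, 2)%:R * tpvar * C + \sum_(i < r') b i * (gb (r' - i.+1)%N + C).
have K0 : 0 <= K.
  rewrite addr_ge0 ?mulr_ge0 ?tpvar_ge0//; apply: sumr_ge0 => i _.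
  by rewrite !mulr_ge0// addr_ge0.
exists K, C2; split=> // l j plj; have [pl _ _] := path_rcons_lt plj.
have := C2P l j plj; set n := size l.
(* The terms [i = 0, 1, 2] are peeled off: their means are 1, 0 and the variance. The remainder [Sg]
   collects the terms with [i >= 3]. *)
rewrite big_ord_recl/= bin0 mul1r tpmean_pow0 mul1r subn0.
rewrite big_ord_recl/= tpmean_pow1 mul0r mulr0 add0r.
rewrite big_ord_recl/= -/tpvar /bump/= !add1n.
rewrite (_ : r'.+2 - 2 = r')%N; last by rewrite !subSS subn0.
set Sg := \sum_(i < r') _ => H.
have GS := gauss_growthS tpvar r' n.
have -> : moment r'.+2 (rcons l j) - G r'.+2 n.+1 - (moment r'.+2 l - G r'.+2 n) =
  (moment r'.+2 (rcons l j) - (moment r'.+2 l + ('C(r'.+2, 2)%:R * (tpvar * moment r' l) + Sg)))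
  + ('C(r'.+2, 2)%:R * tpvar * (moment r' l - G r' n) + Sg).
  rewrite mulrBr -GS; ring.
apply: (le_trans (ler_normD _ _)); rewrite addrC; apply: lerD => //.
(* For [r' = 0] the main terms cancel exactly, the moment of order 0 being 1 on both sides. Without
   the factor [(0 < r')%:R] a constant error per step would accumulate to order [n], as large as the
   second moment itself. *)
have [r'0|r'0] := posnP r'.
  rewrite /Sg; move: H IH K0 => _ _ _; rewrite {}r'0 in GS * .
  rewrite big_ord0 moment0 /gauss_growth/= !mul1r ffactn0 subrr mulr0 addr0.
  by rewrite normr0 mul0r.
rewrite mul1r; apply: (le_trans (ler_normD _ _)).
rewrite /K mulrDl; apply: lerD.
  rewrite normrM normrM normr_nat (ger0_norm tpvar_ge0) -!mulrA ler_wpM2l//.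
  by rewrite ler_wpM2l ?tpvar_ge0//; apply: IH.
apply: (le_trans (ler_norm_sum _ _ _)); rewrite mulr_suml; apply: ler_sum => i _.
rewrite /bump/= !add1n !subSS normrM normr_nat /b -!mulrA ler_wpM2l//.
rewrite (normrM (tpmean _)) ler_wpM2l//.
have sr : (r' - i.+1 <= r'.-1)%N by rewrite -subn1 leq_sub2l.
set s := (r' - i.+1)%N in sr *.
have n1 : 1 <= n.+1%:R :> R by rewrite ler1n.
have h1 : n.+1%:R ^+ s./2 <= n.+1%:R ^+ r'.-1./2 :> R.
  by apply: ler_weXn2l => //; exact: half_leq.
have h2 : n.+1%:R ^+ s.-1./2 <= n.+1%:R ^+ r'.-1./2 :> R.
  by apply: ler_weXn2l => //; apply: half_leq; exact: leq_trans (leq_pred _) sr.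
have h3 := gauss_growth_bound s n tpvar_ge0.
have sr' : (s <= r'.+1)%N by rewrite (leq_trans sr)// (leq_trans (leq_pred _)).
have h4 := IH s l sr' pl.
rewrite -(subrK (G s n) (moment s l)) (le_trans (ler_normD _ _))//.
rewrite mulrDl addrC; apply: lerD.
  exact: (le_trans h3 (ler_wpM2l (gb0 s) h1)).
exact: (le_trans h4 (ler_wpM2l C0 h2)).
Qed.

Lemma sqr_inv_telescope (n : nat) : n.+1%:R ^- 2 <= 2 / n.+1%:R - 2 / n.+2%:R :> R.
Proof.
have z1 : 1 <= n.+1%:R :> R by rewrite ler1n.
rewrite -[n.+2%:R]natr1; move: (n.+1%:R) z1 => z z1.
have z0 : 0 < z by lra.
have z10 : 0 < z + 1 by lra.
have -> : 2 / z - 2 / (z + 1) = 2 / (z * (z + 1)).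
  by field; rewrite !gt_eqF.
rewrite ler_pdivlMr ?mulr_gt0// expr2 mulrC ler_pdivrMr ?mulr_gt0//.
nra.
Qed.

(** Summation of the increments along the list: the power term is bounded by its last value times
    the number of steps, and the inverse squares by [sqr_inv_telescope]. *)
Lemma moment_growth_step r (K C2 : R) (f : nat) : 0 <= K -> 0 <= C2 ->
  moment r [::] = G r 0 ->
  (forall l j, path ltn 0 (rcons l j) ->
    `|(moment r (rcons l j) - G r (size l).+1) - (moment r l - G r (size l))| <=
      K * (size l).+1%:R ^+ f + C2 / (size l).+1%:R ^+ 2) ->
  forall l, path ltn 0 l -> `|moment r l - G r (size l)| <=
    K * (size l)%:R * (size l).+1%:R ^+ f + C2 * (2 - 2 / (size l).+1%:R).
Proof.
move=> K0 C20 Hnil H; elim/last_ind => [_|l j ih pl].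
  rewrite Hnil subrr normr0.
  by rewrite mulr0 mul0r divr1 subrr mulr0 addr0.
have [pl' _ _] := path_rcons_lt pl; rewrite size_rcons.
have h1 := H l j pl; have h2 := ih pl'; set n := size l in h1 h2 *.
have h3 := sqr_inv_telescope n.
rewrite -(subrK (moment r l - G r n) (moment r (rcons l j) - _)).
rewrite (le_trans (ler_normD _ _))//.
apply: (le_trans (lerD h1 h2)).
have h4 : n.+1%:R ^+ f <= n.+2%:R ^+ f :> R by rewrite lerXn2r ?nnegrE// ler_nat.
have h5 := ler_wpM2l C20 h3.
have h6 : K * n.+1%:R * n.+1%:R ^+ f <= K * n.+1%:R * n.+2%:R ^+ f.
  by rewrite ler_wpM2l// mulr_ge0.
have h7 : K * n.+1%:R ^+ f + K * n%:R * n.+1%:R ^+ f = K * n.+1%:R * n.+1%:R ^+ f.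
  by rewrite -mulrA -mulrDr -[in LHS](mul1r (_ ^+ f)) mulrA mulr1 -mulrDl addrC natr1 mulrA.
rewrite addrACA h7; apply: lerD => //.
rewrite -mulrDr; apply: ler_wpM2l => //; move: h3.
by move: (2 / n.+1%:R) (2 / n.+2%:R) (n.+1%:R ^- 2) => u v w; lra.
Qed.

(** The exponent [(s - 1)./2] is what matters: it lies below [s / 2] by at least one half for
    [s >= 1], so the error vanishes after normalisation by [n^(s/2)]. Orders 0 and 1 are done by
    hand, higher ones by [moment_increment]. *)
Lemma moment_bound r : exists C : R, 0 <= C /\
  forall s l, (s <= r)%N -> path ltn 0 l ->
    `|moment s l - G s (size l)| <= C * (size l).+1%:R ^+ (s.-1)./2.
Proof.
have G0 l : moment 0 l - G 0 (size l) = 0.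
  by rewrite moment0 /gauss_growth ffactn0 !mulr1 subrr.
elim: r => [|[|r'] [C [C0 IH]]].
- exists 0; split=> // s l; rewrite leqn0 => /eqP -> _.
  by rewrite G0 normr0 mul0r.
- have [C2 [C20 C2P]] := moment_rcons 1.
  have G1 n : G 1 n = 0 by rewrite /gauss_growth/= mulr0 mul0r.
  exists (2 * C2); split; first exact: mulr_ge0.
  move=> [|[|//]] l _ pl; first by rewrite G0 normr0 expr0 mulr1 mulr_ge0.
  rewrite expr0 mulr1.
  apply: (le_trans (@moment_growth_step 1 0 C2 0 (lexx _) C20 _ _ _ pl)).
  + by rewrite moment_nil G1.
  + move=> {pl}l j pl; have := C2P _ _ pl.
    rewrite !big_ord_recl big_ord0/= tpmean_pow0 tpmean_pow1.
    by rewrite bin0 !mul1r mul0r ?mulr0 !addr0 !G1 !subr0 mul0r add0r.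
  + rewrite !mul0r add0r mulrC ler_wpM2r//.
    by rewrite gerBl divr_ge0.
- have [K [C2 [K0 C20 HK]]] := moment_increment IH.
  pose K' := (0 < r')%:R * K.
  have K'0 : 0 <= K' by rewrite mulr_ge0.
  exists (C + (K' + 2 * C2)); split; first by rewrite !addr_ge0// mulr_ge0.
  have CC : 0 <= K' + 2 * C2 by rewrite addr_ge0// mulr_ge0.
  move=> s l; rewrite leq_eqVlt => /predU1P[->|sr] pl; last first.
    apply: (le_trans (IH s l sr pl)); rewrite ler_wpM2r ?exprn_ge0//.
    by rewrite lerDl.
  have Hnil : moment r'.+2 [::] = G r'.+2 0.
    by rewrite moment_nil /gauss_growth/= ffact0n mulr0.
  have HK' l' j : path ltn 0 (rcons l' j) ->
    `|(moment r'.+2 (rcons l' j) - G r'.+2 (size l').+1) -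
      (moment r'.+2 l' - G r'.+2 (size l'))| <=
      K' * (size l').+1%:R ^+ r'.-1./2 + C2 / (size l').+1%:R ^+ 2.
    by move=> /HK; rewrite mulrA.
  apply: (le_trans (moment_growth_step K'0 C20 Hnil HK' pl)).
  set n := size l; set e := (r'.+2.-1)./2.
  have n1 : 1 <= n.+1%:R :> R by rewrite ler1n.
  have ne1 : 1 <= n.+1%:R ^+ e :> R by rewrite exprn_ege1.
  have h1 : K' * n%:R * n.+1%:R ^+ r'.-1./2 <= K' * n.+1%:R ^+ e.
    rewrite /e /K'; case: (r') => [|r'']; first by rewrite !mul0r.
    rewrite -mulrA ler_wpM2l ?mulr_ge0//= exprS ler_wpM2r ?exprn_ge0//.
    by rewrite ler_nat.
  have h2 : C2 * (2 - 2 / n.+1%:R) <= 2 * C2 * n.+1%:R ^+ e.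
    apply: (@le_trans _ _ (2 * C2)); last by rewrite ler_peMr// mulr_ge0.
    by rewrite mulrC ler_wpM2r// gerBl divr_ge0.
  apply: (le_trans (lerD h1 h2)); rewrite -mulrDl ler_wpM2r ?exprn_ge0//.
  by rewrite lerDr.
Qed.

Lemma moment_cvg r (eps : R) : 0 < tpvar -> 0 < eps -> exists n0 : nat,
  forall l, path ltn 0 l -> (n0 <= size l)%N ->
  `|avg A B (fun x => (tpsum xi g l x / (Num.sqrt tpvar * Num.sqrt (size l)%:R)) ^+ r)
    - gauss_moment r| < eps.
Proof.
move=> v0 eps0; case: r => [|r].
  exists 0%N => l _ _; rewrite (@avg_eq _ _ _ _ (fun=> 1)) ?avg_cst// ?subrr ?normr0//.
have [C [C0 CP]] := moment_bound r.+1.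
set sg := Num.sqrt tpvar.
have sg0 : 0 < sg by rewrite sqrtr_gt0.
pose e := (r./2)%N; pose h := (r.+1)./2.
(* The first summand comes from [moment_bound] with [(n + 1)^e <= 2^e n^e], where [2 e <= r] leaves
   a factor [n^(-1/2)]; the second from comparing the falling factorial with the power. *)
pose D := C * 2 ^+ e * sg ^- r.+1 + gauss_moment r.+1 * h%:R ^+ 2.
have D0 : 0 <= D.
  rewrite addr_ge0//; last by rewrite mulr_ge0 ?gauss_moment_ge0// sqr_ge0.
  by rewrite !mulr_ge0// ?exprn_ge0// invr_ge0 exprn_ge0// ltW.
exists (Num.bound ((D / eps) ^+ 2)).+1 => l pl; set n := size l => nb.
have n0 : (0 < n)%N by rewrite (leq_trans _ nb).
set w := Num.sqrt n%:R.
have nR0 : 0 < n%:R :> R by rewrite ltr0n.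
have w0 : 0 < w by rewrite sqrtr_gt0.
have w2 : w ^+ 2 = n%:R by rewrite sqr_sqrtr// ltW.
have w1 : 1 <= w by rewrite -[leLHS]sqrtr1 ler_sqrt// ler1n.
have Dw : D / w < eps.
  rewrite ltr_pdivrMr// -ltr_pdivrMl// mulrC.
  rewrite -(@ltr_pXn2r _ 2%N) ?nnegrE ?divr_ge0 ?(ltW eps0) ?(ltW w0)// w2.
  apply: lt_le_trans (archi_boundP _) _; first exact: sqr_ge0.
  by rewrite ler_nat ltnW.
apply: le_lt_trans Dw.
have sw0 : 0 < sg * w by exact: mulr_gt0.
have -> : avg A B (fun x => (tpsum xi g l x / (sg * w)) ^+ r.+1) =
    (sg * w) ^- r.+1 * moment r.+1 l.
  rewrite /moment -avgZ; last by apply: con_ig => //; exact: con_tpsumX.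
  by apply: avg_eq => x _; rewrite exprMn exprVn mulrC.
have GE : (sg * w) ^- r.+1 * G r.+1 n = gauss_moment r.+1 * ((n ^_ h)%:R / n%:R ^+ h).
  have [ro|re] := boolP (odd r.+1).
    by rewrite /gauss_growth gauss_moment_odd// !(mul0r, mulr0).
  rewrite /gauss_growth -/h.
  have -> : (sg * w) ^+ r.+1 = tpvar ^+ h * n%:R ^+ h.
    rewrite -w2 -(sqr_sqrtr (ltW v0)) -/sg -!exprM -exprMn; congr (_ ^+ _).
    by rewrite mul2n -[LHS]odd_double_half (negbTE re).
  have t0 : tpvar ^+ h != 0 by rewrite expf_neq0// gt_eqF.
  have nh0 : (n%:R ^+ h : R) != 0 by rewrite expf_neq0// gt_eqF.
  by field; rewrite t0 nh0.
have -> : (sg * w) ^- r.+1 * moment r.+1 l - gauss_moment r.+1 =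
  (sg * w) ^- r.+1 * (moment r.+1 l - G r.+1 n)
  + gauss_moment r.+1 * ((n ^_ h)%:R / n%:R ^+ h - 1).
  by rewrite mulrBr GE mulrBr mulr1; ring.
rewrite (le_trans (ler_normD _ _))// /D mulrDl; apply: lerD; last first.
  rewrite normrM ger0_norm ?gauss_moment_ge0// -mulrA ler_wpM2l ?gauss_moment_ge0//.
  apply: (le_trans (ffact_ratio h n0)); rewrite ler_wpM2l ?sqr_ge0//.
  by rewrite lef_pV2 ?posrE// -w2 expr2 ler_peMr// ltW.
have swV : 0 <= (sg * w) ^- r.+1 by rewrite invr_ge0 exprn_ge0// ltW.
rewrite normrM (ger0_norm swV).
have h1 := CP _ _ (leqnn r.+1) pl; rewrite -/n -/e /= in h1.
apply: (le_trans (ler_wpM2l swV h1)).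
have h2 : n.+1%:R ^+ e <= 2 ^+ e * w ^+ r :> R.
  apply: (@le_trans _ _ ((2 * n%:R) ^+ e)).
    rewrite lerXn2r ?nnegrE// -natr1 mulr_natl mulr2n lerD2l.
    by rewrite ler1n.
  rewrite exprMn ler_wpM2l ?exprn_ge0// -w2 -exprM ler_weXn2l//.
  by rewrite mul2n -[leqRHS]odd_double_half leq_addl.
rewrite exprMn invfM.
have -> : C * 2 ^+ e / sg ^+ r.+1 / w = sg ^- r.+1 * w ^- r.+1 * (C * (2 ^+ e * w ^+ r)).
  have wr0 : w ^+ r != 0 by rewrite expf_neq0// gt_eqF.
  have sr0 : sg ^+ r.+1 != 0 by rewrite expf_neq0// gt_eqF.
  by rewrite [w ^+ r.+1]exprS; field; rewrite wr0 sr0 gt_eqF.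
rewrite ler_wpM2l ?mulr_ge0 ?invr_ge0 ?exprn_ge0 ?(ltW w0) ?(ltW sg0)//.
by rewrite ler_wpM2l.
Qed.

End moment_limit.

(** * From moments to the Gaussian limit *)

Section cos_taylor.
Context {R : realType}.

(** Taylor polynomial at [b]: the derivative of order [r] of the cosine is a shift by [r pi / 2], so
    no case distinction modulo 4 is needed. *)
Definition cos_taylor (b y : R) (m : nat) : R :=
  \sum_(r < m) cos (b + r%:R * (pi / 2)) * (y ^+ r / r`!%:R).

Lemma factS_neq0 n : (n`!%:R : R) != 0.
Proof. by rewrite pnatr_eq0 -lt0n fact_gt0. Qed.

Lemma dv_powdivfact n (y : R) :
  is_derive y 1 (fun z => z ^+ n.+1 / n.+1`!%:R) (y ^+ n / n`!%:R).
Proof.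
have h := dvM (dvX n.+1 (dv_id y)) (dv_cst (n.+1`!%:R)^-1 y).
apply: (dv_eq h); rewrite mulr0 add0r mulr1 -pred_Sn factS natrM.
have a0 : (n.+1%:R : R) != 0 by rewrite pnatr_eq0.
move: (n.+1%:R : R) a0 (factS_neq0 n) => a a0 b0.
by field; rewrite a0 b0.
Qed.

(** Differentiating a remainder gives the remainder of one order less at the shifted base point. The
    bound below follows by induction on the order, for all base points at once. *)
Lemma dv_cos_taylor (b y : R) m :
  is_derive y 1 (fun z => cos (b + z) - cos_taylor b z m.+1)
    (cos (b + pi / 2 + y) - cos_taylor (b + pi / 2) y m).
Proof.
have -> : (fun z => cos (b + z) - cos_taylor b z m.+1) =
  fun z => cos (b + z) - (cos b + \sum_(r < m)
    cos (b + pi / 2 + r%:R * (pi / 2)) * (z ^+ r.+1 / r.+1`!%:R)).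
  apply/funext => z; rewrite /cos_taylor big_ord_recl/=.
  rewrite mul0r addr0 expr0 fact0 divr1 mulr1; congr (_ - (_ + _)).
  apply: eq_bigr => r _; rewrite /bump/= add1n; congr (cos _ * _).
  by rewrite -natr1; ring.
have -> : cos (b + pi / 2 + y) = - sin (b + y) * (0 + 1).
  by rewrite addrAC cosDpihalf add0r mulr1.
have h1 := dv_cos (dvD (dv_cst b y) (dv_id y)).
have h2 : is_derive y 1 (fun z => \sum_(r < m)
    cos (b + pi / 2 + r%:R * (pi / 2)) * (z ^+ r.+1 / r.+1`!%:R))
    (cos_taylor (b + pi / 2) y m).
  by apply: dv_sum => r; apply: dvZ; exact: dv_powdivfact.
apply: (dv_eq (dvB h1 (dvD (dv_cst (cos b) y) h2))).
by rewrite [0 + cos_taylor _ _ _]add0r.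
Qed.

Lemma cos_taylor_bound (m : nat) (b y : R) :
  `|cos (b + y) - cos_taylor b y m| <= `|y| ^+ m / m`!%:R.
Proof.
elim: m b y => [|m ih] b y.
  rewrite /cos_taylor big_ord0 subr0 expr0 fact0 divr1.
  by rewrite ler_norml cos_geN1 cos_le1.
pose F z := cos (b + z) - cos_taylor b z m.+1.
pose F1 z := cos (b + pi / 2 + z) - cos_taylor (b + pi / 2) z m.
have dF (z : R) : is_derive z 1 F (F1 z) by exact: dv_cos_taylor.
have F0 : F 0 = 0.
  rewrite /F /cos_taylor big_ord_recl/= mul0r !addr0 expr0 fact0 divr1 mulr1.
  by rewrite big1 ?addr0 ?subrr// => r _; rewrite expr0n/= mul0r mulr0.
pose P z : R := z ^+ m.+1 / m.+1`!%:R.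
have P0 : P 0 = 0 by rewrite /P expr0n/= mul0r.
have [y0|/ltW y0] := leP 0 y.
  rewrite (ger0_norm y0) -/(F y) -/(P y) ler_norml.
  have Fb z : 0 <= z <= y -> - (z ^+ m / m`!%:R) <= F1 z <= z ^+ m / m`!%:R.
    by move=> /andP[z0 _]; have := ih (b + pi / 2) z; rewrite (ger0_norm z0) ler_norml.
  have h1 := @derive_bound_le R (fun z => P z - F z)
    (fun z => z ^+ m / m`!%:R - F1 z) 0 0 y y0.
  have h2 := @derive_bound_le R (fun z => P z + F z)
    (fun z => z ^+ m / m`!%:R + F1 z) 0 0 y y0.
  rewrite !mul0r P0 F0 in h1 h2; rewrite subr0 subr0 in h1; rewrite addr0 subr0 in h2.
  have {}h1 : 0 <= P y - F y.
    apply: h1 => z zy; first exact: dvB (dv_powdivfact m z) (dF z).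
    by have := Fb z zy; lra.
  have {}h2 : 0 <= P y + F y.
    apply: h2 => z zy; first exact: dvD (dv_powdivfact m z) (dF z).
    by have := Fb z zy; lra.
  lra.
rewrite (ler0_norm y0) -/(F y) -/(P (- y)) ler_norml.
have dP (z : R) : is_derive z 1 (fun z => P (- z)) ((- z) ^+ m / m`!%:R * - 1).
  exact: dv_comp (dv_powdivfact m (- z)) (dvN (dv_id z)).
have Fb z : y <= z <= 0 -> - ((- z) ^+ m / m`!%:R) <= F1 z <= (- z) ^+ m / m`!%:R.
  by move=> /andP[_ z0]; have := ih (b + pi / 2) z; rewrite (ler0_norm z0) ler_norml.
have h1 := @derive_bound_le R (fun z => - P (- z) - F z)
  (fun z => - ((- z) ^+ m / m`!%:R * - 1) - F1 z) 0 y 0 y0.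
have h2 := @derive_bound_le R (fun z => - P (- z) + F z)
  (fun z => - ((- z) ^+ m / m`!%:R * - 1) + F1 z) 0 y 0 y0.
rewrite !mul0r oppr0 P0 F0 !oppr0 in h1 h2.
have {}h1 : 0 <= 0 + 0 - (- P (- y) - F y).
  apply: h1 => z zy.
  by have := Fb z zy; lra.
have {}h2 : 0 <= 0 + 0 - (- P (- y) + F y).
  apply: h2 => z zy.
  by have := Fb z zy; lra.
lra.
Qed.

End cos_taylor.

(** * Moments of the standard normal law *)

Section gaussian_moments.
Context {R : realType}.
Local Notation mu := (@lebesgue_measure R).

Definition gpdf (x : R) : R := normal_pdf 0 1 x.

Lemma gpdfE x : gpdf x = normal_peak 1 * expR (- (x ^+ 2 / 2)).
Proof.
rewrite /gpdf normal_pdfE ?oner_neq0//; congr (_ * expR _).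
by rewrite subr0 expr1n mulNr.
Qed.

Lemma gpdf_ge0 x : 0 <= gpdf x.
Proof. exact: normal_pdf_ge0. Qed.

Lemma gpdf_le1 x : gpdf x <= 1.
Proof.
apply: (le_trans (normal_pdf_ub 0 x (oner_neq0 _))).
rewrite /normal_peak invf_le1 ?sqrtr_gt0; last first.
  by rewrite expr1n mul1r mulrn_wgt0// pi_gt0.
rewrite -[leLHS]sqrtr1 ler_sqrt// ?expr1n ?mul1r.
  have := @pi_ge2 R; rewrite mulr2n; lra.
by rewrite mulrn_wge0// pi_ge0.
Qed.

Lemma dv_gpdf (x : R) : is_derive x 1 gpdf (- x * gpdf x).
Proof.
have h := dvZ (normal_peak 1) (@dv_comp _ expR (fun y => - (y ^+ 2 / 2)) x _ _ (is_derive_expR _)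
  (dvN (dvM (dvX 2 (dv_id x)) (dv_cst (2^-1) x)))).
rewrite (_ : gpdf = fun x => normal_peak 1 * expR (- (x ^+ 2 / 2))).
  by apply: (dv_eq h); field.
by apply/funext => y; rewrite gpdfE.
Qed.

Definition gexp (h : R -> R) : R := \int[mu]_x (h x * gpdf x).
Definition gig (h : R -> R) := ig mu setT (fun x => h x * gpdf x).

Lemma measurable_gpdf : measurable_fun setT gpdf.
Proof. exact: measurable_normal_pdf. Qed.

Lemma pow_gauss_bound (r : nat) : exists C : R, 0 <= C /\
  forall x : R, `|x| ^+ r <= C * expR (x ^+ 2 / 4).
Proof.
exists (1 + 4 ^+ r * r`!%:R); split.
  by rewrite addr_ge0// mulr_ge0// exprn_ge0.
move=> x; set y := x ^+ 2 / 4.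
have y0 : 0 <= y by rewrite divr_ge0// sqr_ge0.
have e1 : 1 <= expR y by rewrite -expR0 ler_expR.
have yr : y ^+ r <= r`!%:R * expR y.
  case: (r) => [|n]; first by rewrite expr0 fact0 mul1r.
  rewrite mulrC -ler_pdivrMr ?ltr0n ?fact_gt0//.
  by apply: le_trans (expR_ge1Dxn n y0); rewrite lerDr.
have xr : `|x| ^+ r <= 1 + (x ^+ 2) ^+ r.
  rewrite -(real_normK (num_real x)); have [x1|x1] := leP `|x| 1.
    by rewrite (@le_trans _ _ 1) ?exprn_ile1// lerDl exprn_ge0// sqr_ge0.
  rewrite (@le_trans _ _ ((`|x| ^+ 2) ^+ r))// ?lerDr//.
  by rewrite -exprM ler_weXn2l ?(ltW x1)// leq_pmull.
apply: (le_trans xr); rewrite mulrDl mul1r; apply: lerD => //.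
have -> : x ^+ 2 = 4 * y by rewrite /y; field.
by rewrite exprMn -mulrA ler_wpM2l// exprn_ge0.
Qed.

(** Half of the Gaussian decay is spent on the power, by [pow_gauss_bound]. What remains is a
    multiple of the normal density of standard deviation [sqrt 2], whose integrability is known. *)
Lemma gig_pow r : gig (fun x => x ^+ r).
Proof.
have [C [C0 CP]] := pow_gauss_bound r.
have s0 : Num.sqrt 2 != 0 :> R by rewrite gt_eqF// sqrtr_gt0.
have pk0 : 0 < normal_peak (Num.sqrt 2 : R) by exact: normal_peak_gt0.
set K := C * normal_peak 1 / normal_peak (Num.sqrt 2 : R).
have Iw : ig mu setT (fun x => K * normal_pdf 0 (Num.sqrt 2) x).
  by apply: igZ => //; exact: integrable_normal_pdf.
apply: le_integrable Iw => //.
  apply/measurable_EFinP; apply: measurable_funM; last exact: measurable_gpdf.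
  exact: measurable_funX.
move=> x _ /=; rewrite lee_fin.
have pk1 : 0 <= normal_peak (1 : R) by exact: normal_peak_ge0.
have K0 : 0 <= K by rewrite divr_ge0// ?mulr_ge0// ltW.
rewrite (ger0_norm (mulr_ge0 K0 (normal_pdf_ge0 _ _ _))).
rewrite normrM normrX (ger0_norm (gpdf_ge0 x)) gpdfE.
have -> : normal_pdf 0 (Num.sqrt 2) x =
    normal_peak (Num.sqrt 2) * expR (- (x ^+ 2 / (2 *+ 2))).
  by rewrite normal_pdfE//; congr (_ * expR _); rewrite subr0 sqr_sqrtr// mulNr.
have -> : K * (normal_peak (Num.sqrt 2) * expR (- (x ^+ 2 / (2 *+ 2)))) =
    C * normal_peak 1 * expR (- (x ^+ 2 / (2 *+ 2))).
  by rewrite /K mulrA divfK// gt_eqF.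
have -> : expR (- (x ^+ 2 / 2)) = expR (- (x ^+ 2 / 4)) * expR (- (x ^+ 2 / (2 *+ 2))).
  by rewrite -expRD; congr expR; rewrite -mulr_natr; field.
set e1 := expR (- (x ^+ 2 / 4)); set e2 := expR _.
have -> : `|x| ^+ r * (normal_peak 1 * (e1 * e2)) =
  normal_peak 1 * (e2 * (`|x| ^+ r * e1)) by ring.
have -> : C * normal_peak 1 * e2 = normal_peak 1 * (e2 * C) by ring.
apply: ler_wpM2l => //; apply: ler_wpM2l; first exact: expR_ge0.
by rewrite /e1 expRN ler_pdivrMr ?expR_gt0.
Qed.

Lemma gigD (f h : R -> R) : gig f -> gig h -> gig (fun x => f x + h x).
Proof.
move=> If Ih; have := igD measurableT If Ih; rewrite /gig.
rewrite (_ : (fun x => f x * gpdf x + h x * gpdf x) = fun x => (f x + h x) * gpdf x)//.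
by apply/funext => x; rewrite mulrDl.
Qed.

Lemma gigZ (c : R) (f : R -> R) : gig f -> gig (fun x => c * f x).
Proof.
move=> If; have := igZ measurableT c If; rewrite /gig.
rewrite (_ : (fun x => c * (f x * gpdf x)) = fun x => (c * f x) * gpdf x)//.
by apply/funext => x; rewrite mulrA.
Qed.

Lemma gexpD f h : gig f -> gig h -> gexp (fun x => f x + h x) = gexp f + gexp h.
Proof.
move=> If Ih; rewrite -RintegralD//; apply: eq_Rintegral => x _.
by rewrite mulrDl.
Qed.

Lemma gexpZ c f : gig f -> gexp (fun x => c * f x) = c * gexp f.
Proof.
move=> If; rewrite -RintegralZl//; apply: eq_Rintegral => x _.
by rewrite mulrA.
Qed.

Lemma gexp_abs_le f h : gig f -> gig h -> (forall x, `|f x| <= h x) ->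
  `|gexp f| <= gexp h.
Proof.
move=> If Ih fh; apply: Rintegral_abs_le => // x _.
by rewrite normrM (ger0_norm (gpdf_ge0 x)) ler_wpM2r// gpdf_ge0.
Qed.

Lemma gig_bounded (f : R -> R) (C : R) : measurable_fun setT f -> (forall x, `|f x| <= C) -> gig f.
Proof.
move=> mf fC.
have Iw : ig mu setT (fun x => `|C| * gpdf x).
  by apply: igZ => //; exact: integrable_normal_pdf.
apply: le_integrable Iw => //.
  by apply/measurable_EFinP; apply: measurable_funM => //; exact: measurable_gpdf.
move=> x _ /=; rewrite lee_fin normrM (ger0_norm (gpdf_ge0 x)).
rewrite (ger0_norm (mulr_ge0 (normr_ge0 C) (gpdf_ge0 x))) ler_wpM2r ?gpdf_ge0//.
by rewrite (le_trans (fC x))// ler_norm.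
Qed.

Lemma gexp_cst c : gexp (fun=> c) = c.
Proof.
rewrite /gexp RintegralZl//; last exact: integrable_normal_pdf.
by rewrite /Rintegral integral_normal_pdf mulr1.
Qed.

End gaussian_moments.

Section gaussian_moment_values.
Context {R : realType}.
Local Notation mu := (@lebesgue_measure R).

Lemma pow_gpdf_bound k : exists C : R, forall x : R, `|x ^+ k * gpdf x| <= C.
Proof.
have [C [C0 CP]] := @pow_gauss_bound R k; exists (C * normal_peak 1) => x.
have pk1 : 0 <= normal_peak (1 : R) by exact: normal_peak_ge0.
rewrite normrM normrX (ger0_norm (gpdf_ge0 x)) gpdfE.
have e4 : expR (x ^+ 2 / 4) * expR (- (x ^+ 2 / 2)) <= 1.
  rewrite -expRD -[leRHS]expR0 ler_expR.
  by have := sqr_ge0 x; lra.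
have h := ler_wpM2r (expR_ge0 (- (x ^+ 2 / 2))) (CP x).
have h2 := ler_wpM2l C0 e4.
rewrite mulrCA [C * _]mulrC; apply: ler_wpM2l => //.
apply: (le_trans h); rewrite -mulrA; lra.
Qed.

(** The function [h] times the density is the derivative of [F = - x^k gpdf]. On [[-N, N]] its
    integral is the boundary term, of order [1 / N]; outside, [|h|] is at most [|x h| / N] with
    [x h] integrable against the density. Hence the integral [I] is of order [1 / N] for every [N]
    and vanishes. For [k = 0] the truncated [k.-1] is multiplied by 0. *)
Lemma gexp_pow_step k :
  gexp (fun x : R => x ^+ k.+1) = k%:R * gexp (fun x : R => x ^+ k.-1).
Proof.
pose h (x : R) := x ^+ k.+1 + - k%:R * x ^+ k.-1.
have gk1 := @gig_pow R k.+1; have gk := @gig_pow R k.-1.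
have gh : gig h by apply: gigD => //; exact: gigZ.
apply/eqP; rewrite -subr_eq0 -mulNr -gexpZ// -gexpD//; last exact: gigZ.
rewrite -/h; set I := gexp h.
pose xh (x : R) := x * h x * gpdf x.
have Ixh : ig mu setT xh.
  have : gig (fun x : R => x ^+ k.+2 + - k%:R * x ^+ (k.-1).+1).
    by apply: gigD; [exact: gig_pow|apply: gigZ; exact: gig_pow].
  rewrite /gig (_ : (fun x => _) = xh)//; apply/funext => x.
  by rewrite /xh /h !exprS; ring.
have [C1 C1P] := pow_gpdf_bound k.+1.
set C2 := \int[mu]_x `|xh x|.
have key (N : nat) : (0 < N)%N -> `|I| <= (2 * C1 + C2) / N%:R.
  move=> N0; have NR : 0 < N%:R :> R by rewrite ltr0n.
  have NN : - N%:R < N%:R :> R by lra.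
  pose F (x : R) := - (x ^+ k * gpdf x).
  have dF (x : R) : is_derive x 1 F (h x * gpdf x).
    have dd := dvN (dvM (dvX k (dv_id x)) (dv_gpdf x)).
    apply: (dv_eq dd); rewrite /h mulr1 exprS; ring.
  have cF : con (- N%:R) N%:R (fun x => h x * gpdf x).
    apply: con_dv => x _.
    exact: dvM (dvD (dvX k.+1 (dv_id x)) (dvZ (- k%:R) (dvX k.-1 (dv_id x)))) (dv_gpdf x).
  have FTC := Rintegral_FTC NN cF (fun x _ => dF x).
  have Fb (x : R) : `|x| = N%:R -> `|F x| <= C1 / N%:R.
    move=> xN; rewrite ler_pdivlMr// /F normrN -xN -normrM.
    by have := C1P x; rewrite exprS -mulrA mulrC.
  have [FN FmN] : `|F N%:R| <= C1 / N%:R /\ `|F (- N%:R)| <= C1 / N%:R.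
    by split; apply: Fb; rewrite ?normrN normr_nat.
  set J := \int[mu]_(x in `[- N%:R, N%:R]) (h x * gpdf x) in FTC.
  have JE : J = \int[mu]_x ((fun x => h x * gpdf x) \_ `[- N%:R, N%:R]) x.
    by rewrite /J Rintegral_mkcond.
  have IJ : `|I - J| <= C2 / N%:R.
    rewrite JE /I /gexp -RintegralB//; last first.
      have := (@integrable_mkcond _ _ _ mu `[- N%:R, N%:R] (EFin \o (fun x => h x * gpdf x)) (measurable_itv _)).1.
      rewrite restrict_EFin; apply; exact: con_ig.
    rewrite mulrC -RintegralZl//; last exact: ig_abs.
    apply: Rintegral_abs_le => //.
    - apply: igB => //.
      have := (@integrable_mkcond _ _ _ mu `[- N%:R, N%:R] (EFin \o (fun x => h x * gpdf x)) (measurable_itv _)).1.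
      rewrite restrict_EFin; apply; exact: con_ig.
    - by apply: igZ => //; exact: ig_abs.
    move=> x _; rewrite patchE; case: ifPn => [_|].
      by rewrite subrr normr0 mulr_ge0 ?invr_ge0.
    rewrite notin_setE/= in_itv/= => xN.
    rewrite subr0 ler_pdivlMl// /xh -mulrA [`|x * _|]normrM ler_wpM2r//.
    rewrite leNgt; apply/negP => xN'; apply: xN.
    by move: xN'; rewrite ltr_norml => /andP[/ltW -> /ltW ->].
  rewrite -[I](subrK J) (le_trans (ler_normD _ _))// addrC mulrDl.
  apply: lerD => //; rewrite FTC (le_trans (ler_normB _ _))//.
  by rewrite -mulrA mulr_natl mulr2n; exact: lerD.
apply/eqP/normr0_eq0/eqP; rewrite eq_le normr_ge0 andbT leNgt; apply/negP => I0.
have D0 : 0 <= 2 * C1 + C2.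
  by have := key 1%N isT; rewrite divr1; apply: le_trans.
set N := (Num.bound ((2 * C1 + C2) / `|I|)).+1.
have := key N isT; rewrite ler_pdivlMr ?ltr0n// leNgt => /negP; apply.
rewrite -ltr_pdivrMl// mulrC.
apply: lt_le_trans (archi_boundP _) _; first by rewrite divr_ge0.
by rewrite ler_nat.
Qed.

Lemma gexp_pow r : gexp (fun x : R => x ^+ r) = gauss_moment r.
Proof.
suff : gexp (fun x : R => x ^+ r) = gauss_moment r /\
  gexp (fun x : R => x ^+ r.+1) = gauss_moment r.+1 by case.
elim: r => [|r [ih1 ih2]].
  split; last by rewrite gexp_pow_step mul0r.
  by rewrite (_ : (fun x => x ^+ 0) = fun=> 1) ?gexp_cst//; apply/funext => x.
by split=> //; rewrite gexp_pow_step ih1.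
Qed.

(** This is what makes the moment method succeed: the moment divided by the factorial still decays
    factorially, so the Gaussian Taylor remainder tends to 0 for every frequency. *)
Lemma gauss_moment_fact q :
  gauss_moment q.*2 / (q.*2)`!%:R = (2^-1) ^+ q / q`!%:R :> R.
Proof.
elim: q => [|q ih]; first by rewrite /= fact0.
rewrite doubleS /= !factS !natrM.
have f0 := @factS_neq0 R q.*2; have f1 := @factS_neq0 R q.
have -> : gauss_moment q.*2 = (2^-1) ^+ q / q`!%:R * (q.*2)`!%:R :> R.
  by rewrite -ih divfK.
have -> : q.*2.+2%:R = 2 * q.+1%:R :> R by rewrite -natrM mul2n.
have a0 : (q.+1%:R : R) != 0 by rewrite pnatr_eq0.
have b0 : (q.*2.+1%:R : R) != 0 by rewrite pnatr_eq0.
rewrite exprS; move: (q.+1%:R : R) (q.*2.+1%:R : R) (q`!%:R : R) ((q.*2)`!%:R : R) a0 b0 f0 f1.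
by move=> a b c d a0 b0 d0 c0; field; rewrite a0 b0 c0 d0.
Qed.

End gaussian_moment_values.

Section cos_limit.
Context {R : realType}.

Lemma gexp_sum (I : eqType) (s : seq I) (F : I -> R -> R) :
  (forall i, gig (F i)) ->
  gig (fun x => \sum_(i <- s) F i x) /\
  gexp (fun x => \sum_(i <- s) F i x) = \sum_(i <- s) gexp (F i).
Proof.
move=> IF; elim: s => [|i s [ih1 ih2]].
  rewrite big_nil (_ : (fun x => _) = fun=> 0); last by apply/funext => x; rewrite big_nil.
  split; last exact: gexp_cst.
  by apply: (@gig_bounded _ _ 0) => // x; rewrite normr0.
rewrite big_cons (_ : (fun x => _) = fun x => F i x + \sum_(i <- s) F i x).
  by split; [exact: gigD|rewrite gexpD// ih2].
by apply/funext => x; rewrite big_cons.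
Qed.

Lemma gig_cos (b t : R) : gig (fun y => cos (b + t * y)).
Proof.
apply: (@gig_bounded _ _ 1); last by move=> y; rewrite ler_norml cos_geN1 cos_le1.
apply: continuous_measurable_fun => y.
exact: dv_continuous (dv_cos (dvD (dv_cst b y) (dvZ t (dv_id y)))).
Qed.

Lemma cos_taylor_scale (b t y : R) m :
  cos_taylor b (t * y) m =
  \sum_(r < m) cos (b + r%:R * (pi / 2)) * (t ^+ r / r`!%:R) * y ^+ r.
Proof. by apply: eq_bigr => r _; rewrite exprMn; ring. Qed.

Lemma even_pow_norm (t y : R) q :
  `|t * y| ^+ q.*2 = `|t| ^+ q.*2 * y ^+ q.*2.
Proof.
rewrite normrM exprMn; congr (_ * _).
by rewrite -mul2n !exprM real_normK// num_real.
Qed.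

(** The truncation order is even so that the absolute moment in the remainder is an ordinary moment,
    available also for the sums. *)
Lemma gexp_cos_taylor (b t : R) q :
  `|gexp (fun y => cos (b + t * y)) -
    \sum_(r < q.*2) cos (b + r%:R * (pi / 2)) * (t ^+ r / r`!%:R) * gauss_moment r|
  <= `|t| ^+ q.*2 / (q.*2)`!%:R * gauss_moment q.*2.
Proof.
pose F (r : 'I_q.*2) y := cos (b + r%:R * (pi / 2)) * (t ^+ r / r`!%:R) * y ^+ r.
have gF r : gig (F r) by apply: gigZ; exact: gig_pow.
have [gS eS] := gexp_sum (index_enum 'I_q.*2) gF.
have -> : \sum_(r < q.*2) cos (b + r%:R * (pi / 2)) * (t ^+ r / r`!%:R) * gauss_moment r
   = gexp (fun y => \sum_(r < q.*2) F r y).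
  rewrite eS; apply: eq_bigr => r _.
  by rewrite -gexp_pow -gexpZ//; exact: gig_pow.
rewrite -mulN1r -gexpZ// -gexpD//; [|exact: gig_cos|exact: gigZ].
rewrite -gexp_pow -gexpZ; last exact: gig_pow.
apply: gexp_abs_le.
- by apply: gigD; [exact: gig_cos|exact: gigZ].
- by apply: gigZ; exact: gig_pow.
move=> y; rewrite mulN1r -cos_taylor_scale.
apply: (le_trans (cos_taylor_bound _ _ _)).
by rewrite even_pow_norm mulrAC.
Qed.

Variables (A B : R).
Hypothesis AB : A < B.

Lemma con_comp (f h : R -> R) : continuous h -> con A B f ->
  con A B (fun x => h (f x)).
Proof. by move=> ch cf x xAB; have := continuous_comp (cf x xAB) (ch (f x)). Qed.

Lemma avg_cos_taylor (Y : R -> R) (b t : R) q : con A B Y ->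
  `|avg A B (fun x => cos (b + t * Y x)) -
    \sum_(r < q.*2) cos (b + r%:R * (pi / 2)) * (t ^+ r / r`!%:R)
       * avg A B (fun x => Y x ^+ r)|
  <= `|t| ^+ q.*2 / (q.*2)`!%:R * avg A B (fun x => Y x ^+ q.*2).
Proof.
move=> cY.
have cc : con A B (fun x => cos (b + t * Y x)).
  apply: con_comp (@continuous_cos R) _.
  by apply: conD; [exact: con_cst|apply: conM => //; exact: con_cst].
pose F (r : 'I_q.*2) x := cos (b + r%:R * (pi / 2)) * (t ^+ r / r`!%:R) * Y x ^+ r.
have cF r : con A B (F r) by apply: conM; [exact: con_cst|exact: conX].
have cS : con A B (fun x => \sum_(r < q.*2) F r x) by exact: con_sum.
have -> : \sum_(r < q.*2) cos (b + r%:R * (pi / 2)) * (t ^+ r / r`!%:R)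
    * avg A B (fun x => Y x ^+ r) = avg A B (fun x => \sum_(r < q.*2) F r x).
  rewrite avg_sum; last by move=> r _; exact: con_ig.
  by apply: eq_bigr => r _; rewrite -avgZ//; apply: con_ig => //; exact: conX.
rewrite -avgB; try exact: con_ig.
rewrite -avgZ; last by apply: con_ig => //; exact: conX.
apply: avg_abs_le => //.
- by apply: con_ig => //; exact: conB.
- by apply: con_ig => //; apply: conM; [exact: con_cst|exact: conX].
move=> x _; rewrite -cos_taylor_scale.
apply: (le_trans (cos_taylor_bound _ _ _)).
by rewrite even_pow_norm mulrAC.
Qed.

End cos_limit.

(** * Convergence for cosines *)

Section cos_clt.
Context {R : realType}.
Variables (A B xi : R).
Hypotheses (A1 : 1 < A) (AB : A < B) (xi0 : 0 < xi).
Variable g : @trigpoly R.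
Hypotheses (g0 : tpmean g = 0) (v0 : 0 < tpvar g).

Definition nsum (l : seq nat) (x : R) : R :=
  tpsum xi g l x / (Num.sqrt (tpvar g) * Num.sqrt (size l)%:R).

Lemma con_nsum l : con A B (nsum l).
Proof. by apply: conM; [exact: con_tpsum|exact: con_cst]. Qed.

Lemma eventually_forall_lt (P : nat -> seq nat -> Prop) m :
  (forall r, exists n0 : nat, forall l, path ltn 0 l -> (n0 <= size l)%N -> P r l) ->
  exists n0 : nat, forall l, path ltn 0 l -> (n0 <= size l)%N ->
    forall r, (r < m)%N -> P r l.
Proof.
move=> H; elim: m => [|m [n1 ih]]; first by exists 0%N.
have [n2 H2] := H m; exists (maxn n1 n2) => l pl; rewrite geq_max => /andP[l1 l2] r.
rewrite ltnS leq_eqVlt => /predU1P[->|]; first exact: H2.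
exact: ih.
Qed.

Lemma exp_fact_small (t eps : R) : 0 < eps -> exists q : nat, `|t| ^+ q / q`!%:R < eps.
Proof.
move=> eps0; have := cvg_exp_coeff `|t|.
move=> /cvgrPdist_lt /(_ _ eps0) [q _ /(_ q (leqnn _))] /=.
rewrite sub0r normrN ger0_norm; last by rewrite divr_ge0.
by exists q.
Qed.

Lemma cos_clt (b t eps : R) : 0 < eps -> exists n0 : nat,
  forall l, path ltn 0 l -> (n0 <= size l)%N ->
  `|avg A B (fun x => cos (b + t * nsum l x)) - gexp (fun y => cos (b + t * y))| < eps.
Proof.
move=> eps0.
(* Budget: less than [eps / 6] for the Gaussian remainder, twice that for the remainder of the sum,
   whose moment of order [m] is at most twice the Gaussian one, and [eps / 2] for the difference of
   the Taylor sums. *)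
have e6 : 0 < eps / 6 by rewrite divr_gt0.
have [q qP] := exp_fact_small (t ^+ 2 / 2) e6.
set m := q.*2.
have gmE : `|t| ^+ m / m`!%:R * gauss_moment m < eps / 6.
  rewrite mulrAC -mulrA gauss_moment_fact; apply: le_lt_trans qP.
  have t2 : 0 <= t ^+ 2 / 2 by rewrite divr_ge0 ?sqr_ge0.
  rewrite (ger0_norm t2) mulrA /m -mul2n exprM real_normK ?num_real//.
  by rewrite -exprMn.
have gm1 : 1 <= gauss_moment m :> R.
  rewrite /m; elim: (q) => [//|n ih] /=.
  by rewrite -[leLHS]mul1r ler_pM// ler1n.
set c := fun r : nat => cos (b + r%:R * (pi / 2)) * (t ^+ r / r`!%:R).
set S := \sum_(r < m) `|c r|.
have S0 : 0 <= S by apply: sumr_ge0.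
set de := Num.min 1 (eps / (2 * (1 + S))).
have de0 : 0 < de.
  by rewrite lt_min ltr01 divr_gt0// mulr_gt0// ltr_wpDr.
have de1 : de <= 1 by rewrite ge_min lexx.
have deS : de * S <= eps / 2.
  apply: (@le_trans _ _ (eps / (2 * (1 + S)) * S)).
    by rewrite ler_wpM2r// ge_min lexx orbT.
  rewrite mulrAC ler_pdivrMr ?mulr_gt0// ?ltr_wpDr//.
  have : 0 <= eps by exact: ltW.
  lra.
have [n0 n0P] := @eventually_forall_lt (fun r l =>
    `|avg A B (fun x => nsum l x ^+ r) - gauss_moment r| < de) m.+1
    (fun r => moment_cvg A1 AB xi0 g0 r v0 de0).
exists n0 => l pl nl; have H := n0P l pl nl.
have h1 := gexp_cos_taylor b t q.
have h2 := avg_cos_taylor AB b t q (@con_nsum l).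
rewrite -/m in h1 h2.
have h3 : `|avg A B (fun x => nsum l x ^+ m) - gauss_moment m| < de by exact: H.
set T1 := \sum_(r < m) _ * gauss_moment r in h1.
set T2 := \sum_(r < m) _ in h2.
have h4 : `|T2 - T1| <= de * S.
  rewrite /T1 /T2 -sumrB (le_trans (ler_norm_sum _ _ _))// mulr_sumr.
  apply: ler_sum => r _; rewrite -mulrBr normrM mulrC ler_wpM2r//.
  by apply: ltW; apply: H; rewrite ltnS ltnW.
set K := `|t| ^+ m / m`!%:R in gmE h1 h2.
have K0 : 0 <= K by rewrite divr_ge0// exprn_ge0.
have h5 : avg A B (fun x => nsum l x ^+ m) <= 2 * gauss_moment m.
  by move: h3; rewrite ltr_norml => /andP[_]; lra.
have h6 := ler_wpM2l K0 h5.
set a := avg A B _ in h2 *; set e := gexp _ in h1 *.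
have -> : a - e = (a - T2) + (T2 - T1) - (e - T1) by ring.
apply: le_lt_trans (ler_normB _ _) _.
apply: le_lt_trans (lerD (ler_normD _ _) (lexx _)) _.
lra.
Qed.

Lemma trigpoly_clt (h : @trigpoly R) (c eps : R) : 0 < eps -> exists n0 : nat,
  forall l, path ltn 0 l -> (n0 <= size l)%N ->
  `|avg A B (fun x => tpeval h (c * nsum l x)) - gexp (fun y => tpeval h (c * y))| < eps.
Proof.
move=> eps0.
have tpE (y : R) : tpeval h (c * y) =
    \sum_(p <- h) p.1 * cos (p.2.2 + 2 * pi * p.2.1%:~R * c * y).
  by apply: eq_bigr => p _; rewrite addrC !mulrA.
set S := coef_norm h; have S0 : 0 <= S by exact: coef_norm_ge0.
set de := eps / (1 + S).
have de0 : 0 < de by rewrite divr_gt0// ltr_wpDr.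
have [n0 n0P] : exists n0 : nat, forall l, path ltn 0 l -> (n0 <= size l)%N ->
    forall p, p \in h -> `|avg A B (fun x => cos (p.2.2 + 2 * pi * p.2.1%:~R * c * nsum l x))
      - gexp (fun y => cos (p.2.2 + 2 * pi * p.2.1%:~R * c * y))| < de.
  elim: (h) => [|p h' [n1 ih]]; first by exists 0%N.
  have [n2 n2P] := cos_clt p.2.2 (2 * pi * p.2.1%:~R * c) de0.
  exists (maxn n1 n2) => l pl; rewrite geq_max => /andP[l1 l2] p'.
  rewrite in_cons => /predU1P[->|]; first exact: n2P.
  exact: ih.
exists n0 => l pl nl.
pose F (p : R * (int * R)) y := p.1 * cos (p.2.2 + 2 * pi * p.2.1%:~R * c * y).
have gF p : gig (F p) by apply: gigZ; exact: gig_cos.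
have [_ gE] := gexp_sum h gF.
rewrite (_ : (fun y => tpeval h (c * y)) = fun y => \sum_(p <- h) F p y); last first.
  by apply/funext => y; rewrite tpE.
rewrite gE (@avg_eq _ _ _ _ (fun x => \sum_(p <- h) F p (nsum l x))); last first.
  by move=> x _; rewrite tpE.
have cC (p : R * (int * R)) : con A B (fun x => cos (p.2.2 + 2 * pi * p.2.1%:~R * c * nsum l x)).
  apply: con_comp (@continuous_cos R) _.
  apply: conD; first exact: con_cst.
  by apply: conM; [exact: con_cst|exact: con_nsum].
rewrite avg_sum//; last first.
  by move=> p _; exact: con_ig (conM (@con_cst _ A B p.1) (cC p)).
rewrite -sumrB; apply: le_lt_trans (ler_norm_sum _ _ _) _.
apply: (@le_lt_trans _ _ (S * de)); last first.
  by rewrite /de mulrCA gtr_pMr// ltr_pdivrMr ?ltr_wpDr// mul1r ltrDr.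
rewrite /S /coef_norm mulr_suml big_seq [leRHS]big_seq; apply: ler_sum => p ph.
rewrite /F avgZ; last by apply: con_ig.
rewrite gexpZ; last exact: gig_cos.
by rewrite -mulrBr normrM ler_wpM2l// ltW// n0P.
Qed.

End cos_clt.

Section sine_bounds.
Context {R : realType}.

(** Halving the angle: on [[0, pi / 4]] the cosine is at least [cos (pi / 4)], so
    [sin x = 2 sin (x / 2) cos (x / 2)] contains this number twice, and its square is 1/2. *)
Lemma sin_ge_half (x : R) : 0 <= x <= pi / 2 -> x / 2 <= sin x.
Proof.
move=> /andP[x0 xpi].
have c4 : cos (pi / 4) ^+ 2 = 1 / 2 :> R.
  have := @cos_pihalf R; have -> : pi / 2 = (pi / 4) *+ 2 :> R by rewrite mulr2n; field.
  by rewrite cos_mulr2n mulr2n; lra.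
have c4p : 0 <= cos (pi / 4) :> R.
  by apply: cos_ge0_pihalf; have := @pi_ge0 R; lra.
have cosm (t : R) : 0 <= t <= pi / 4 -> cos (pi / 4) <= cos t.
  move=> /andP[t0 t4]; have := @pi_ge0 R => pi0.
  have m1 : t \in `[0, pi] by rewrite in_itv/=; lra.
  have m2 : (pi / 4 : R) \in `[0, pi] by rewrite in_itv/=; lra.
  by rewrite leNgt (ltr_cos m2 m1) -leNgt.
have x20 : 0 <= x / 2 by lra.
have h := @derive_bound_le R sin cos (cos (pi / 4)) 0 (x / 2) x20
  (fun z _ => is_derive_sin z).
rewrite sin0 !subr0 in h.
have {}h : cos (pi / 4) * (x / 2) <= sin (x / 2).
  by apply: h => z zx; apply: cosm; lra.
have h2 : cos (pi / 4) <= cos (x / 2) by apply: cosm; lra.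
have -> : x = (x / 2) *+ 2 by rewrite mulr2n; field.
rewrite [in leRHS]sin_mulr2n.
have -> : (x / 2) *+ 2 / 2 = x / 2 by rewrite mulr2n; field.
have h3 : cos (pi / 4) * (cos (pi / 4) * (x / 2)) <= cos (x / 2) * sin (x / 2).
  by apply: ler_pM => //; rewrite mulr_ge0.
rewrite mulrA -expr2 c4 in h3.
rewrite [leRHS]mulr2n; lra.
Qed.

Lemma sqr_le_sin (z : R) : `|z| <= 1 / 2 -> z ^+ 2 <= sin (pi * z) ^+ 2.
Proof.
move=> z2.
have -> : sin (pi * z) ^+ 2 = sin (pi * `|z|) ^+ 2.
  by case: (ger0P z) => // _; rewrite mulrN sinN sqrrN.
rewrite -(real_normK (num_real z)).
have p2 := @pi_ge2 R; have z0 := normr_ge0 z.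
have h : 0 <= pi * `|z| <= pi / 2.
  rewrite mulr_ge0 ?pi_ge0//= ler_wpM2l ?pi_ge0//; lra.
have := sin_ge_half h => hs.
have h2 : `|z| <= sin (pi * `|z|).
  apply: le_trans hs; rewrite mulrAC ler_peMl//; lra.
by rewrite ler_sqr ?nnegrE// (le_trans z0).
Qed.

(** The range goes past 1/2 because a point in [[-1/4, 1/4]] and a node in [[-1/2, 1/2]] may differ
    by 3/4. Beyond 1/2 the reflection [1 - |z|] is at least 1/4, and 9 is the ratio of 9/16 to
    1/16. *)
Lemma sqr_le_9sin (z : R) : `|z| <= 3 / 4 -> z ^+ 2 <= 9 * sin (pi * z) ^+ 2.
Proof.
move=> z34; have [z2|z2] := leP `|z| (1 / 2).
  have := sqr_le_sin z2; have := sqr_ge0 (sin (pi * z)); lra.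
have h1 : `|1 - `|z| | <= 1 / 2 by rewrite ger0_norm; lra.
have h := sqr_le_sin h1.
have -> : sin (pi * z) ^+ 2 = sin (pi * (1 - `|z|)) ^+ 2.
  rewrite mulrBr mulr1 addrC sinDpi sqrrN sinN sqrrN.
  by case: (ger0P z) => // _; rewrite mulrN sinN sqrrN.
rewrite -(real_normK (num_real z)).
have z16 : 1 / 16 <= (1 - `|z|) ^+ 2 by rewrite expr2; nra.
have z9 : `|z| ^+ 2 <= 9 / 16.
  have := normr_ge0 z; rewrite expr2; nra.
lra.
Qed.

End sine_bounds.

(** * A positive trigonometric kernel *)

Section kernel.
Context {R : realType}.

(** The even power [2 n] of [cos (pi u)], written as the power [n] of [(1 + cos (2 pi u)) / 2]:
    nonnegative, of degree at most [n], and concentrated near the integers. *)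
Definition cos2pow (n : nat) : @trigpoly R :=
  tppow [:: (2^-1, (0, 0)); (2^-1, (1, 0))] n.

Lemma cos2powE n (u : R) : tpeval (cos2pow n) u = (cos (pi * u) ^+ 2) ^+ n.
Proof.
rewrite tpeval_pow; congr (_ ^+ _).
rewrite /tpeval big_cons big_seq1/= !addr0 mulr0 mul0r cos0.
have -> : 2 * pi * 1%:~R * u = (pi * u) *+ 2 by rewrite mulr2n; ring.
by rewrite cos_mulr2n mulr2n; field.
Qed.

Lemma cos2pow_norm n : coef_norm (cos2pow n) = 1.
Proof.
rewrite coef_norm_pow /coef_norm big_cons big_seq1/=.
by rewrite ger0_norm ?invr_ge0// (_ : 2^-1 + 2^-1 = 1 :> R) ?expr1n//; field.
Qed.

Lemma cos2pow_deg n : tpdeg_le n (cos2pow n).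
Proof.
rewrite -[n in tpdeg_le n]muln1; apply: tpdeg_pow => p.
by rewrite !inE => /orP[] /eqP ->.
Qed.

Definition cos2mean n : R := tpmean (cos2pow n).

Lemma cos2mean0 : cos2mean 0 = 1.
Proof. exact: tpmean_cst. Qed.

(** Wallis recursion: the function [cos^(2n+1) sin] of [pi u] has equal values at 0 and 1, so its
    derivative integrates to 0. *)
Lemma cos2meanS n : (2 * n + 2)%:R * cos2mean n.+1 = (2 * n + 1)%:R * cos2mean n.
Proof.
rewrite /cos2mean -!tpmeanE.
have H01 : (0 : R) < 1 by [].
have ct m : con 0 1 (tpeval (cos2pow m)) by move=> x _; exact: continuous_tpeval.
have mI : measurable (`[0, 1]%classic : set R) by exact: measurable_itv.
have It m := con_ig (ct m).
pose F (u : R) := cos (pi * u) ^+ (2 * n + 1) * sin (pi * u).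
pose f (u : R) := pi * ((2 * n + 2)%:R * tpeval (cos2pow n.+1) u
  - (2 * n + 1)%:R * tpeval (cos2pow n) u).
have dF (u : R) : is_derive u 1 F (f u).
  have dp := dvZ pi (dv_id u).
  apply: (dv_eq (dvM (dvX (2 * n + 1) (dv_cos dp)) (dv_sin dp))).
  rewrite /f !cos2powE mulr1 addn1 -pred_Sn.
  have sE : sin (pi * u) ^+ 2 = 1 - cos (pi * u) ^+ 2.
    by rewrite -(cos2Dsin2 (pi * u)); ring.
  rewrite [X in X + _](_ : _ = pi * ((cos (pi * u) ^+ 2) ^+ n.+1)); last first.
    by rewrite -exprM mulnS addnC exprD; rewrite !exprS expr0; ring.
  rewrite [X in _ + X](_ : _ = - pi * (2 * n).+1%:R * (cos (pi * u) ^+ 2) ^+ n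
     * sin (pi * u) ^+ 2); last by rewrite -exprM expr2; ring.
  rewrite sE addn2 -[(2 * n).+2%:R]natr1 exprS; ring.
have cf : con 0 1 f.
  apply: conM; first exact: con_cst.
  by apply: conB; apply: conM => //; exact: con_cst.
have := Rintegral_FTC H01 cf (fun x _ => dF x).
rewrite /F mulr1 mulr0 sinpi sin0 !mulr0 subr0 /f.
rewrite (RintegralZl pi)//; last by apply: igB => //; exact: igZ.
rewrite RintegralB//; try exact: igZ.
rewrite (RintegralZl (2 * n + 2)%:R) ?(RintegralZl (2 * n + 1)%:R)//; try exact: It.
by move=> /eqP; rewrite mulf_eq0 gt_eqF ?pi_gt0//= subr_eq0 => /eqP.
Qed.

(** Far from the true order [n^(-1/2)], but it is needed only for positivity and for a polynomial
    bound on the coefficient norm of the kernel. *)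
Lemma cos2mean_gt n : n.+1%:R^-1 <= cos2mean n.
Proof.
elim: n => [|n ih]; first by rewrite cos2mean0 invr1.
have n0 : 0 < (2 * n + 2)%:R :> R by rewrite ltr0n addn2.
rewrite -(ler_pM2l n0) cos2meanS.
apply: (@le_trans _ _ ((2 * n + 1)%:R * n.+1%:R^-1)); last by rewrite ler_wpM2l.
have n1 : 0 < n.+1%:R :> R by rewrite ltr0n.
have n2 : 0 < n.+2%:R :> R by rewrite ltr0n.
rewrite ler_pdivrMr// mulrAC ler_pdivlMr// -!natrM ler_nat.
lia.
Qed.

Lemma cos2mean_gt0 n : 0 < cos2mean n.
Proof. by apply: lt_le_trans (cos2mean_gt n); rewrite invr_gt0 ltr0n. Qed.

Lemma sinD2piz (a : int) (x : R) : sin (x + 2 * pi * a%:~R) = sin x.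
Proof.
by rewrite -[LHS]cosBpihalf addrAC cosD2piz cosBpihalf.
Qed.

(** Multiplication by [sin th] makes the sum telescope, and the two ends differ by a multiple of
    [2 pi]. As [0 < |a| < M], the factor [sin th] is not 0. *)
Lemma discrete_cos_sum (M : nat) (a : int) (x : R) : a != 0 -> (`|a| < M)%N ->
  \sum_(i < M) cos (x - 2 * pi * a%:~R * (i%:R / M%:R)) = 0.
Proof.
move=> a0 aM; have M0 : 0 < M%:R :> R by rewrite ltr0n (leq_ltn_trans _ aM).
pose th : R := pi * (a%:~R / M%:R).
have sth : sin th != 0.
  have pos (n : nat) : (0 < n < M)%N -> 0 < sin (pi * (n%:R / M%:R)) :> R.
    move=> /andP[n0 nM]; apply: sin_gt0_pi.
    have pi0 := @pi_gt0 R; apply/andP; split.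
      by apply: mulr_gt0 => //; rewrite divr_gt0// ltr0n.
    by rewrite gtr_pMr// ltr_pdivrMr// mul1r ltr_nat.
  rewrite /th {th}; case: a a0 aM => n a0 aM.
    by rewrite gt_eqF//; apply: pos; rewrite aM lt0n andbT.
  rewrite NegzE mulrNz mulNr mulrN sinN oppr_eq0 gt_eqF//; exact: pos.
apply: (mulfI sth); rewrite mulr0 mulr_sumr.
pose G (i : nat) := sin (x - 2 * i%:R * th + th).
have step (i : nat) : sin th * cos (x - 2 * pi * a%:~R * (i%:R / M%:R)) =
    (G i - G i.+1) / 2.
  have -> : x - 2 * pi * a%:~R * (i%:R / M%:R) = x - 2 * i%:R * th.
    by rewrite /th; ring.
  rewrite /G; set z := x - 2 * i%:R * th.
  have -> : x - 2 * i.+1%:R * th + th = z - th by rewrite /z -natr1; ring.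
  by rewrite sinD sinB; field.
under eq_bigr do rewrite step.
rewrite -mulr_suml (eq_bigr (fun i : 'I_M => - (G i.+1 - G i))); last first.
  by move=> i _; rewrite opprB.
rewrite sumrN -(big_mkord xpredT (fun i => G i.+1 - G i)) telescope_sumr//.
rewrite /G mulr0 mul0r subr0.
have -> : x - 2 * M%:R * th + th = x + th + 2 * pi * (- a)%:~R.
  by rewrite /th mulrNz; field; rewrite gt_eqF.
by rewrite sinD2piz subrr oppr0 mul0r.
Qed.

Lemma discrete_mean (M n : nat) (h : @trigpoly R) (s u : R) : (n < M)%N ->
  tpdeg_le n h -> \sum_(i < M) tpeval h (u - (i%:R / M%:R + s)) = M%:R * tpmean h.
Proof.
move=> nM hn; rewrite exchange_big/= /tpmean mulr_sumr [RHS]big_mkcond/=.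
rewrite big_seq [RHS]big_seq; apply: eq_bigr => p ph.
rewrite -mulr_sumr; case: ifPn => [/eqP a0|a0].
  rewrite (eq_bigr (fun=> cos p.2.2)); last first.
    by move=> i _; rewrite a0 mulr0 mul0r add0r.
  by rewrite sumr_const card_ord -[cos _ *+ M]mulr_natl mulrCA.
rewrite (eq_bigr (fun i : 'I_M => cos ((2 * pi * p.2.1%:~R * (u - s) + p.2.2)
    - 2 * pi * p.2.1%:~R * (i%:R / M%:R)))); last first.
  by move=> i _; congr cos; ring.
by rewrite discrete_cos_sum ?mulr0// (leq_ltn_trans _ nM)// hn.
Qed.

(** The normalisation contains the number of nodes, so that the translates to [M > n] equally spaced
    nodes form a partition of unity ([kern_sum]): the mean over the nodes is exact for degrees below
    [M]. *)
Definition kern (n M : nat) (s : R) : @trigpoly R :=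
  tpscale (M%:R * cos2mean n)^-1 (tpshift s (cos2pow n)).

Lemma kernE n M s u :
  tpeval (kern n M s) u = (M%:R * cos2mean n)^-1 * (cos (pi * (u - s)) ^+ 2) ^+ n.
Proof. by rewrite tpeval_scale tpeval_shift cos2powE. Qed.

Lemma kern_ge0 n M s u : 0 <= tpeval (kern n M s) u.
Proof.
have c0 := ltW (cos2mean_gt0 n); rewrite kernE; apply: mulr_ge0.
  by rewrite invr_ge0 mulr_ge0.
by rewrite exprn_ge0// sqr_ge0.
Qed.

Lemma kern_deg n M s : tpdeg_le n (kern n M s).
Proof. by apply: tpdeg_scale; apply: tpdeg_shift; exact: cos2pow_deg. Qed.

Lemma kern_mean n M s : tpmean (kern n M s) = M%:R^-1.
Proof.
rewrite tpmean_scale tpmean_shift -/(cos2mean n) invfM -mulrA mulVf ?mulr1//.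
by rewrite gt_eqF// cos2mean_gt0.
Qed.

Lemma kern_norm n M s : coef_norm (kern n M s) <= n.+1%:R / M%:R.
Proof.
rewrite coef_norm_scale coef_norm_shift cos2pow_norm mulr1.
rewrite ger0_norm ?invr_ge0 ?mulr_ge0 ?(ltW (cos2mean_gt0 n))//.
rewrite invfM mulrC ler_wpM2r ?invr_ge0// -[leRHS]invrK lef_pV2 ?posrE//.
- exact: cos2mean_gt.
- exact: cos2mean_gt0.
Qed.

Lemma kern_sum n M s (u : R) : (n < M)%N ->
  \sum_(i < M) tpeval (kern n M (i%:R / M%:R + s)) u = 1.
Proof.
move=> nM; have M0 : (M%:R : R) != 0 by rewrite pnatr_eq0 -lt0n (leq_ltn_trans _ nM).
have c0 : cos2mean n != 0 by rewrite gt_eqF// cos2mean_gt0.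
under eq_bigr do rewrite tpeval_scale tpeval_shift.
rewrite -mulr_sumr (discrete_mean _ _ nM (@cos2pow_deg n)) -/(cos2mean n).
by rewrite mulVf// mulf_neq0.
Qed.

(** Replacing [sin^2] by [1 - cos^2] raises the power of the cosine by one, and the sum becomes 1
    minus the ratio of two consecutive Wallis means. The degree [n + 1] now occurs, hence the
    stronger condition on [M]. *)
Lemma kern_sin2 n M s (u : R) : (n.+1 < M)%N ->
  \sum_(i < M) tpeval (kern n M (i%:R / M%:R + s)) u
    * sin (pi * (u - (i%:R / M%:R + s))) ^+ 2 = (2 * n + 2)%:R^-1.
Proof.
move=> nM; have nM' : (n < M)%N by rewrite ltnW.
have M0 : (M%:R : R) != 0 by rewrite pnatr_eq0 -lt0n (leq_ltn_trans _ nM).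
have c0 : cos2mean n != 0 by rewrite gt_eqF// cos2mean_gt0.
have n0 : (2 * n + 2)%:R != 0 :> R by rewrite pnatr_eq0 addn2.
rewrite (eq_bigr (fun i : 'I_M => tpeval (kern n M (i%:R / M%:R + s)) u -
   (M%:R * cos2mean n)^-1 * tpeval (cos2pow n.+1) (u - (i%:R / M%:R + s)))); last first.
  move=> i _; rewrite cos2powE kernE [_ ^+ n.+1]exprS.
  have -> : sin (pi * (u - (i%:R / M%:R + s))) ^+ 2 =
     1 - cos (pi * (u - (i%:R / M%:R + s))) ^+ 2.
    exact: sin2cos2.
  ring.
rewrite sumrB kern_sum// -mulr_sumr (discrete_mean _ _ nM (@cos2pow_deg n.+1)).
rewrite -/(cos2mean n.+1).
have -> : cos2mean n.+1 = (2 * n + 1)%:R * cos2mean n / (2 * n + 2)%:R.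
  by rewrite -cos2meanS [RHS]mulrC mulKf.
apply: (mulfI n0); rewrite mulfV// mulrBr mulr1.
have -> : (2 * n + 2)%:R * ((M%:R * cos2mean n)^-1 *
  (M%:R * ((2 * n + 1)%:R * cos2mean n / (2 * n + 2)%:R))) = (2 * n + 1)%:R :> R.
  move: ((2 * n + 2)%:R : R) n0 ((2 * n + 1)%:R : R) => a a0 b.
  by field; rewrite ?M0 ?c0 ?a0.
by rewrite addn2 addn1 -[(2 * n).+2%:R]natr1; ring.
Qed.

(* The second moment of the kernel controls the approximation of [v] by the
   weighted mean of the [v_ i]. *)
Lemma kern_approx n M s (v_ o_ : 'I_M -> R) (v K u : R) : (n.+1 < M)%N ->
  (forall i, `|v_ i - v| <= o_ i + K * sin (pi * (u - (i%:R / M%:R + s))) ^+ 2) ->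
  `|\sum_(i < M) v_ i * tpeval (kern n M (i%:R / M%:R + s)) u - v| <=
  \sum_(i < M) o_ i * tpeval (kern n M (i%:R / M%:R + s)) u + K / (2 * n + 2)%:R.
Proof.
move=> nM vo.
have vE : v = \sum_(i < M) v * tpeval (kern n M (i%:R / M%:R + s)) u.
  by rewrite -mulr_sumr (kern_sum s u (ltnW nM)) mulr1.
rewrite [X in `|_ - X|]vE -sumrB.
apply: (le_trans (ler_norm_sum _ _ _)).
rewrite -(kern_sin2 s u nM) mulr_sumr -big_split/=; apply: ler_sum => i _.
rewrite -mulrBl normrM (ger0_norm (kern_ge0 _ _ _ _)).
apply: (le_trans (ler_wpM2r (kern_ge0 n M _ u) (vo i))).
by rewrite mulrDl -(mulrA K) [sin _ ^+ 2 * _]mulrC.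
Qed.

End kernel.

(** * Convergence for Lipschitz test functions *)

Section lipschitz_clt.
Context {R : realType}.

Lemma lip_continuous (f : R -> R) (L : R) :
  (forall x y, `|f x - f y| <= L * `|x - y|) -> continuous f.
Proof.
move=> fL x; apply/cvgrPdist_lt => e e0.
have L1 : 0 < `|L| + 1 by rewrite ltr_wpDl.
near=> y; apply: (le_lt_trans (fL x y)).
apply: (@le_lt_trans _ _ ((`|L| + 1) * `|x - y|)).
  by rewrite ler_wpM2r// (le_trans (ler_norm L))// lerDl.
rewrite -ltr_pdivlMl// mulrC; near: y.
have e1 : 0 < e / (`|L| + 1) by rewrite divr_gt0.
have /cvgrPdist_lt/(_ _ e1) : (id : R -> R) z @[z --> x] --> (id : R -> R) x by exact: cvg_id.
exact.
Unshelve. all: by end_near. Qed.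

Variables (A B xi : R).
Hypotheses (A1 : 1 < A) (AB : A < B) (xi0 : 0 < xi).
Variable g : @trigpoly R.
Hypotheses (g0 : tpmean g = 0) (v0 : 0 < tpvar g).

Local Notation nsum := (nsum xi g).

(** The polynomials, the nodes and the scale are chosen before [phi], which enters only through its
    values at the nodes. This makes the convergence uniform over all Lipschitz functions of a given
    constant, hence later uniform in [t]. *)
Lemma trig_approx (L T eta : R) : 0 <= L -> 0 < T -> 0 < eta ->
  exists M (h : 'I_M -> @trigpoly R) (y_ : 'I_M -> R) (c : R),
  forall phi : R -> R, (forall x, 0 <= phi x <= 1) ->
    (forall x y, `|phi x - phi y| <= L * `|x - y|) ->
  forall y, `|\sum_(i < M) phi (y_ i) * tpeval (h i) (c * y) - phi y| <=
    2 * eta + y ^+ 2 / T ^+ 2.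
Proof.
(* With the period [4 T] a point [|y| <= T] corresponds to [|u| <= 1/4], so its distance to any node
   is at most 3/4 and [sqr_le_9sin] applies. For [|y| > T] the term [y^2 / T^2] exceeds 1 and
   nothing is to be shown about the approximation. *)
move=> L0 T0 eta0; set P := 4 * T; have P0 : 0 < P by rewrite mulr_gt0.
set K := 9 * (L * P) ^+ 2 / (4 * eta).
have K0 : 0 <= K.
  by apply: divr_ge0; [apply: mulr_ge0 => //; exact: sqr_ge0|apply: mulr_ge0 => //; exact: ltW].
pose n := Num.bound (K / eta); pose M := n.+2.
have nK : K / (2 * n + 2)%:R <= eta.
  rewrite ler_pdivrMr ?ltr0n ?addn2// mulrC -ler_pdivrMr//.
  apply: (le_trans (ltW (archi_boundP _))); first by rewrite divr_ge0// ltW.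
  by rewrite ler_nat -/n; lia.
pose s := - (1 / 2) : R.
exists M, (fun i => kern n M (i%:R / M%:R + s)), (fun i => P * (i%:R / M%:R + s)), P^-1.
move=> phi phi01 phiL y.
have M0 : (0 : R) < M%:R by rewrite ltr0n.
have sb (i : 'I_M) : `|i%:R / M%:R + s| <= 1 / 2.
  have i0 : 0 <= i%:R / M%:R :> R by rewrite divr_ge0.
  have i1 : i%:R / M%:R <= 1 :> R by rewrite ler_pdivrMr// mul1r ler_nat ltnW.
  by rewrite ler_norml /s; lra.
set u := P^-1 * y.
have yu : y = P * u by rewrite /u mulVKf// gt_eqF.
have [yT|yT] := leP `|y| T; last first.
  set W := \sum_(i < M) _.
  have W01 : 0 <= W <= 1.
    apply/andP; split.
      apply: sumr_ge0 => i _; rewrite mulr_ge0// ?kern_ge0//.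
      by have /andP[] := phi01 (P * (i%:R / M%:R + s)).
    rewrite -(kern_sum (n := n) (M := M) s u (ltnW (ltnSn _))).
    apply: ler_sum => i _; rewrite ler_piMl ?kern_ge0//.
    by have /andP[] := phi01 (P * (i%:R / M%:R + s)).
  have y2 : 1 <= y ^+ 2 / T ^+ 2.
    rewrite ler_pdivlMr ?exprn_gt0// mul1r -(real_normK (num_real y)).
    by rewrite ler_sqr ?nnegrE// ltW.
  by have := phi01 y; rewrite ler_norml; lra.
have ub : `|u| <= 1 / 4.
  rewrite normrM gtr0_norm ?invr_gt0// ler_pdivrMl// /P; lra.
have H (i : 'I_M) : `|phi (P * (i%:R / M%:R + s)) - phi y| <=
    eta + K * sin (pi * (u - (i%:R / M%:R + s))) ^+ 2.
  set z := u - (i%:R / M%:R + s).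
  have z34 : `|z| <= 3 / 4.
    by apply: (le_trans (ler_normB _ _)); have := sb i; lra.
  apply: (le_trans (phiL _ _)).
  rewrite yu -mulrBr normrM distrC -/z (gtr0_norm P0) mulrA.
  have h9 := sqr_le_9sin z34.
  (* Young's inequality turns the linear Lipschitz bound into a quadratic one, which the second
     moment of the kernel controls. *)
  apply: (@le_trans _ _ (eta + (L * P) ^+ 2 / (4 * eta) * z ^+ 2)).
    rewrite -(real_normK (num_real z)) -subr_ge0.
    have -> : eta + (L * P) ^+ 2 / (4 * eta) * `|z| ^+ 2 - L * P * `|z| =
      (eta - L * P * `|z| / 2) ^+ 2 / eta by field; rewrite gt_eqF.
    by rewrite divr_ge0 ?sqr_ge0// ltW.
  rewrite lerD2l.
  have -> : K * sin (pi * z) ^+ 2 = (L * P) ^+ 2 / (4 * eta) * (9 * sin (pi * z) ^+ 2).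
    by rewrite /K; field; rewrite gt_eqF.
  apply: ler_wpM2l => //; apply: divr_ge0; first exact: sqr_ge0.
  by apply: mulr_ge0 => //; exact: ltW.
have nM : (n.+1 < M)%N by [].
apply: (le_trans (kern_approx nM H)).
rewrite -mulr_sumr (kern_sum s u (ltnW nM)) mulr1.
have : 0 <= y ^+ 2 / T ^+ 2 by rewrite divr_ge0// sqr_ge0.
lra.
Qed.

Lemma lipschitz_clt (L eps : R) : 0 <= L -> 0 < eps -> exists n0 : nat,
  forall l, path ltn 0 l -> (n0 <= size l)%N ->
  forall phi : R -> R, (forall x, 0 <= phi x <= 1) ->
    (forall x y, `|phi x - phi y| <= L * `|x - y|) ->
  `|avg A B (fun x => phi (nsum l x)) - gexp phi| < eps.
Proof.
(* The errors below add up to [5 eta + 3 / T^2], at most [eps / 2] with these choices. The second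
   moments entering here are 1 for the Gaussian and at most 2 for the sum. *)
move=> L0 eps0; set T := 1 + 12 / eps; set eta := eps / 20.
have eta0 : 0 < eta by rewrite divr_gt0.
have T1 : 1 <= T by rewrite lerDl divr_ge0// ltW.
have T0 : 0 < T by lra.
have T2 : (T ^+ 2)^-1 <= eps / 12.
  rewrite -[leRHS]invrK lef_pV2 ?posrE ?invr_gt0 ?exprn_gt0 ?divr_gt0//.
  rewrite invf_div; apply: (@le_trans _ _ T); first by rewrite /T lerDr.
  by rewrite expr2 ler_peMr// ltW.
have [M [h [y_ [c HM]]]] := trig_approx L0 T0 eta0.
have eM : 0 < eta / M.+1%:R by rewrite divr_gt0.
have [n1 n1P] : exists n1 : nat, forall l, path ltn 0 l -> (n1 <= size l)%N ->
    forall i : 'I_M, `|avg A B (fun x => tpeval (h i) (c * nsum l x))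
      - gexp (fun y => tpeval (h i) (c * y))| < eta / M.+1%:R.
  pose Q r l := forall i : 'I_M, r = i :> nat ->
    `|avg A B (fun x => tpeval (h i) (c * nsum l x))
      - gexp (fun y => tpeval (h i) (c * y))| < eta / M.+1%:R.
  have HQ r : exists n0 : nat, forall l, path ltn 0 l -> (n0 <= size l)%N -> Q r l.
    have [rM|Mr] := ltnP r M.
      have [n2 n2P] := trigpoly_clt A1 AB xi0 g0 v0 (h (Ordinal rM)) c eM.
      exists n2 => l pl nl i ri.
      have -> : i = Ordinal rM by exact: val_inj.
      exact: n2P.
    by exists 0%N => l _ _ i ri; move: Mr; rewrite ri leqNgt ltn_ord.
  have [n1 H1] := @eventually_forall_lt Q M HQ.
  by exists n1 => l pl nl i; exact: (H1 l pl nl i (ltn_ord i) i erefl).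
have [n2 n2P] := moment_cvg A1 AB xi0 g0 2 v0 (@ltr01 R).
exists (maxn n1 n2) => l pl; rewrite geq_max => /andP[l1 l2] phi phi01 phiL.
have cphi := lip_continuous phiL.
have mphi : gig phi.
  apply: (@gig_bounded _ _ 1); first exact: continuous_measurable_fun.
  by move=> x; have /andP[p0 p1] := phi01 x; rewrite ger0_norm.
have cphiS : con A B (fun x => phi (nsum l x)).
  by apply: con_comp => //; exact: con_nsum.
pose G y := \sum_(i < M) phi (y_ i) * tpeval (h i) (c * y).
have ct i : continuous (fun y => tpeval (h i) (c * y)).
  by move=> y; exact: dv_continuous (dv_comp (dv_tpeval (h i) (c * y)) (dvZ c (dv_id y))).
have gt i : gig (fun y => tpeval (h i) (c * y)).
  apply: (@gig_bounded _ _ (coef_norm (h i))); first exact: continuous_measurable_fun.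
  by move=> x; exact: tpeval_bound.
have gF i : gig (fun y => phi (y_ i) * tpeval (h i) (c * y)) by exact: gigZ.
have [gG gE] := gexp_sum (index_enum 'I_M) gF.
have cF i : con A B (fun x => tpeval (h i) (c * nsum l x)).
  by apply: con_comp (ct i) _; exact: con_nsum.
have cG : con A B (fun x => G (nsum l x)).
  by apply: con_sum => i; apply: conM => //; exact: con_cst.
have aE : avg A B (fun x => G (nsum l x)) =
    \sum_(i < M) phi (y_ i) * avg A B (fun x => tpeval (h i) (c * nsum l x)).
  rewrite avg_sum; last first.
    by move=> i _; apply: con_ig; apply: conM => //; exact: con_cst.
  by apply: eq_bigr => i _; rewrite avgZ//; exact: con_ig.
have d1 : `|avg A B (fun x => G (nsum l x)) - gexp G| <= eta.
  rewrite aE gE -sumrB (le_trans (ler_norm_sum _ _ _))//.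
  apply: (@le_trans _ _ (\sum_(i < M) eta / M.+1%:R)); last first.
    rewrite sumr_const card_ord -[_ *+ M]mulr_natl mulrCA ler_piMr ?(ltW eta0)//.
    by rewrite ler_pdivrMr ?ltr0n// mul1r ler_nat.
  apply: ler_sum => i _; rewrite gexpZ// -mulrBr normrM.
  have /andP[p0 p1] := phi01 (y_ i).
  rewrite (ger0_norm p0) -[leRHS]mul1r ler_pM// ltW//; exact: n1P.
have m2 : avg A B (fun x => nsum l x ^+ 2) <= 2.
  have := n2P l pl l2; rewrite -/(nsum l _) /= mulr1 ltr_norml => /andP[_].
  by rewrite ltrBlDr => /ltW.
have cN2 : con A B (fun x => nsum l x ^+ 2) by apply: conX; exact: con_nsum.
have cR : con A B (fun x => 2 * eta + nsum l x ^+ 2 / T ^+ 2).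
  by apply: conD; [exact: con_cst|apply: conM => //; exact: con_cst].
have d2 : `|avg A B (fun x => G (nsum l x)) - avg A B (fun x => phi (nsum l x))|
    <= 2 * eta + 2 / T ^+ 2.
  rewrite -avgB; try exact: con_ig.
  apply: (@le_trans _ _ (avg A B (fun x => 2 * eta + nsum l x ^+ 2 / T ^+ 2))).
    apply: avg_abs_le => //; [apply: con_ig; exact: conB|exact: con_ig|].
    by move=> x _; exact: HM.
  rewrite avgD; [|exact: ig_cst|apply: con_ig; apply: conM => //; exact: con_cst].
  rewrite avg_cst// lerD2l.
  rewrite (@avg_eq _ _ _ _ (fun x => (T ^+ 2)^-1 * nsum l x ^+ 2)); last first.
    by move=> x _; rewrite mulrC.
  rewrite avgZ; last exact: con_ig.
  by rewrite mulrC ler_wpM2r// invr_ge0 sqr_ge0.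
have d3 : `|gexp G - gexp phi| <= 2 * eta + 1 / T ^+ 2.
  rewrite -mulN1r -gexpZ// -gexpD//; last exact: gigZ.
  apply: (@le_trans _ _ (gexp (fun y => 2 * eta + (T ^+ 2)^-1 * y ^+ 2))).
    apply: gexp_abs_le.
    - by apply: gigD => //; exact: gigZ.
    - apply: gigD; last by apply: gigZ; exact: gig_pow.
      by apply: (@gig_bounded _ _ `|2 * eta|) => //.
    - by move=> y; rewrite mulN1r [_^-1 * _]mulrC; exact: HM.
  rewrite gexpD; [|by apply: (@gig_bounded _ _ `|2 * eta|)|by apply: gigZ; exact: gig_pow].
  rewrite gexp_cst gexpZ; last exact: gig_pow.
  by rewrite gexp_pow /= !mulr1 div1r.
set a := avg A B (fun x => phi _) in d2 *.
set b := avg A B (fun x => G _) in d1 d2.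
have -> : a - gexp phi = (b - gexp G) + (gexp G - gexp phi) - (b - a) by ring.
apply: le_lt_trans (ler_normB _ _) _.
apply: le_lt_trans (lerD (ler_normD _ _) (lexx _)) _.
rewrite /eta in d1 d2 d3 *; lra.
Qed.

End lipschitz_clt.

(** * Functions of bounded variation *)

Section periodic_bounded_variation.
Context {R : realType}.
Variable f : R -> R.
Hypothesis f_periodic : forall x : R, f x = f (x + 1).
Hypothesis f_var : (total_variation 0%R 1%R f <= 2%:E)%E.

Lemma periodic_int (x : R) (z : int) : f (x + z%:~R) = f x.
Proof.
have fn (n : nat) y : f (y + n%:R) = f y.
  by elim: n => [|n ih]; [rewrite addr0|rewrite -natr1 addrA -f_periodic].
case: z => n; first exact: fn.
by rewrite NegzE mulrNz -[in RHS](subrK n.+1%:R x) fn.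
Qed.

Let tv (y : R) : R := fine (total_variation 0 y f).

Lemma tv_fin (a b : R) : 0 <= a -> a <= b -> b <= 1 ->
  total_variation a b f \is a fin_num.
Proof.
move=> a0 ab b1; rewrite ge0_fin_numE ?total_variation_ge0//.
apply: (@le_lt_trans _ _ (total_variation 0 1 f)).
  rewrite (total_variationD f a0 (le_trans ab b1)) (total_variationD f ab b1).
  rewrite addeCA leeDl// adde_ge0// total_variation_ge0//.
by rewrite (le_lt_trans f_var)// ltry.
Qed.

Lemma tv_ge (a b : R) : 0 <= a -> a <= b -> b <= 1 -> `|f b - f a| <= tv b - tv a.
Proof.
move=> a0 ab b1; rewrite /tv (total_variationD f a0 ab).
rewrite fineD; last 2 first.
- by apply: tv_fin => //; exact: le_trans b1.
- exact: tv_fin.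
rewrite addrAC subrr add0r -lee_fin fineK; last exact: tv_fin.
exact: total_variation_ge.
Qed.

(* The variation on [0, x], extended so that it grows by the variation over one
   period when [x] is increased by 1. *)
Lemma variation_control : exists (T : R -> R) (V : R),
  [/\ V <= 2, forall u, T (u + 1) = T u + V &
   forall u v, u <= v -> `|f v - f u| <= T v - T u].
Proof.
pose fl (x : R) : R := (Num.floor x)%:~R.
have fr01 x : 0 <= x - fl x < 1.
  have /andP[h1 h2] := floor_itv x; rewrite /fl subr_ge0 h1/= ltrBlDl.
  by rewrite intrD in h2.
have ffr x : f (x - fl x) = f x by rewrite /fl -mulrNz periodic_int.
have tv0 : tv 0 = 0 by rewrite /tv total_variationxx.
have tv1 : tv 1 <= 2.
  by rewrite -lee_fin fineK//; apply: tv_fin.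
have tv10 : 0 <= tv 1 by rewrite fine_ge0// total_variation_ge0.
exists (fun x => tv 1 * fl x + tv (x - fl x)), (tv 1); split=> //.
  move=> u; have -> : fl (u + 1) = fl u + 1.
    by rewrite /fl floorDrz ?rpred1// floor1 intrD.
  by rewrite mulrDr mulr1 opprD addrACA subrr addr0 addrAC.
move=> u v uv; have /andP[u0 u1] := fr01 u; have /andP[v0 v1] := fr01 v.
have := le_floor uv; rewrite le_eqVlt => /predU1P[e|].
  have fle : fl v = fl u by rewrite /fl e.
  rewrite fle in v0 v1 *.
  have -> : f v = f (v - fl u) by rewrite -fle ffr.
  rewrite -(ffr u) opprD addrACA subrr add0r; apply: tv_ge => //; last exact: ltW.
  by rewrite lerB.
rewrite -lezD1 -(ler_int R) intrD -/(fl u) -/(fl v) => fuv.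
have h1 := tv_ge u0 (ltW u1) (lexx 1).
have h2 := tv_ge (lexx 0) v0 (ltW v1).
have f10 : f 1 = f 0 by rewrite -[1]add0r -f_periodic.
rewrite !ffr f10 tv0 in h1 h2.
have h3 : tv 1 * (fl u + 1) <= tv 1 * fl v by rewrite ler_wpM2l.
have h4 : `|f v - f u| <= `|f 0 - f u| + `|f v - f 0|.
  have -> : f v - f u = (f 0 - f u) + (f v - f 0) by ring.
  exact: ler_normD.
lra.
Qed.

(** Jordan decomposition: both [T] and [T - f] are nondecreasing. *)
Lemma measurable_bv : measurable_fun setT f.
Proof.
have [T [V [_ _ TP]]] := variation_control.
have -> : f = fun x => T x - (T x - f x) by apply/funext => x; ring.
apply: measurable_funB; apply: nondecreasing_measurable => //.
  by move=> u v uv; have := le_trans (normr_ge0 _) (TP u v uv); rewrite subr_ge0.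
move=> u v uv; have := le_trans (ler_norm _) (TP u v uv); lra.
Qed.

Lemma bounded_bv : exists C : R, 0 <= C /\ forall x, `|f x| <= C.
Proof.
exists (`|f 0| + 2); split; first by rewrite addr_ge0.
move=> x; have /andP[h1 h2] := floor_itv x.
have fx : f (x - (Num.floor x)%:~R) = f x by rewrite -mulrNz periodic_int.
rewrite intrD in h2.
set y := x - _ in fx; have y0 : 0 <= y by rewrite subr_ge0.
have y1 : y <= 1 by rewrite lerBlDl ltW.
have h := tv_ge (lexx 0) y0 y1.
have hy := tv_ge y0 y1 (lexx 1).
have tv0 : tv 0 = 0 by rewrite /tv total_variationxx.
have tv1 : tv 1 <= 2 by rewrite -lee_fin fineK//; exact: tv_fin.
have hy0 := le_trans (normr_ge0 _) hy.
rewrite -fx -[f y](subrK (f 0)) (le_trans (ler_normD _ _))// addrC lerD2l.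
rewrite tv0 in h; lra.
Qed.

Lemma sin2_int_shift (x : R) (z : int) :
  sin (pi * (x + z%:~R)) ^+ 2 = sin (pi * x) ^+ 2.
Proof.
have h y : sin y ^+ 2 = (1 - cos (y *+ 2)) / 2 :> R.
  by rewrite cos_mulr2n sin2cos2 mulr2n; field.
rewrite !h; have -> : (pi * (x + z%:~R)) *+ 2 = (pi * x) *+ 2 + 2 * pi * z%:~R.
  by rewrite !mulr2n; ring.
by rewrite cosD2piz.
Qed.

(** A shift by one grid step moves every node to the next; only the last one leaves the period and
    comes back as the first with the increment [V]. *)
Lemma shift_sum (T : R -> R) (V c : R) (M k : nat) : (0 < M)%N ->
  (forall u, T (u + 1) = T u + V) ->
  \sum_(i < M) T (i%:R / M%:R + (c + k%:R / M%:R)) =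
  \sum_(i < M) T (i%:R / M%:R + c) + k%:R * V.
Proof.
move=> M0 TV; have M0' : (M%:R : R) != 0 by rewrite pnatr_eq0 -lt0n.
elim: k => [|k ih]; first by rewrite !mul0r !addr0.
pose G (i : nat) := T (i%:R / M%:R + (c + k%:R / M%:R)).
have -> : \sum_(i < M) T (i%:R / M%:R + (c + k.+1%:R / M%:R)) = \sum_(i < M) G i.+1.
  apply: eq_bigr => i _; rewrite /G -!natr1; congr T; ring.
have : \sum_(i < M.+1) G i = \sum_(i < M.+1) G i by [].
rewrite {1}big_ord_recl big_ord_recr/= => /eqP.
have -> : G M = G 0%N + V.
  by rewrite /G mul0r add0r mulfV// addrC TV.
rewrite addrCA (inj_eq (addrI _)) -/G => /eqP.
rewrite (eq_bigr (fun i : 'I_M => G i.+1)) => [->|i _]; last by rewrite /bump/= add1n.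
rewrite ih -natr1; ring.
Qed.

End periodic_bounded_variation.

(** * Trigonometric approximation with a trigonometric error majorant *)

Section trig_sandwich.
Context {R : realType}.
Local Notation mu := (@lebesgue_measure R).
Variable f : R -> R.
Hypothesis f_periodic : forall x : R, f x = f (x + 1).
Hypothesis f_mean0 : (\int[mu]_(x in `[0%R, 1%R]) (f x)%:E = 0)%E.
Hypothesis f_var : (total_variation 0%R 1%R f <= 2%:E)%E.

Let H01 : (0 : R) < 1. Proof. by []. Qed.
Let m01 : measurable (`[0, 1]%classic : set R). Proof. exact: measurable_itv. Qed.

Lemma ig_bv : ig mu `[0, 1] f.
Proof.
have [C [_ fC]] := bounded_bv f_periodic f_var.
have := @ig_bounded _ _ _ mu _ m01 (segment_measure_fin H01) f C.
apply => [|x _]; last exact: fC.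
by apply: measurable_funTS; exact: measurable_bv.
Qed.

Lemma ig_tpeval (g : @trigpoly R) : ig mu `[0, 1] (tpeval g).
Proof. by apply: con_ig => x _; exact: continuous_tpeval. Qed.

Definition tpsumlist (M : nat) (c : 'I_M -> R) (h : 'I_M -> @trigpoly R) : @trigpoly R :=
  flatten [seq tpscale (c i) (h i) | i <- index_enum 'I_M].

Lemma tpeval_sumlist M (c : 'I_M -> R) h u :
  tpeval (tpsumlist c h) u = \sum_(i < M) c i * tpeval (h i) u.
Proof.
rewrite /tpsumlist; elim: (index_enum _) => [|i s ih]; first by rewrite /tpeval !big_nil.
by rewrite /= tpeval_cat tpeval_scale ih big_cons.
Qed.

Lemma tpmean_sumlist M (c : 'I_M -> R) h :
  tpmean (tpsumlist c h) = \sum_(i < M) c i * tpmean (h i).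
Proof.
rewrite /tpsumlist; elim: (index_enum _) => [|i s ih]; first by rewrite /tpmean !big_nil.
by rewrite /= tpmean_cat tpmean_scale ih big_cons.
Qed.

Lemma coef_norm_sumlist M (c : 'I_M -> R) (h : 'I_M -> @trigpoly R) :
  coef_norm (tpsumlist c h) = \sum_(i < M) `|c i| * coef_norm (h i).
Proof.
rewrite /tpsumlist; elim: (index_enum _) => [|i s ih]; first by rewrite /coef_norm !big_nil.
by rewrite /= coef_norm_cat coef_norm_scale ih big_cons.
Qed.

Lemma tpdeg_sumlist H M (c : 'I_M -> R) h : (forall i, tpdeg_le H (h i)) ->
  tpdeg_le H (tpsumlist c h).
Proof.
move=> hH; rewrite /tpsumlist; elim: (index_enum _) => [//|i s ih] /=.
by apply: tpdeg_cat => //; exact: tpdeg_scale.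
Qed.

(** If [u] is within [r] of [s] modulo 1, the variation over [[s - r, s + r]] suffices. Otherwise
    [sin^2] is at least [r^2] and the last term exceeds the trivial bound [2 C]. *)
Lemma kernel_pointwise (T : R -> R) (C : R) (r s u : R) : 0 <= C -> 0 < r ->
  (forall u v, u <= v -> `|f v - f u| <= T v - T u) -> (forall x, `|f x| <= C) ->
  `|f s - f u| <= (T (s + r) - T (s - r)) + 2 * C / r ^+ 2 * sin (pi * (u - s)) ^+ 2.
Proof.
move=> C0 r0 TP fC.
pose z := Num.floor (u - s + 1 / 2); pose t := u - s - z%:~R.
have /andP[z1 z2] := floor_itv (u - s + 1 / 2); rewrite -/z intrD in z1 z2.
have t2 : `|t| <= 1 / 2 by rewrite ler_norml /t; lra.
have fu : f u = f (s + t).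
  by rewrite -(periodic_int f_periodic u (- z)) mulrNz /t; congr f; ring.
have K0 : 0 <= 2 * C / r ^+ 2 by rewrite divr_ge0 ?sqr_ge0// mulr_ge0.
have s0 := mulr_ge0 K0 (sqr_ge0 (sin (pi * (u - s)))).
have To : 0 <= T (s + r) - T (s - r).
  by apply: le_trans (TP _ _ _); rewrite ?normr_ge0//; lra.
have mono a b : a <= b -> T a <= T b.
  by move=> ab; rewrite -subr_ge0; apply: le_trans (TP _ _ ab).
have [tr|rt] := leP `|t| r.
  rewrite fu; move: tr; rewrite ler_norml => /andP[tr1 tr2].
  have [t0|/ltW t0] := leP 0 t.
    have := TP s (s + t); rewrite distrC lerDl => /(_ t0).
    have := mono (s + t) (s + r); have := mono (s - r) s.
    rewrite lerD2l gerBl => /(_ (ltW r0)) h1 /(_ tr2) h2; lra.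
  have := TP (s + t) s; rewrite gerDl => /(_ t0).
  have := mono s (s + r); have := mono (s - r) (s + t).
  rewrite lerD2l lerDl => /(_ tr1) h1 /(_ (ltW r0)) h2; lra.
have h1 : `|f s - f u| <= 2 * C.
  by apply: (le_trans (ler_normB _ _)); have := fC s; have := fC u; lra.
have sE : sin (pi * (u - s)) ^+ 2 = sin (pi * t) ^+ 2.
  by rewrite -(sin2_int_shift t z) /t subrK.
have h2 : r ^+ 2 <= sin (pi * (u - s)) ^+ 2.
  rewrite sE; apply: le_trans (sqr_le_sin t2).
  by rewrite -(real_normK (num_real t)) ler_sqr ?nnegrE ?(ltW r0)// ltW.
apply: (le_trans h1); apply: (@le_trans _ _ (2 * C / r ^+ 2 * sin (pi * (u - s)) ^+ 2)).
  rewrite -[leLHS](divfK (lt0r_neq0 (exprn_gt0 2 r0))).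
  exact: ler_wpM2l.
by rewrite lerDr.
Qed.

(** Kernel means of the values of [f] at [M = p^3] nodes, with window [r = 1 / p] and the largest
    admissible kernel degree [n = M - 2]. The two errors balance: the variations over the windows
    have mean [2 V / p], and the second moment of the kernel contributes [2 C0 p^2 / (2 n + 2)], at
    most [2 C0 / p]. *)
Lemma trig_sandwich : exists C : R, 0 <= C /\ (forall x, `|f x| <= C) /\
  forall p : nat, (2 <= p)%N -> exists g w : @trigpoly R,
  [/\ tpmean g = 0, forall u, `|f u - tpeval g u| <= tpeval w u,
      tpmean w <= C / p%:R, coef_norm g <= C * p%:R ^+ 3
    & tpdeg_le (p ^ 3) g /\ forall u, `|tpeval g u| <= C].
Proof.
have [C0 [C00 fC]] := bounded_bv f_periodic f_var.
have [T [V [V2 TV TP]]] := variation_control f_periodic f_var.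
have V0 : 0 <= V.
  have := TP 0 (0 + 1) (ltW _); rewrite TV addrAC subrr !add0r.
  by move=> /(_ H01); apply: le_trans.
(* The factor 2 pays for subtracting the mean [m] of [g0]: since [f] has mean 0, [|m|] is at most
   the mean of [w0], and it is added to the majorant once more. *)
pose C := 2 * (4 + 2 * C0) + C0.
have C0C : C0 <= C by rewrite /C; lra.
exists C; split; first by rewrite /C; lra.
split; first by move=> x; exact: le_trans (fC x) C0C.
move=> p p2; pose M := (p ^ 3)%N; pose n := M.-2.
have M8 : (8 <= M)%N by rewrite (@leq_trans (2 ^ 3)) ?leq_exp2r.
have nM2 : n.+2 = M by rewrite /n; move: M8; case: (M) => [//|[//|k]].
have nM : (n.+1 < M)%N by rewrite -nM2.
have M0 : (0 < M)%N by rewrite -nM2.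
have p0 : 0 < p%:R :> R by rewrite ltr0n (leq_trans _ p2).
have p1 : 1 <= p%:R :> R by rewrite ler1n (leq_trans _ p2).
pose r : R := p%:R^-1.
have r0 : 0 < r by rewrite invr_gt0.
have MR : M%:R = p%:R ^+ 3 :> R by rewrite natrX.
pose s (i : 'I_M) : R := i%:R / M%:R + 0.
pose o i : R := T (s i + r) - T (s i - r).
pose K : R := 2 * C0 / r ^+ 2.
have o0 i : 0 <= o i.
  by apply: le_trans (TP _ _ _); rewrite ?normr_ge0// lerD2l; lra.
have K0 : 0 <= K by rewrite divr_ge0 ?sqr_ge0// mulr_ge0.
pose g0 := tpsumlist (fun i => f (s i)) (fun i => kern n M (s i)).
pose e := K / (2 * n + 2)%:R.
have e0 : 0 <= e by rewrite divr_ge0.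
pose w0 := tpsumlist o (fun i => kern n M (s i)) ++ tpcst e.
have fgw u : `|f u - tpeval g0 u| <= tpeval w0 u.
  rewrite distrC tpeval_cat tpeval_cst !tpeval_sumlist.
  apply: kern_approx => // i.
  exact: kernel_pointwise.
have mw0 : tpmean w0 <= (4 + 2 * C0) / p%:R.
  rewrite tpmean_cat tpmean_cst tpmean_sumlist.
  under eq_bigr do rewrite kern_mean.
  rewrite -mulr_suml mulrDl; apply: lerD.
    (* The window of length [2 / p] is exactly [2 p^2] grid steps, so [shift_sum] evaluates the sum
       of all window variations. *)
    have -> : \sum_(i < M) o i = (2 * p ^ 2)%:R * V.
      rewrite /o sumrB.
      have := shift_sum (- r) (2 * p ^ 2) M0 TV.
      have -> : (2 * p ^ 2)%:R / M%:R = 2 * r :> R.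
        by rewrite MR natrM natrX /r; field; rewrite gt_eqF.
      have -> : \sum_(i < M) T (s i + r) = \sum_(i < M) T (i%:R / M%:R + (- r + 2 * r)).
        by apply: eq_bigr => i _; congr T; rewrite /s; ring.
      move=> ->; rewrite addrAC.
      have -> : \sum_(i < M) T (s i - r) = \sum_(i < M) T (i%:R / M%:R + - r).
        by apply: eq_bigr => i _; congr T; rewrite /s; ring.
      by rewrite subrr add0r.
    rewrite natrM natrX MR ler_pdivlMr//.
    have -> : 2 * p%:R ^+ 2 * V / p%:R ^+ 3 * p%:R = 2 * V by field; rewrite gt_eqF.
    lra.
  rewrite /e /K /r exprVn invrK.
  have hn : p%:R ^+ 3 <= (2 * n + 2)%:R :> R.
    by rewrite -MR ler_nat -nM2 addn2 !ltnS leq_pmull.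
  rewrite ler_pdivrMr; last by rewrite ltr0n addn2.
  rewrite [leRHS]mulrAC -[leRHS]mulrA; apply: ler_wpM2l; first exact: mulr_ge0.
  by rewrite ler_pdivlMr// -exprSr.
have w00 u : 0 <= tpeval w0 u by apply: le_trans (fgw u).
set m := tpmean g0.
have mb : `|m| <= (4 + 2 * C0) / p%:R.
  apply: le_trans mw0; rewrite /m -!tpmeanE.
  have f0 : \int[mu]_(x in `[0, 1]) f x = 0 by rewrite /Rintegral f_mean0.
  have -> : \int[mu]_(x in `[0, 1]) tpeval g0 x =
      \int[mu]_(x in `[0, 1]) tpeval g0 x - \int[mu]_(x in `[0, 1]) f x.
    by rewrite f0 subr0.
  rewrite -RintegralB//; [|exact: ig_tpeval|exact: ig_bv].
  apply: Rintegral_abs_le => //.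
  - by apply: igB => //; [exact: ig_tpeval|exact: ig_bv].
  - exact: ig_tpeval.
  - by move=> x _; rewrite distrC.
have pC : (4 + 2 * C0) / p%:R <= 4 + 2 * C0.
  by rewrite ler_pdivrMr// ler_peMr//; lra.
exists (g0 ++ tpcst (- m)), (w0 ++ tpcst `|m|); split.
- by rewrite tpmean_cat tpmean_cst subrr.
- move=> u; rewrite (tpeval_cat g0) (tpeval_cat w0) !tpeval_cst opprD opprK addrA.
  by apply: (le_trans (ler_normD _ _)); apply: lerD => //; exact: fgw.
- rewrite (tpmean_cat w0) tpmean_cst; apply: (le_trans (lerD mw0 mb)).
  rewrite -mulrDl; apply: ler_wpM2r; first by rewrite invr_ge0 ltW.
  by rewrite /C; lra.
- rewrite coef_norm_cat coef_norm_cst normrN coef_norm_sumlist.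
  apply: (@le_trans _ _ (\sum_(i < M) C0 * (n.+1%:R / M%:R) + (4 + 2 * C0))).
    apply: lerD; last exact: le_trans pC.
    apply: ler_sum => i _; apply: ler_pM => //; [exact: coef_norm_ge0|exact: kern_norm].
  rewrite sumr_const card_ord -[_ *+ M]mulr_natl.
  have M0' : (M%:R : R) != 0 by rewrite pnatr_eq0 -lt0n.
  have -> : M%:R * (C0 * (n.+1%:R / M%:R)) = C0 * n.+1%:R :> R by field.
  have h1 : n.+1%:R <= p%:R ^+ 3 :> R by rewrite -MR ler_nat ltnW.
  have h2 : 1 <= p%:R ^+ 3 :> R by rewrite exprn_ege1.
  have h3 := ler_wpM2l C00 h1; have h4 := ler_wpM2l C00 h2.
  rewrite /C; lra.
split.
  apply: tpdeg_cat; last by move=> q; rewrite mem_seq1 => /eqP ->.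
  by apply: tpdeg_sumlist => i; apply: tpdegW (@kern_deg _ _ _ _); rewrite -/M -nM2 leqW.
move=> u; rewrite tpeval_cat tpeval_cst tpeval_sumlist.
apply: (le_trans (ler_normB _ _)).
have : `|\sum_(i < M) f (s i) * tpeval (kern n M (s i)) u| <= C0.
  apply: (le_trans (ler_norm_sum _ _ _)).
  apply: (@le_trans _ _ (\sum_(i < M) C0 * tpeval (kern n M (s i)) u)).
    apply: ler_sum => i _; rewrite normrM (ger0_norm (kern_ge0 _ _ _ _)).
    by apply: ler_wpM2r => //; exact: kern_ge0.
  by rewrite -mulr_sumr kern_sum ?mulr1// ltnW.
have := le_trans mb pC; rewrite /C; lra.
Qed.

End trig_sandwich.

(** * Integration by parts against high powers *)

Section oscillation_by_parts.
Context {R : realType}.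
Variables (A B xi : R).
Hypotheses (A1 : 1 < A) (AB : A < B) (xi0 : 0 < xi).
Local Notation mu := (@lebesgue_measure R).

Let mAB : measurable `[A, B]%classic. Proof. exact: measurable_itv. Qed.
Let BA0 : 0 < B - A. Proof. by rewrite subr_gt0. Qed.

(** [psi (xi x^k)] is the derivative of [Psi (xi x^k)] divided by [k xi x^(k-1)]. The parameter
    [rho] is the gain from that division, [L] measures how fast [phi] varies relative to it. Two
    uses: [phi = 1] with [rho = 1], and [phi] oscillating at a smaller exponent [j] with
    [rho = A^-(k-j)]. *)
Lemma integral_by_parts (phi phi1 Psi psi : R -> R) (k : nat) (M1 Mx L rho : R) :
  (1 <= k)%N ->
  (forall x, A <= x <= B -> is_derive x 1 phi (phi1 x)) -> con A B phi1 ->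
  (forall u : R, is_derive u 1 Psi (psi u)) -> continuous psi ->
  (forall x, A <= x <= B -> `|phi x| <= M1) ->
  (forall u, `|Psi u| <= Mx) -> 0 <= M1 -> 0 <= Mx -> 0 <= L -> A^-1 ^+ k.-1 <= rho ->
  (forall x, A <= x <= B -> `|phi1 x| * x^-1 ^+ k.-1 <= k%:R * xi * (L * rho)) ->
  `|\int[mu]_(x in `[A, B]) (phi x * psi (xi * x ^+ k))|
    <= Mx * rho * (2 * M1 / xi + (B - A) * (L + M1 / xi)).
Proof.
move=> k1 dphi cphi1 dPsi cpsi phiM PsiM M10 Mx0 L0 Arho phi1L.
have A0 : 0 < A by rewrite (lt_trans ltr01).
have kR : 1 <= k%:R :> R by rewrite ler1n.
have k0 : 0 < k%:R :> R by rewrite ltr0n.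
have x_gt0 x : A <= x <= B -> 0 < x by move=> /andP[Ax _]; exact: lt_le_trans A0 Ax.
have x0 x : A <= x <= B -> x != 0 by move=> /x_gt0; exact: lt0r_neq0.
pose kx : R := (k%:R * xi)^-1.
have kx0 : 0 < kx by rewrite invr_gt0 mulr_gt0.
have kx1 : kx <= xi^-1 by rewrite lef_pV2 ?posrE ?mulr_gt0// ler_peMl// ltW.
have rho0 : 0 <= rho by apply: le_trans Arho; rewrite exprn_ge0// invr_ge0 ltW.
pose y1 (x : R) : R := - (k.-1%:R * x^-1 ^+ k).
have dy x : A <= x <= B -> is_derive x 1 (fun x : R => x^-1 ^+ k.-1) (y1 x).
  move=> xAB; apply: (dv_eq (dvX k.-1 (dvV (x0 _ xAB) (dv_id x)))).
  rewrite /y1; case: (k) k1 => [//|[|k']] _; first by rewrite !mul0r oppr0.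
  by rewrite -!pred_Sn mulNr mul1r -exprVn !exprS expr0; ring.
have cy := con_dv dy.
have cinv : con A B (fun x : R => x^-1).
  by apply: conV; [exact: x0|move=> x _; exact: cvg_id].
have cy1 : con A B y1 by apply: conN; apply: conM; [exact: con_cst|exact: conX].
have yb x : A <= x <= B -> 0 <= x^-1 ^+ k.-1 <= rho.
  move=> xAB; have x00 := x_gt0 _ xAB; apply/andP; split.
    by rewrite exprn_ge0// invr_ge0 ltW.
  apply: le_trans Arho; apply: lerXn2r; rewrite ?nnegrE ?invr_ge0 ?(ltW x00) ?(ltW A0)//.
  by rewrite lef_pV2 ?posrE//; case/andP: xAB.
have y1b x : A <= x <= B -> `|y1 x| <= k%:R * rho.
  move=> xAB; have x00 := x_gt0 _ xAB; rewrite normrN normrM normr_nat.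
  apply: ler_pM => //; first by rewrite ler_nat leq_pred.
  have /andP[z0 zE] := yb _ xAB.
  rewrite -(prednK k1) exprS ger0_norm ?mulr_ge0 ?invr_ge0 ?(ltW x00)//.
  apply: le_trans zE; apply: ler_piMl => //.
  by rewrite invf_le1//; case/andP: xAB => Ax _; rewrite (le_trans (ltW A1)).
have dPk (x : R) : is_derive x 1 (fun x => Psi (xi * x ^+ k))
    (psi (xi * x ^+ k) * (xi * (k%:R * x ^+ k.-1 * 1))).
  exact: dv_comp (dPsi _) (dvZ xi (dvX k (dv_id x))).
have cPk : con A B (fun x => Psi (xi * x ^+ k)) by apply: con_dv => x _; exact: dPk.
have cpk : con A B (fun x => psi (xi * x ^+ k)).
  apply: con_comp cpsi _; apply: conM; first exact: con_cst.
  by apply: conX => x _; exact: cvg_id.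
pose z x := phi x * x^-1 ^+ k.-1.
pose z1 x := phi x * y1 x + x^-1 ^+ k.-1 * phi1 x.
have dz x : A <= x <= B -> is_derive x 1 z (z1 x).
  by move=> xAB; exact: dvM (dphi _ xAB) (dy _ xAB).
have cphi := con_dv dphi; have cz := con_dv dz.
have cz1 : con A B z1 by apply: conD; exact: conM.
pose F x := kx * (Psi (xi * x ^+ k) * z x).
have cf1 : con A B (fun x => phi x * psi (xi * x ^+ k)) by exact: conM.
have cf2 : con A B (fun x => kx * (Psi (xi * x ^+ k) * z1 x)).
  by apply: conM; [exact: con_cst|exact: conM].
have FTC : \int[mu]_(x in `[A, B]) (phi x * psi (xi * x ^+ k) +
    kx * (Psi (xi * x ^+ k) * z1 x)) = F B - F A.
  apply: (@Rintegral_FTC _ _ _ AB F _ (conD cf1 cf2)) => x xAB.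
  apply: (dv_eq (dvZ kx (dvM (dPk x) (dz _ xAB)))).
  rewrite /z exprVn /kx; have := x0 _ xAB => xn0.
  have : x ^+ k.-1 != 0 by rewrite expf_neq0.
  move: (x ^+ k.-1) (psi _) (Psi _) (phi x) (z1 x) => a b c d e a0.
  by field; rewrite a0 (gt_eqF xi0) (gt_eqF k0).
rewrite RintegralD// in FTC; [|exact: con_ig|exact: con_ig].
have AAB : A <= A <= B by rewrite lexx ltW.
have BAB : A <= B <= B by rewrite lexx ltW.
have xiV : 0 <= xi^-1 by rewrite invr_ge0 ltW.
have Fb x : A <= x <= B -> `|F x| <= Mx * rho * (M1 / xi).
  move=> xAB; have /andP[w0 wE] := yb _ xAB.
  rewrite /F normrM (gtr0_norm kx0).
  have h1 : `|Psi (xi * x ^+ k) * z x| <= Mx * (M1 * rho).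
    rewrite normrM; apply: ler_pM => //.
    by rewrite /z normrM (ger0_norm w0); apply: ler_pM => //; exact: phiM.
  have -> : Mx * rho * (M1 / xi) = xi^-1 * (Mx * (M1 * rho)) by ring.
  by apply: ler_pM => //; exact: ltW.
have Ib : `|\int[mu]_(x in `[A, B]) (kx * (Psi (xi * x ^+ k) * z1 x))|
    <= Mx * rho * (L + M1 / xi) * (B - A).
  rewrite -segment_measureE//; apply: Rintegral_abs_bound => //.
  - exact: segment_measure_fin.
  - exact: con_ig.
  - move=> x /=; rewrite in_itv/= => xAB; have /andP[w0 wE] := yb _ xAB.
    rewrite normrM (gtr0_norm kx0).
    have h1 : `|z1 x| <= M1 * (k%:R * rho) + k%:R * xi * (L * rho).
      rewrite /z1 (le_trans (ler_normD _ _))//; apply: lerD.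
        by rewrite normrM; apply: ler_pM => //; [exact: phiM|exact: y1b].
      by rewrite normrM (ger0_norm w0) mulrC; exact: phi1L.
    have -> : Mx * rho * (L + M1 / xi) =
        kx * (Mx * (M1 * (k%:R * rho) + k%:R * xi * (L * rho))).
      by rewrite /kx; field; rewrite (gt_eqF xi0) (gt_eqF k0).
    apply: ler_wpM2l; first exact: ltW.
    by rewrite normrM; apply: ler_pM.
have -> : \int[mu]_(x in `[A, B]) (phi x * psi (xi * x ^+ k)) =
   (F B - F A) - \int[mu]_(x in `[A, B]) (kx * (Psi (xi * x ^+ k) * z1 x)).
  by rewrite -FTC addrK.
apply: (le_trans (ler_normB _ _)).
have -> : Mx * rho * (2 * M1 / xi + (B - A) * (L + M1 / xi)) =
  (Mx * rho * (M1 / xi) + Mx * rho * (M1 / xi)) + Mx * rho * (L + M1 / xi) * (B - A).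
  by ring.
apply: lerD => //; apply: (le_trans (ler_normB _ _)).
by apply: lerD; exact: Fb.
Qed.

Definition tpprim (w : @trigpoly R) (u : R) : R := \sum_(p <- w | p.2.1 != 0)
  p.1 * (sin (2 * pi * p.2.1%:~R * u + p.2.2) / (2 * pi * p.2.1%:~R)).

Lemma dv_tpprim w (u : R) : is_derive u 1 (tpprim w) (tpeval w u - tpmean w).
Proof.
have -> : tpprim w = fun u => \sum_(p <- w) (if p.2.1 != 0 then
    p.1 * (sin (2 * pi * p.2.1%:~R * u + p.2.2) / (2 * pi * p.2.1%:~R)) else 0).
  by apply/funext => v; rewrite /tpprim big_mkcond.
have -> : tpeval w u - tpmean w = \sum_(p <- w) (if p.2.1 != 0 then
    p.1 * cos (2 * pi * p.2.1%:~R * u + p.2.2) else 0).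
  rewrite /tpeval /tpmean [X in _ - X]big_mkcond/= -sumrB; apply: eq_bigr => p _.
  case: eqP => [->|_] /=; last by rewrite subr0.
  by rewrite mulr0 mul0r add0r subrr.
apply: dv_sum => p; case: eqP => [_|/eqP a0] /=; first exact: dv_cst.
have h := dvD (dvZ (2 * pi * p.2.1%:~R) (dv_id u)) (dv_cst p.2.2 u).
have h2 := dvZ p.1 (dvM (dv_sin h) (dv_cst (2 * pi * p.2.1%:~R)^-1 u)).
apply: (dv_eq h2).
rewrite mulr0 add0r mulr1 addr0; congr (_ * _).
by rewrite mulrC mulfK// !mulf_neq0 ?intr_eq0// gt_eqF// pi_gt0.
Qed.

Lemma tpprim_periodic w u (z : int) : tpprim w (u + z%:~R) = tpprim w u.
Proof.
apply: eq_bigr => p _; congr (_ * (_ / _)).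
rewrite -[in RHS](sinD2piz (p.2.1 * z)); congr sin.
by rewrite intrM; ring.
Qed.

Lemma tpprim_bound w u : `|tpprim w u| <= coef_norm w.
Proof.
rewrite /tpprim big_mkcond (le_trans (ler_norm_sum _ _ _))//.
apply: ler_sum => p _; case: eqP => [_|/eqP a0] /=; first by rewrite normr0.
rewrite normrM ler_piMr// normrM normfV.
have a1 : 1 <= `|2 * pi * p.2.1%:~R : R|.
  have i1 : 1 <= `|p.2.1%:~R : R|.
    by rewrite -intr_norm ler1z -gtz0_ge1 normr_gt0.
  rewrite normrM -[leLHS]mul1r; apply: ler_pM => //.
  by have := @pi_ge2 R => p2; rewrite ger0_norm; lra.
rewrite ler_pdivrMr ?(lt_le_trans ltr01 a1)// mul1r (le_trans _ a1)//.
by rewrite ler_norml sin_geN1 sin_le1.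
Qed.

(** The derivative of the primitive is at least minus the mean, since [w >= 0]; over one period the
    primitive returns to its value, so it cannot have risen by more than it can fall. The bound by
    the mean, instead of the coefficient norm, is essential because the mean is small while the norm
    is large. *)
Lemma tpprim_osc w : (forall u, 0 <= tpeval w u) ->
  forall u, `|tpprim w u - tpprim w 0| <= tpmean w.
Proof.
move=> w0 u; set m := tpmean w.
have m0 : 0 <= m.
  by rewrite /m -tpmeanE; apply: Rintegral_ge0 => x _; exact: w0.
have /andP[h1 h2] := floor_itv u; rewrite intrD in h2.
rewrite -(tpprim_periodic w u (- Num.floor u)) mulrNz.
set v := u - _; have v0 : 0 <= v by rewrite subr_ge0.
have v1 : v <= 1 by rewrite lerBlDl ltW.
have dw (a b : R) : a <= b -> - m * (b - a) <= tpprim w b - tpprim w a.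
  move=> ab; apply: (derive_bound_le ab (fun x _ => dv_tpprim w x)) => x _.
  by have := w0 x; rewrite /m; lra.
have p1 : tpprim w 1 = tpprim w 0.
  by rewrite -(tpprim_periodic w 0 1) add0r.
have h3 := dw _ _ v0; have h4 := dw _ _ v1; rewrite p1 in h4.
have h5 : m * v <= m * 1 by rewrite ler_wpM2l.
have h6 : 0 <= m * v by rewrite mulr_ge0.
rewrite ler_norml; lra.
Qed.

(** The mean itself, plus the bound of [integral_by_parts] for [phi = 1], left in the shape in which
    it appears there. *)
Definition avg_const : R := 1 + (B - A)^-1 * (2 / xi + (B - A) * (0 + 1 / xi)).

Lemma avg_const_ge0 : 0 <= avg_const.
Proof.
have x0 : 0 <= xi^-1 by rewrite invr_ge0 ltW.
rewrite /avg_const add0r addr_ge0// mulr_ge0 ?invr_ge0 ?(ltW BA0)//.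
by rewrite addr_ge0// mulr_ge0 ?(ltW BA0)// mul1r.
Qed.

Lemma avg_tpeval_le w k : (1 <= k)%N -> (forall u, 0 <= tpeval w u) ->
  avg A B (fun x => tpeval w (xi * x ^+ k)) <= avg_const * tpmean w.
Proof.
move=> k1 w0; have osc := tpprim_osc w0; set m := tpmean w.
have m0 : 0 <= m by apply: le_trans (osc 0).
have cw := @con_tpeval R A B xi w k.
have dP (u : R) : is_derive u 1 (fun u => tpprim w u - tpprim w 0) (tpeval w u - m).
  by apply: (dv_eq (dvB (dv_tpprim w u) (dv_cst (tpprim w 0) u))); rewrite subr0.
have cP : continuous (fun u => tpeval w u - m).
  by move=> u; apply: continuousB; [exact: continuous_tpeval|exact: cst_continuous].
have A0 : 0 < A by rewrite (lt_trans ltr01).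
have Ale : A^-1 ^+ k.-1 <= 1 by rewrite exprn_ile1// ?invr_ge0 ?(ltW A0)// invf_le1// ltW.
have n1 (x : R) : A <= x <= B -> `|1 : R| <= 1 by rewrite normr1.
have n0 (x : R) : A <= x <= B ->
    `|0 : R| * x^-1 ^+ k.-1 <= k%:R * xi * (0 * 1) by rewrite normr0 !mul0r mulr0.
have h := integral_by_parts k1 (fun x _ => dv_cst 1 x) (@con_cst R A B 0) dP cP
  n1 osc ler01 m0 (lexx 0) Ale n0.
have e1 : avg A B (fun x => tpeval w (xi * x ^+ k)) - m =
   (B - A)^-1 * \int[mu]_(x in `[A, B]) (1 * (tpeval w (xi * x ^+ k) - m)).
  rewrite -[in LHS](avg_cst AB m) -avgB; [|exact: con_ig|exact: ig_cst].
  by congr (_ * _); apply: eq_Rintegral => x _; rewrite mul1r.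
have BV : 0 <= (B - A)^-1 by rewrite invr_ge0 ltW.
have h2 := ler_wpM2l BV (le_trans (ler_norm _) h).
have -> : avg_const * m =
    m + (B - A)^-1 * (m * 1 * (2 * 1 / xi + (B - A) * (0 + 1 / xi))).
  by rewrite /avg_const; ring.
by rewrite -lerBlDl e1.
Qed.

End oscillation_by_parts.

Section trig_cross_correlation.
Context {R : realType}.
Variables (A B xi : R).
Hypotheses (A1 : 1 < A) (AB : A < B) (xi0 : 0 < xi).

Let BA0 : 0 < B - A. Proof. by rewrite subr_gt0. Qed.

Definition tpderiv (w : @trigpoly R) : @trigpoly R :=
  [seq (p.1 * (2 * pi * p.2.1%:~R), (p.2.1, p.2.2 + pi / 2)) | p <- w].

Lemma dv_tpderiv w (u : R) : is_derive u 1 (tpeval w) (tpeval (tpderiv w) u).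
Proof.
apply: (dv_eq (dv_tpeval w u)); rewrite /tpeval big_map; apply: eq_bigr => p _ /=.
by rewrite addrA cosDpihalf; ring.
Qed.

Lemma tpderiv_norm H w : tpdeg_le H w -> coef_norm (tpderiv w) <= 8 * H%:R * coef_norm w.
Proof.
move=> wH; rewrite /coef_norm big_map mulr_sumr big_seq [leRHS]big_seq.
apply: ler_sum => p /wH pH /=; rewrite normrM mulrC; apply: ler_wpM2r => //.
rewrite normrM -intr_norm -natr_absz; apply: ler_pM => //.
  by have := @pi_ge0 R; have := @pihalf_lt2 R => p2 p0; rewrite ger0_norm; lra.
by rewrite ler_nat.
Qed.

Definition cross_const : R := (B - A)^-1 * (2 / xi + (B - A) * (8 + 1 / xi)).

Lemma cross_const_ge0 : 0 <= cross_const.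
Proof.
have x0 : 0 <= xi^-1 by rewrite invr_ge0 ltW.
apply: mulr_ge0; first by rewrite invr_ge0 ltW.
apply: addr_ge0; first by rewrite mulr_ge0.
by apply: mulr_ge0; [exact: ltW|rewrite addr_ge0// mul1r].
Qed.

(** The faster factor is integrated, the slower one differentiated: its derivative is of order
    [j x^(j-1)] against the gain [k x^(k-1)], which leaves [x^-(k-j)]. *)
Lemma trig_cross H (phi psi : @trigpoly R) j k : (1 <= j < k)%N ->
  tpdeg_le H phi -> tpmean psi = 0 ->
  `|avg A B (fun x => tpeval phi (xi * x ^+ j) * tpeval psi (xi * x ^+ k))| <=
  cross_const * (coef_norm phi * coef_norm psi * (1 + H%:R)) * A^-1 ^+ (k - j).
Proof.
move=> /andP[j1 jk] phiH psi0.
have k1 : (1 <= k)%N by rewrite (leq_trans j1)// ltnW.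
have A0 : 0 < A by rewrite (lt_trans ltr01).
have Ai : 0 <= A^-1 by rewrite invr_ge0 ltW.
have Ai1 : A^-1 <= 1 by rewrite invf_le1// ltW.
set N := coef_norm phi; set N' := coef_norm psi.
have N0 : 0 <= N by exact: coef_norm_ge0.
have N'0 : 0 <= N' by exact: coef_norm_ge0.
pose p1 x := tpeval (tpderiv phi) (xi * x ^+ j) * (xi * (j%:R * x ^+ j.-1 * 1)).
have dp x : A <= x <= B -> is_derive x 1 (fun x => tpeval phi (xi * x ^+ j)) (p1 x).
  by move=> _; exact: dv_comp (dv_tpderiv phi _) (dvZ xi (dvX j (dv_id x))).
have cp1 : con A B p1.
  apply: conM; first exact: con_tpeval.
  apply: conM; first exact: con_cst.
  apply: conM; last exact: con_cst.
  by apply: conM; [exact: con_cst|apply: conX => x _; exact: cvg_id].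
have dP (u : R) : is_derive u 1 (tpprim psi) (tpeval psi u).
  by apply: (dv_eq (dv_tpprim psi u)); rewrite psi0 subr0.
have L0 : 0 <= 8 * H%:R * N by rewrite !mulr_ge0.
have Ale : A^-1 ^+ k.-1 <= A^-1 ^+ (k - j).
  by apply: ler_wiXn2l => //; rewrite -subn1 leq_sub2l.
have p1b x : A <= x <= B -> `|p1 x| * x^-1 ^+ k.-1 <=
    k%:R * xi * (8 * H%:R * N * A^-1 ^+ (k - j)).
  move=> /andP[Ax xB]; have x0 : 0 < x by exact: lt_le_trans A0 Ax.
  have d1 : `|tpeval (tpderiv phi) (xi * x ^+ j)| <= 8 * H%:R * N.
    by apply: (le_trans (tpeval_bound _ _)); exact: tpderiv_norm.
  rewrite /p1 mulr1 normrM (ger0_norm (x := xi * _)); last first.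
    by rewrite !mulr_ge0 ?exprn_ge0 ?(ltW x0) ?(ltW xi0).
  have -> : x^-1 ^+ k.-1 = x^-1 ^+ (k - j) * x^-1 ^+ j.-1.
    rewrite -exprD; congr (_ ^+ _).
    by rewrite -[in RHS](prednK j1) -[in RHS](prednK k1) subSS subnK// -ltnS !prednK// ltnW.
  have -> : `|tpeval (tpderiv phi) (xi * x ^+ j)| * (xi * (j%:R * x ^+ j.-1)) *
     (x^-1 ^+ (k - j) * x^-1 ^+ j.-1) =
     j%:R * xi * (`|tpeval (tpderiv phi) (xi * x ^+ j)| * x^-1 ^+ (k - j)).
    rewrite (exprVn x j.-1); have : x ^+ j.-1 != 0 by rewrite expf_neq0// gt_eqF.
    by move: (x ^+ j.-1) (x^-1 ^+ _) `|_| => a b c a0; field.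
  have xV : 0 <= x^-1 by rewrite invr_ge0 ltW.
  apply: ler_pM.
  - by rewrite mulr_ge0 ?(ltW xi0).
  - by rewrite mulr_ge0 ?exprn_ge0.
  - by rewrite ler_wpM2r ?(ltW xi0)// ler_nat ltnW.
  - apply: ler_pM => //; first by rewrite exprn_ge0.
    by apply: lerXn2r; rewrite ?nnegrE// lef_pV2 ?posrE.
have h := integral_by_parts A1 AB xi0 k1 dp cp1 dP (@continuous_tpeval R psi)
  (fun x _ => tpeval_bound phi _) (tpprim_bound psi) N0 N'0 L0 Ale p1b.
have BV : 0 <= (B - A)^-1 by rewrite invr_ge0 ltW.
rewrite normrM (ger0_norm BV); apply: (le_trans (ler_wpM2l BV h)).
rewrite -/N -/N' /cross_const.
set rho := A^-1 ^+ (k - j); have rho0 : 0 <= rho by rewrite exprn_ge0.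
have xiV : 0 <= xi^-1 by rewrite invr_ge0 ltW.
have -> : (B - A)^-1 * (N' * rho * (2 * N / xi + (B - A) * (8 * H%:R * N + N / xi))) =
  (B - A)^-1 * ((N' * rho * N) * (2 / xi + (B - A) * (8 * H%:R + 1 / xi))) by ring.
have -> : (B - A)^-1 * (2 / xi + (B - A) * (8 + 1 / xi)) * (N * N' * (1 + H%:R)) * rho =
  (B - A)^-1 * ((N' * rho * N) * ((1 + H%:R) * (2 / xi + (B - A) * (8 + 1 / xi)))) by ring.
apply: ler_wpM2l => //; apply: ler_wpM2l; first by rewrite !mulr_ge0.
rewrite -subr_ge0 !div1r.
have -> : (1 + H%:R) * (2 / xi + (B - A) * (8 + xi^-1)) -
  (2 / xi + (B - A) * (8 * H%:R + xi^-1)) =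
  (B - A) * 8 + (H%:R * (2 / xi) + (B - A) * (H%:R * xi^-1)) by ring.
have t3 : 0 <= B - A by exact: ltW.
by rewrite !addr_ge0// !mulr_ge0.
Qed.

End trig_cross_correlation.

(** * Second moment of the approximation error *)

Section increasing_sums.
Context {R : realType}.

Lemma path_sum_le (F : nat -> R) l k : (forall j, 0 <= F j) ->
  path ltn 0 (rcons l k) -> \sum_(j <- l) F j <= \sum_(j < k) F j.
Proof.
move=> F0; elim/last_ind: l k => [|l j ih] k.
  by rewrite big_nil => _; apply: sumr_ge0 => i _.
rewrite [path _ _ _]rcons_path last_rcons => /andP[pl jk].
rewrite -cats1 big_cat big_seq1/=.
apply: (@le_trans _ _ (\sum_(i < j.+1) F i)).
  by rewrite big_ord_recr/= lerD2r; exact: ih.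
rewrite -(subnKC jk) big_split_ord/= lerDl; exact: sumr_ge0.
Qed.

Definition beta_ (D d : nat) : R := if (d < D)%N then D%:R ^- 2 else d%:R ^- 2.

Lemma beta_ge0 D d : 0 <= beta_ D d.
Proof. by rewrite /beta_; case: ifP => _; rewrite invr_ge0 sqr_ge0. Qed.

(** Fewer than [D] terms equal to [D^-2] contribute at most [1 / D], the tail of the inverse squares
    from [D] on at most [2 / D]. *)
Lemma beta_sum D m : (1 <= D)%N -> \sum_(i < m) beta_ D i.+1 <= 3 / D%:R.
Proof.
move=> D1; have D0 : 0 < D%:R :> R by rewrite ltr0n.
have small n : (n < D)%N -> \sum_(i < n) beta_ D i.+1 = n%:R / D%:R ^+ 2.
  move=> nD; rewrite (eq_bigr (fun=> D%:R ^- 2)); last first.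
    by move=> i _; rewrite /beta_ (leq_ltn_trans (ltn_ord i)).
  by rewrite sumr_const card_ord -[_ *+ n]mulr_natl.
have big n : \sum_(i < D.-1 + n) beta_ D i.+1 <= 3 / D%:R - 2 / (D + n)%:R.
  elim: n => [|n ih].
    rewrite !addn0 small ?prednK//.
    have -> : 3 / D%:R - 2 / D%:R = D%:R / D%:R ^+ 2 :> R by field; rewrite gt_eqF.
    by rewrite ler_wpM2r ?invr_ge0 ?sqr_ge0// ler_nat leq_pred.
  rewrite addnS big_ord_recr/=.
  have -> : beta_ D (D.-1 + n).+1 = (D + n)%:R ^- 2.
    by rewrite /beta_ -addSn prednK// ltnNge leq_addr.
  have e : (D + n = (D + n).-1.+1)%N by rewrite prednK// addn_gt0 D1.
  have := @sqr_inv_telescope R (D + n).-1; rewrite -e => h.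
  rewrite addnS; move: ih h; move: (2 / _) (2 / _) (3 / _) (_ ^- 2) => a b c d; lra.
have [mD|Dm] := ltnP m D.
  rewrite small// ler_pdivrMr ?exprn_gt0//.
  have -> : 3 / D%:R * D%:R ^+ 2 = 3 * D%:R :> R by field; rewrite gt_eqF.
  have : m%:R <= D%:R :> R by rewrite ler_nat ltnW.
  lra.
have Dm' : (D.-1 <= m)%N by rewrite (leq_trans (leq_pred _)).
rewrite -(subnKC Dm'); apply: (le_trans (big _)).
by rewrite gerBl divr_ge0.
Qed.

(** The exponents are distinct, so the differences [k - j] are distinct positive integers and the
    sum over all of them is a bound. *)
Lemma beta_path_sum D l k : (1 <= D)%N -> path ltn 0 (rcons l k) ->
  \sum_(j <- l) beta_ D (k - j) <= 3 / D%:R.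
Proof.
move=> D1 pl; apply: le_trans (beta_sum k D1).
apply: (le_trans (path_sum_le (F := fun j => beta_ D (k - j)) _ pl)).
  by move=> j; exact: beta_ge0.
rewrite (reindex_inj rev_ord_inj)/=.
rewrite le_eqVlt; apply/predU1P; left; apply: eq_bigr => i _.
by rewrite subKn.
Qed.

End increasing_sums.

Section bounded_measurable.
Context {R : realType}.
Local Notation mu := (@lebesgue_measure R).
Implicit Types h : R -> R.

(** Replaces [con] from here on, since [f] may jump; it is stable under the operations used and
    gives integrability on every segment. *)
Definition bmf h := measurable_fun setT h /\ exists C, forall x, `|h x| <= C.

Lemma bmf_cst (c : R) : bmf (fun=> c).
Proof. by split; [exact: measurable_cst|exists `|c|]. Qed.

Lemma bmfD h1 h2 : bmf h1 -> bmf h2 -> bmf (fun x => h1 x + h2 x).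
Proof.
move=> [m1 [C1 H1]] [m2 [C2 H2]]; split; first exact: measurable_funD.
by exists (C1 + C2) => x; rewrite (le_trans (ler_normD _ _))// lerD.
Qed.

Lemma bmfM h1 h2 : bmf h1 -> bmf h2 -> bmf (fun x => h1 x * h2 x).
Proof.
move=> [m1 [C1 H1]] [m2 [C2 H2]]; split; first exact: measurable_funM.
by exists (C1 * C2) => x; rewrite normrM ler_pM.
Qed.

Lemma bmfB h1 h2 : bmf h1 -> bmf h2 -> bmf (fun x => h1 x - h2 x).
Proof.
move=> [m1 [C1 H1]] [m2 [C2 H2]]; split; first exact: measurable_funB.
by exists (C1 + C2) => x; rewrite (le_trans (ler_normB _ _))// lerD.
Qed.

Lemma bmfX h n : bmf h -> bmf (fun x => h x ^+ n).
Proof.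
move=> hb; elim: n => [|n ih]; first exact: bmf_cst.
rewrite (_ : (fun x => _) = fun x => h x * h x ^+ n); first exact: bmfM.
by apply/funext => x; rewrite exprS.
Qed.

Lemma bmf_sum (I : Type) (s : seq I) (F : I -> R -> R) :
  (forall i, bmf (F i)) -> bmf (fun x => \sum_(i <- s) F i x).
Proof.
move=> bF; elim: s => [|i s ih].
  rewrite (_ : (fun x => _) = fun=> 0); first exact: bmf_cst.
  by apply/funext => y; rewrite big_nil.
rewrite (_ : (fun x => _) = fun x => F i x + \sum_(i <- s) F i x).
  exact: bmfD.
by apply/funext => y; rewrite big_cons.
Qed.

Lemma bmf_comp h (F : R -> R) : bmf h -> measurable_fun setT F ->
  bmf (fun x => h (F x)).
Proof.
move=> [mh [C H]] mF; split; first exact: measurableT_comp.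
by exists C => x; exact: H.
Qed.

Lemma bmf_tpeval (g : @trigpoly R) : bmf (tpeval g).
Proof.
split; first by apply: continuous_measurable_fun; exact: continuous_tpeval.
by exists (coef_norm g) => x; exact: tpeval_bound.
Qed.

Lemma bmf_ig (a b : R) h : a < b -> bmf h -> ig mu `[a, b] h.
Proof.
move=> ab [mh [C H]].
have := @ig_bounded _ _ _ mu _ (measurable_itv _) (segment_measure_fin ab) h C.
by apply => [|x _]; [exact: measurable_funTS|exact: H].
Qed.

End bounded_measurable.

Lemma path_pos (l : seq nat) k : path ltn 0 l -> k \in l -> (1 <= k)%N.
Proof.
elim/last_ind: l => [//|l j ih] pl; have [pl' sj _] := path_rcons_lt pl.
by rewrite mem_rcons in_cons => /predU1P[->|/(ih pl')//]; exact: leq_trans sj.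
Qed.

Section variance_bound.
Context {R : realType}.
Local Notation mu := (@lebesgue_measure R).
Variable f : R -> R.
Hypothesis f_periodic : forall x : R, f x = f (x + 1).
Hypothesis f_mean0 : (\int[mu]_(x in `[0%R, 1%R]) (f x)%:E = 0)%E.
Hypothesis f_var : (total_variation 0%R 1%R f <= 2%:E)%E.
Variables (A B xi : R).
Hypotheses (A1 : 1 < A) (AB : A < B) (xi0 : 0 < xi).

Lemma measurable_monomial k : measurable_fun setT (fun x : R => xi * x ^+ k).
Proof. by apply: measurable_funM => //; exact: measurable_funX. Qed.

Lemma bmf_bv : bmf f.
Proof.
have [C [_ fC]] := bounded_bv f_periodic f_var.
by split; [exact: measurable_bv|exists C].
Qed.

Definition fsum (l : seq nat) (x : R) : R := \sum_(k <- l) f (xi * x ^+ k).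

Lemma bmf_fsum l : bmf (fsum l).
Proof.
apply: bmf_sum => k; apply: (bmf_comp bmf_bv); exact: measurable_monomial.
Qed.

Lemma bmf_tpsum g l : bmf (tpsum xi g l).
Proof.
apply: bmf_sum => k; apply: (bmf_comp (bmf_tpeval g)); exact: measurable_monomial.
Qed.

(** Each new exponent adds its cross terms with the earlier ones, at most [2 c (3 / D)] by
    [beta_path_sum], and its own square, at most [c / D]; this is the constant 7. *)
Lemma square_sum_bound (h : R -> R) (c : R) (D : nat) : bmf h -> 0 <= c -> (1 <= D)%N ->
  (forall j k, (1 <= j <= k)%N ->
    `|avg A B (fun x => h (xi * x ^+ j) * h (xi * x ^+ k))| <= c * beta_ D (k - j)) ->
  forall l, path ltn 0 l ->
    avg A B (fun x => (\sum_(k <- l) h (xi * x ^+ k)) ^+ 2) <= 7 * c / D%:R * (size l)%:R.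
Proof.
move=> bh c0 D1 H.
have D0 : 1 <= D%:R :> R by rewrite ler1n.
pose hk k x := h (xi * x ^+ k).
have bk k : bmf (hk k) by apply: (bmf_comp bh); exact: measurable_monomial.
elim/last_ind => [_|l k ih pl].
  rewrite mulr0 (@avg_eq _ _ _ _ (fun=> 0)) ?avg_cst// => x _.
  by rewrite big_nil expr0n.
have [pl' sk kj] := path_rcons_lt pl.
have k1 : (1 <= k)%N by rewrite (leq_trans _ sk).
pose S x := \sum_(j <- l) hk j x.
have bS : bmf S by exact: bmf_sum.
rewrite (@avg_eq _ _ _ _ (fun x => S x ^+ 2 + (2 * (\sum_(j <- l) hk j x * hk k x)
    + hk k x * hk k x))); last first.
  move=> x _; rewrite -cats1 big_cat big_seq1/= -/(S x) -/(hk k x).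
  by rewrite -mulr_suml -/(S x); ring.
have bp j : bmf (fun x => hk j x * hk k x) by exact: bmfM.
have bps : bmf (fun x => \sum_(j <- l) hk j x * hk k x) by exact: bmf_sum.
have bps2 : bmf (fun x => 2 * \sum_(j <- l) hk j x * hk k x).
  by apply: bmfM => //; exact: bmf_cst.
rewrite avgD; [|exact/bmf_ig/bmfX|by apply: bmf_ig => //; exact: bmfD].
rewrite avgD; [|exact: bmf_ig|exact: bmf_ig].
rewrite avgZ; last exact: bmf_ig.
rewrite avg_sum; last by move=> j _; exact: bmf_ig.
have h1 : \sum_(j <- l) avg A B (fun x => hk j x * hk k x) <= c * (3 / D%:R).
  apply: (@le_trans _ _ (\sum_(j <- l) c * beta_ D (k - j))).
    rewrite big_seq [leRHS]big_seq; apply: ler_sum => j jl.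
    apply: (le_trans (ler_norm _)); apply: H.
    by rewrite (path_pos pl' jl) ltnW// kj.
  by rewrite -mulr_sumr; apply: ler_wpM2l => //; exact: beta_path_sum.
have h2 : avg A B (fun x => hk k x * hk k x) <= c / D%:R.
  apply: (le_trans (ler_norm _)); apply: (le_trans (H k k _)); first by rewrite k1 leqnn.
  apply: ler_wpM2l => //; rewrite subnn /beta_ D1 lef_pV2 ?posrE ?exprn_gt0 ?ltr0n//.
  by rewrite expr2 ler_peMr.
rewrite size_rcons -[(size l).+1%:R]natr1 mulrDr mulr1; apply: lerD; first exact: ih.
have -> : 7 * c / D%:R = 2 * (c * (3 / D%:R)) + c / D%:R by ring.
by apply: lerD => //; apply: ler_wpM2l.
Qed.

Lemma variance_bound : exists C : R, 0 <= C /\ forall D : nat, (2 <= D)%N ->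
  exists g : @trigpoly R, [/\ tpmean g = 0,
    `|\int[mu]_(x in `[0, 1]) (f x ^+ 2) - tpvar g| <= C / D%:R &
    forall l, path ltn 0 l ->
      avg A B (fun x => (fsum l x - tpsum xi g l x) ^+ 2) <= C / D%:R * (size l)%:R].
Proof.
have [C [C0 [fC SW]]] := trig_sandwich f_periodic f_mean0 f_var.
have A0 : 0 < A by rewrite (lt_trans ltr01).
have Ai01 : 0 < A^-1 < 1 by rewrite invr_gt0 A0 invf_lt1.
(* With [p = d^2] the two coefficient norms and the degree are each of order [d^6]; together [d^18],
   and two more powers leave the rate [d^-2]. *)
have [C' [C'0 C'P]] := natpow_geometric_bounded 20 Ai01.
set CE := avg_const A B xi; have CE0 : 0 <= CE by exact: avg_const_ge0.
set CX := cross_const A B xi; have CX0 : 0 <= CX by exact: cross_const_ge0.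
pose c := 6 * C * CE * C + CX * (8 * C ^+ 2) * C'.
have c10 : 0 <= C * CE * C by apply: mulr_ge0 => //; exact: mulr_ge0.
have c20 : 0 <= CX * (8 * C ^+ 2) * C'.
  apply: mulr_ge0 => //; apply: mulr_ge0 => //.
  by apply: mulr_ge0 => //; exact: sqr_ge0.
have c0 : 0 <= c by rewrite /c; lra.
have CC : 0 <= 2 * C by rewrite mulr_ge0.
exists (7 * c + 2 * C * C); split; first by rewrite addr_ge0// !mulr_ge0.
move=> D D2; have D1 : (1 <= D)%N by rewrite ltnW.
have sq2 d : (2 <= d)%N -> (2 <= d ^ 2)%N.
  by move=> d2; rewrite (leq_trans d2)// expnS leq_pmulr// expn_gt0 (leq_trans _ d2).
have [g [w [g0 fgw mw ng [gdeg gC]]]] := SW _ (sq2 _ D2).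
have DR0 : 0 < D%:R :> R by rewrite ltr0n.
have DR1 : 1 <= D%:R :> R by rewrite ler1n.
have wpos (g' w' : @trigpoly R) : (forall u, `|f u - tpeval g' u| <= tpeval w' u) ->
    forall u, 0 <= tpeval w' u.
  by move=> fg u; apply: le_trans (fg u).
have D2D : C / (D ^ 2)%:R <= C / D%:R.
  by rewrite ler_wpM2l// lef_pV2 ?posrE ?ltr0n ?expn_gt0 ?D1// ler_nat expnS leq_pmulr// expn1.
exists g; split=> //.
  rewrite /tpvar -tpmeanE.
  have bf2 : bmf (fun x => f x ^+ 2) by apply: bmfX; exact: bmf_bv.
  have H01 : (0 : R) < 1 by [].
  rewrite -RintegralB//; [|exact: bmf_ig|exact/bmf_ig/bmf_tpeval].
  (* [f^2 - g^2] is the product of [f - g], majorised by [w], and [f + g], bounded by [2 C]. *)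
  apply: (@le_trans _ _ (\int[mu]_(x in `[0, 1]) (2 * C * tpeval w x))).
    apply: Rintegral_abs_le => //.
    - by apply: bmf_ig => //; apply: bmfB => //; exact: bmf_tpeval.
    - by apply: bmf_ig => //; apply: bmfM; [exact: bmf_cst|exact: bmf_tpeval].
    move=> x _; rewrite tpeval_pow subr_sqr mulrC normrM; apply: ler_pM => //.
    by apply: (le_trans (ler_normD _ _)); have := fC x; have := gC x; lra.
  rewrite RintegralZl//; last exact/bmf_ig/bmf_tpeval.
  rewrite tpmeanE.
  apply: (le_trans (ler_wpM2l CC (le_trans mw D2D))).
  have -> : (7 * c + 2 * C * C) / D%:R = 7 * c / D%:R + 2 * C * (C / D%:R) by ring.
  by rewrite lerDr divr_ge0// mulr_ge0.
pose h u := f u - tpeval g u.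
have bh : bmf h by apply: bmfB; [exact: bmf_bv|exact: bmf_tpeval].
have hC u : `|h u| <= 2 * C.
  by apply: (le_trans (ler_normB _ _)); have := fC u; have := gC u; lra.
have bhk k : bmf (fun x => h (xi * x ^+ k)) by apply: (bmf_comp bh); exact: measurable_monomial.
have btk (g' : @trigpoly R) k : bmf (fun x => tpeval g' (xi * x ^+ k)).
  by apply: (bmf_comp (bmf_tpeval g')); exact: measurable_monomial.
have avgw (w' g' : @trigpoly R) k (p : nat) : (1 <= k)%N ->
    (forall u, `|f u - tpeval g' u| <= tpeval w' u) -> tpmean w' <= C / p%:R ->
    avg A B (fun x => tpeval w' (xi * x ^+ k)) <= CE * C / p%:R.
  move=> k1 fg mw'; apply: (le_trans (avg_tpeval_le A1 AB xi0 k1 (wpos _ _ fg))).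
  by rewrite -mulrA ler_wpM2l.
have key j k : (1 <= j <= k)%N ->
    `|avg A B (fun x => h (xi * x ^+ j) * h (xi * x ^+ k))| <= c * beta_ D (k - j).
  move=> /andP[j1 jk]; have k1 := leq_trans j1 jk.
  (* For gaps below [D] no cancellation is used: one factor is bounded by [2 C], the other by [w],
     whose mean is [C / D^2] as the approximation was taken at [p = D^2]. *)
  rewrite /beta_; case: ltnP => [_|Dd].
    apply: (@le_trans _ _ (avg A B (fun x => 2 * C * tpeval w (xi * x ^+ j)))).
      apply: avg_abs_le => //.
      - by apply: bmf_ig => //; exact: bmfM.
      - by apply: bmf_ig => //; apply: bmfM => //; exact: bmf_cst.
      by move=> x _; rewrite mulrC normrM; apply: ler_pM => //; exact: fgw.
    rewrite avgZ; last exact: bmf_ig.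
    apply: (@le_trans _ _ (2 * C * (CE * C / (D ^ 2)%:R))).
      exact: (ler_wpM2l CC (avgw _ _ j _ j1 fgw mw)).
    rewrite natrX mulrA; apply: ler_wpM2r; first by rewrite invr_ge0 sqr_ge0.
    rewrite /c; lra.
  (* For larger gaps [D^-2] would not be summable. A finer sandwich at [p = d^2] splits [h] into
     [f - g'], whose majorant has mean [C / d^2], and [phi = g' - g], a polynomial of mean 0 to
     which [trig_cross] applies. *)
  set d := (k - j)%N in Dd *; have d2 : (2 <= d)%N by rewrite (leq_trans D2).
  have [g' [w' [g'0 fgw' mw' ng' [gdeg' gC']]]] := SW _ (sq2 _ d2).
  have jk' : (1 <= j < k)%N by rewrite j1 -subn_gt0 -/d (leq_trans _ d2).
  pose phi : @trigpoly R := g' ++ tpscale (- 1) g.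
  have phiE u : tpeval phi u = tpeval g' u - tpeval g u.
    by rewrite tpeval_cat tpeval_scale mulN1r.
  have phi0 : tpmean phi = 0 by rewrite tpmean_cat tpmean_scale g0 g'0 mulr0 addr0.
  have Dd2 : (D ^ 2 <= d ^ 2)%N by rewrite leq_exp2r.
  have Dd6 : ((D ^ 2) ^ 3 <= (d ^ 2) ^ 3)%N by rewrite leq_exp2r.
  have phideg : tpdeg_le ((d ^ 2) ^ 3) phi.
    by apply: tpdeg_cat => //; apply: tpdeg_scale; exact: tpdegW Dd6 gdeg.
  set q : R := (d ^ 2)%:R ^+ 3.
  have q1 : 1 <= q by rewrite exprn_ege1// ler1n expn_gt0 (leq_trans _ d2).
  have phin : coef_norm phi <= 2 * C * q.
    rewrite coef_norm_cat coef_norm_scale normrN1 mul1r.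
    have : C * (D ^ 2)%:R ^+ 3 <= C * q.
      by rewrite ler_wpM2l// lerXn2r ?nnegrE// ler_nat.
    move: ng ng'; rewrite -/q; lra.
  have cross := trig_cross A1 AB xi0 jk' phideg phi0.
  have dR0 : 0 < d%:R :> R by rewrite ltr0n (leq_trans _ d2).
  have crossb : `|avg A B (fun x => tpeval phi (xi * x ^+ j) * tpeval phi (xi * x ^+ k))|
      <= CX * (8 * C ^+ 2) * C' / d%:R ^+ 2.
    apply: (le_trans cross); rewrite -/d natrX -/q -/CX.
    have n0 := coef_norm_ge0 phi.
    have q0 : 0 <= q by rewrite (le_trans _ q1).
    have s1 : coef_norm phi * coef_norm phi * (1 + q) <= 8 * C ^+ 2 * q ^+ 3.
      have -> : 8 * C ^+ 2 * q ^+ 3 = (2 * C * q) * (2 * C * q) * (2 * q) by ring.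
      apply: ler_pM; [exact: mulr_ge0|by rewrite addr_ge0| |lra].
      exact: ler_pM.
    have s2 : q ^+ 3 * A^-1 ^+ d <= C' / d%:R ^+ 2.
      rewrite ler_pdivlMr ?exprn_gt0//; apply: le_trans (C'P d).
      rewrite /q natrX -!exprM le_eqVlt; apply/predU1P; left.
      by rewrite (_ : 20 = 2 * 3 * 3 + 2)%N// exprD; ring.
    have Ad : 0 <= A^-1 ^+ d by rewrite exprn_ge0// invr_ge0 ltW.
    rewrite -!(mulrA CX); apply: ler_wpM2l => //.
    apply: (le_trans (ler_wpM2r Ad s1)).
    rewrite -[leLHS]mulrA -[leRHS]mulrA; apply: ler_wpM2l => //.
    by rewrite mulr_ge0// exprn_ge0.
  have rest : `|avg A B (fun x => h (xi * x ^+ j) * h (xi * x ^+ k) -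
      tpeval phi (xi * x ^+ j) * tpeval phi (xi * x ^+ k))| <= 4 * C * CE * C / d%:R ^+ 2.
    apply: (@le_trans _ _ (avg A B (fun x => 2 * C * tpeval w' (xi * x ^+ j)
        + 2 * C * tpeval w' (xi * x ^+ k)))).
      apply: avg_abs_le => //.
      - by apply: bmf_ig => //; apply: bmfB; exact: bmfM.
      - by apply: bmf_ig => //; apply: bmfD; apply: bmfM => //; exact: bmf_cst.
      move=> x _; set u := xi * x ^+ j; set v := xi * x ^+ k.
      have hphi z : h z - tpeval phi z = f z - tpeval g' z by rewrite phiE /h; ring.
      have -> : h u * h v - tpeval phi u * tpeval phi v =
        h v * (h u - tpeval phi u) + tpeval phi u * (h v - tpeval phi v) by ring.
      rewrite !hphi; apply: (le_trans (ler_normD _ _)); apply: lerD.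
        by rewrite normrM; apply: ler_pM => //; exact: hC.
      rewrite normrM; apply: ler_pM => //.
      rewrite phiE; apply: (le_trans (ler_normB _ _)).
      by have := gC u; have := gC' u; lra.
    have b2 i : bmf (fun x => 2 * C * tpeval w' (xi * x ^+ i)).
      by apply: bmfM => //; exact: bmf_cst.
    rewrite avgD; [|exact: bmf_ig|exact: bmf_ig].
    rewrite !avgZ; try exact: bmf_ig.
    have e1 := avgw _ _ j _ j1 fgw' mw'; have e2 := avgw _ _ k _ k1 fgw' mw'.
    rewrite natrX in e1 e2.
    apply: (le_trans (lerD (ler_wpM2l CC e1) (ler_wpM2l CC e2))).
    by rewrite le_eqVlt; apply/predU1P; left; ring.
  set P := fun x => h (xi * x ^+ j) * h (xi * x ^+ k).
  set Q := fun x => tpeval phi (xi * x ^+ j) * tpeval phi (xi * x ^+ k) in crossb.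
  have bP : bmf P by exact: bmfM.
  have bQ : bmf Q by exact: bmfM.
  have -> : avg A B P = avg A B (fun x => P x - Q x) + avg A B Q.
    by rewrite avgB ?subrK//; exact: bmf_ig.
  apply: (le_trans (ler_normD _ _)); apply: (le_trans (lerD rest crossb)).
  rewrite -mulrDl; apply: ler_wpM2r; first by rewrite invr_ge0 sqr_ge0.
  rewrite /c; lra.
move=> l pl; have := square_sum_bound bh c0 D1 key pl.
rewrite (@avg_eq _ _ _ _ (fun x => (fsum l x - tpsum xi g l x) ^+ 2)); last first.
  by move=> x _; rewrite /fsum /tpsum -sumrB.
move=> /le_trans; apply; apply: ler_wpM2r => //.
by apply: ler_wpM2r; [rewrite invr_ge0|rewrite lerDl !mulr_ge0].
Qed.

End variance_bound.

(** * Smoothing *)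

Section ramps.
Context {R : realType}.

Definition ramp (de t y : R) : R := Num.max 0 (Num.min 1 ((t + de - y) / de)).

Lemma ramp01 de t y : 0 <= ramp de t y <= 1.
Proof. by rewrite /ramp le_max lexx/= ge_max ler01 ge_min lexx. Qed.

Lemma ramp_lip de t x y : 0 < de -> `|ramp de t x - ramp de t y| <= de^-1 * `|x - y|.
Proof.
move=> de0; rewrite /ramp.
have -> : de^-1 * `|x - y| = `|(t + de - x) / de - (t + de - y) / de|.
  rewrite -mulrBl normrM mulrC (gtr0_norm (x := de^-1)) ?invr_gt0//.
  by rewrite distrC; congr (`|_| * _); ring.
move: ((t + de - x) / de) ((t + de - y) / de) => a b.
wlog ba : a b / b <= a.
  by move=> h; have [/h//|/ltW/h] := leP b a; rewrite distrC (distrC b).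
have clip_mono : Num.max 0 (Num.min 1 b) <= Num.max 0 (Num.min 1 a).
  by rewrite ge_max le_max lexx/= le_max le_min !ge_min lexx ba/= orbT orbT.
rewrite !ger0_norm ?subr_ge0//.
have [a1|a1] := leP 1 a; have [b1|b1] := leP 1 b;
  have [a0|a0] := leP 0 a; have [b0|b0] := leP 0 b; rewrite ?(max_idPr ler01); lra.
Qed.

Lemma ramp_ge1 de t y : 0 < de -> y <= t -> ramp de t y = 1.
Proof.
move=> de0 yt; have h : 1 <= (t + de - y) / de by rewrite ler_pdivlMr//; lra.
by rewrite /ramp (min_idPl h) (max_idPr ler01).
Qed.

Lemma ramp_le0 de t y : 0 < de -> t + de <= y -> ramp de t y = 0.
Proof.
move=> de0 yt; have h : (t + de - y) / de <= 0 by rewrite ler_pdivrMr//; lra.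
by rewrite /ramp (min_idPr (le_trans h ler01)) (max_idPl h).
Qed.

End ramps.

Section gaussian_cdf.
Context {R : realType}.
Local Notation mu := (@lebesgue_measure R).

Lemma patch_indic (D : set R) (h : R -> R) (x : R) : (h \_ D) x = \1_D x * h x.
Proof. by rewrite patchE indicE; case: ifPn => _; rewrite ?mul1r ?mul0r. Qed.

Lemma gexp_indic (D : set R) : gexp (\1_D : R -> R) = \int[mu]_(x in D) gpdf x.
Proof.
by rewrite Rintegral_mkcond; apply: eq_Rintegral => x _; rewrite patch_indic.
Qed.

Lemma gig_indic (D : set R) : measurable D -> gig (\1_D : R -> R).
Proof.
move=> mD; apply: (@gig_bounded _ _ 1); first exact: measurable_indic.
by move=> x; rewrite indicE; case: (_ \in _); rewrite ?normr1 ?normr0.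
Qed.

Lemma std_normal_cdfE (t : R) : std_normal_cdf t = gexp (\1_`]-oo, t] : R -> R).
Proof. by rewrite gexp_indic. Qed.

Lemma gexp_le (f h : R -> R) : gig f -> gig h -> (forall x, f x <= h x) ->
  gexp f <= gexp h.
Proof.
move=> If Ih fh; apply: le_Rintegral => // x _.
by rewrite ler_wpM2r// gpdf_ge0.
Qed.

(** The density is at most 1. This is the anticoncentration that makes the smoothing error uniform
    in [t]. *)
Lemma gexp_indic_itv (t de : R) : 0 < de -> gexp (\1_`]t, t + de] : R -> R) <= de.
Proof.
move=> de0; have tde : t < t + de by rewrite ltrDl.
have m1 : mu `]t, t + de] = de%:E.
  by rewrite lebesgue_measure_itv/= lte_fin tde -EFinB; congr EFin; ring.
rewrite gexp_indic; apply: (le_trans (ler_norm _)).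
have Ig : ig mu `]t, t + de] gpdf.
  by apply: integrableS (integrable_normal_pdf 0 1).
have mI : measurable (`]t, t + de]%classic : set R) by exact: measurable_itv.
have fI : (mu `]t, (t + de)%R]%classic < +oo)%E by rewrite m1 ltry.
rewrite -[leRHS]mul1r -[X in _ <= 1 * X]/(fine de%:E) -m1.
apply: (@Rintegral_abs_bound _ _ R mu _ mI fI gpdf 1 Ig) => x _.
by rewrite ger0_norm ?gpdf_ge0// gpdf_le1.
Qed.

Lemma gig_ramp (de t : R) : 0 < de -> gig (ramp de t).
Proof.
move=> de0; apply: (@gig_bounded _ _ 1).
  apply: continuous_measurable_fun.
  by apply: (@lip_continuous _ _ de^-1) => x y; exact: ramp_lip.
by move=> x; have /andP[h0 h1] := ramp01 de t x; rewrite ger0_norm.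
Qed.

Lemma gexp_ramp_le (de t : R) : 0 < de -> gexp (ramp de t) <= std_normal_cdf t + de.
Proof.
move=> de0; rewrite std_normal_cdfE.
apply: (@le_trans _ _ (gexp (\1_`]-oo, t] : R -> R) + gexp (\1_`]t, t + de] : R -> R))).
  have m1 : measurable (`]-oo, t]%classic : set R) by exact: measurable_itv.
  have m2 : measurable (`]t, t + de]%classic : set R) by exact: measurable_itv.
  rewrite -gexpD; [|exact: gig_indic|exact: gig_indic].
  apply: gexp_le.
  - exact: gig_ramp.
  - by apply: gigD; exact: gig_indic.
  move=> x; rewrite !indicE !mem_setE/= !in_itv/=.
  have /andP[r0 r1] := ramp01 de t x.
  have [xt|tx] := leP x t; first by rewrite addr0.
  have [xtd|tdx] := leP x (t + de); first by rewrite add0r.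
  by rewrite addr0 ramp_le0// ltW.
by rewrite lerD2l gexp_indic_itv.
Qed.

Lemma gexp_ramp_ge (de t : R) : 0 < de -> std_normal_cdf t - de <= gexp (ramp de (t - de)).
Proof.
move=> de0; rewrite std_normal_cdfE lerBlDr.
apply: (@le_trans _ _ (gexp (ramp de (t - de)) + gexp (\1_`](t - de), (t - de + de)] : R -> R))).
  have m1 : measurable (`]-oo, t]%classic : set R) by exact: measurable_itv.
  have m2 : measurable (`](t - de), (t - de + de)]%classic : set R) by exact: measurable_itv.
  rewrite -gexpD; [|exact: gig_ramp|exact: gig_indic].
  apply: gexp_le.
  - exact: gig_indic.
  - by apply: gigD; [exact: gig_ramp|exact: gig_indic].
  move=> x; rewrite !indicE !mem_setE/= !in_itv/= subrK.
  have /andP[r0 r1] := ramp01 de (t - de) x.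
  have [xt|tx] := leP x t; last by rewrite addr_ge0.
  have [xtd|tdx] := leP x (t - de); first by rewrite ramp_ge1// lerDl.
  by rewrite lerDr.
by rewrite lerD2l gexp_indic_itv.
Qed.

End gaussian_cdf.

Section sorting.

(** The only place where positivity and distinctness of the exponents enter: they turn the sorted
    list into a strictly increasing one, without changing the sum. *)
Lemma sorted_image (s : nat -> nat) N :
  (forall n, (1 <= n)%N -> (0 < s n)%N) ->
  (forall m n, (1 <= m)%N -> (1 <= n)%N -> s m = s n -> m = n) ->
  path ltn 0 (sort leq [seq s n | n <- iota 1 N]).
Proof.
move=> s0 sinj; set l := [seq s n | n <- _].
have lu : uniq l.
  rewrite map_inj_in_uniq ?iota_uniq// => m n.
  by rewrite !mem_iota => /andP[m1 _] /andP[n1 _]; exact: sinj.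
rewrite path_min_sorted.
  by rewrite ltn_sorted_uniq_leq sort_uniq lu sort_sorted//; exact: leq_total.
rewrite all_sort; apply/allP => k /mapP[n]; rewrite mem_iota => /andP[n1 _] ->.
exact: s0.
Qed.

End sorting.

Section smoothing.
Context {R : realType}.
Variables (A B : R).
Hypothesis AB : A < B.
Local Notation mu := (@lebesgue_measure R).

Lemma normalized_lebesgueE (S : set R) : measurable S ->
  normalized_lebesgue A B S = avg A B (\1_S : R -> R).
Proof.
move=> mS; rewrite /normalized_lebesgue /avg mulrC; congr (_ * _).
rewrite /Rintegral.
have -> : (\int[mu]_(x in `[A, B]) (\1_S x : R)%:E)%E = mu (S `&` `[A, B]%classic).
  exact: (@integral_indic _ _ R mu _ (measurable_itv `[A, B]) _ mS).
by rewrite setIC.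
Qed.

Lemma measurable_sublevel (Z : R -> R) t : measurable_fun setT Z ->
  measurable [set x | Z x <= t].
Proof.
move=> mZ; have := mZ measurableT _ (measurable_itv `]-oo, t]).
by rewrite setTI (_ : _ @^-1` _ = [set x | Z x <= t])//; apply/seteqP; split => x /=; rewrite in_itv.
Qed.

Lemma indic_sublevel (Z : R -> R) t x : \1_[set x | Z x <= t] x = (Z x <= t)%R%:R :> R.
Proof.
rewrite indicE; congr (_ %:R); congr nat_of_bool.
by apply/idP/idP => [/set_mem//|h]; exact: mem_set.
Qed.

Lemma bmf_ramp (Z : R -> R) (de t : R) : 0 < de -> measurable_fun setT Z ->
  bmf (fun x => ramp de t (Z x)).
Proof.
move=> de0; apply: bmf_comp; split; last first.
  by exists 1 => x; have /andP[r0 r1] := ramp01 de t x; rewrite ger0_norm.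
apply: continuous_measurable_fun.
by apply: (@lip_continuous _ _ de^-1) => x y; exact: ramp_lip.
Qed.

(** The indicator of the half-line lies between the ramps at [t - de] and at [t]. Passing from [Z]
    to [Y] costs [E / de] by the Lipschitz constant, passing to the Gaussian costs [e], and the
    ramps miss the distribution function by at most [de]. *)
Lemma kolmogorov_smoothing (Z Y : R -> R) (de e E t : R) : 0 < de -> bmf Z -> bmf Y ->
  (forall phi : R -> R, (forall x, 0 <= phi x <= 1) ->
    (forall x y, `|phi x - phi y| <= de^-1 * `|x - y|) ->
    `|avg A B (fun x => phi (Y x)) - gexp phi| < e) ->
  avg A B (fun x => `|Z x - Y x|) <= E ->
  `|normalized_lebesgue A B [set x | Z x <= t] - std_normal_cdf t| <
    e + de^-1 * E + de.
Proof.
move=> de0 bZ bY clt ZY.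
have mS := measurable_sublevel t bZ.1.
have Iind : ig mu `[A, B] (\1_[set x | Z x <= t] : R -> R).
  apply: bmf_ig => //; split; first exact: measurable_indic.
  by exists 1 => x; rewrite indicE; case: (_ \in _); rewrite ?normr1 ?normr0.
have Ir W u : bmf W -> ig mu `[A, B] (fun x => ramp de u (W x)).
  by move=> bW; apply: bmf_ig => //; apply: bmf_ramp => //; exact: bW.1.
have close u : `|avg A B (fun x => ramp de u (Z x)) - avg A B (fun x => ramp de u (Y x))|
    <= de^-1 * E.
  have I0 : ig mu `[A, B] (fun x => `|Z x - Y x|).
    exact: ig_abs (bmf_ig AB (bmfB bZ bY)).
  rewrite -avgB; [|exact: Ir|exact: Ir].
  apply: (@le_trans _ _ (de^-1 * avg A B (fun x => `|Z x - Y x|))).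
    rewrite -avgZ//; apply: avg_abs_le => [//|||x _]; last exact: ramp_lip.
    - exact: (@igB _ _ R mu _ (measurable_itv _) _ _ (Ir _ u bZ) (Ir _ u bY)).
    - exact: (@igZ _ _ R mu _ (measurable_itv _) de^-1 _ I0).
  by rewrite ler_wpM2l// invr_ge0 ltW.
have gc u := clt _ (ramp01 de u) (fun x y => ramp_lip u x y de0).
rewrite normalized_lebesgueE//.
have up : avg A B (\1_[set x | Z x <= t] : R -> R) <= avg A B (fun x => ramp de t (Z x)).
  apply: avg_le => //; first exact: Ir.
  move=> x _; have /andP[r0 _] := ramp01 de t (Z x).
  rewrite indic_sublevel; case: (leP (Z x) t) => zt //=.
  by rewrite ramp_ge1//= lexx.
have lo : avg A B (fun x => ramp de (t - de) (Z x)) <=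
    avg A B (\1_[set x | Z x <= t] : R -> R).
  apply: avg_le => //; first exact: Ir.
  move=> x _; have /andP[_ r1] := ramp01 de (t - de) (Z x).
  rewrite indic_sublevel; case: (leP (Z x) t) => zt //=.
  by rewrite ramp_le0// subrK ltW.
have h1 := close t; have h2 := close (t - de).
have h3 := gc t; have h4 := gc (t - de).
have h5 := gexp_ramp_le t de0; have h6 := gexp_ramp_ge t de0.
move: up lo h1 h2 h3 h4 h5 h6; rewrite !ler_norml !ltr_norml; clear.
move: (avg A B (\1__ : R -> R)) (std_normal_cdf t) (de^-1 * E) (gexp _) (gexp _).
do 4 move: (avg A B _).
move=> a1 a2 a3 a4 a5 a6 a7 a8 a9 ? ? /andP[? ?] /andP[? ?] /andP[? ?] /andP[? ?] ? ?.
by apply/andP; split; lra.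
Qed.

(** Two errors are separated: the summand [d], and the change of normalisation from [si] to [nf].
    Both are bounded by squares, through [a <= (th + a^2 / th) / 2] and [|Y| <= (1 + Y^2) / 2],
    because only second moments are at hand; and [|si - nf|] is at most [|nf^2 - si^2| / nf]. *)
Lemma normalized_diff (nf si sN d T th : R) : 0 < nf -> 0 < si -> 0 < sN -> 0 < th ->
  `|1 / (nf * sN) * (T + d) - T / (si * sN)| <=
  (th + d ^+ 2 / sN ^+ 2 / th) / (2 * nf) +
  `|nf ^+ 2 - si ^+ 2| / nf ^+ 2 * ((1 + (T / (si * sN)) ^+ 2) / 2).
Proof.
move=> n0 s0 N0 t0; set Y := T / _.
have -> : 1 / (nf * sN) * (T + d) - Y = (d / sN) / nf + Y * ((si - nf) / nf).
  by rewrite /Y; field; rewrite !gt_eqF.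
have TE (a : R) : a <= (th + a ^+ 2 / th) / 2.
  rewrite -subr_ge0 (_ : _ - a = (a - th) ^+ 2 / (th * 2)); last by field; rewrite gt_eqF.
  by rewrite divr_ge0 ?sqr_ge0// mulr_ge0// ltW.
rewrite (le_trans (ler_normD _ _))// lerD//.
  rewrite normrM normfV (gtr0_norm n0) (invfM 2 nf) mulrA ler_wpM2r ?invr_ge0 ?(ltW n0)//.
  by rewrite -expr_div_n -(real_normK (num_real (d / sN))); exact: TE.
rewrite normrM mulrC ler_pM//; last first.
  rewrite -(real_normK (num_real Y)).
  by have := sqr_ge0 (`|Y| - 1); rewrite sqrrB1; lra.
rewrite normrM normfV (gtr0_norm n0) ler_pdivrMr// (mulrC (`|_| / _)).
rewrite (distrC (nf ^+ 2)) subr_sqr normrM (gtr0_norm (addr_gt0 s0 n0)).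
rewrite (_ : nf * _ = `|si - nf| * ((si + nf) / nf)); last by field; rewrite gt_eqF.
by rewrite ler_peMr// ler_pdivlMr// mul1r lerDr ltW.
Qed.

End smoothing.

Section comparison.
Context {R : realType}.
Variable f : R -> R.
Hypothesis f_periodic : forall x : R, f x = f (x + 1).
Hypothesis f_var : (total_variation 0%R 1%R f <= 2%:E)%E.
Variables (A B xi : R).
Hypothesis AB : A < B.
Local Notation mu := (@lebesgue_measure R).

Lemma bmf_nsum g l : bmf (nsum xi g l).
Proof. exact: bmfM (bmf_tpsum xi g l) (bmf_cst _). Qed.

Lemma avg_normalized_diff g (nf K th : R) l : 0 < nf -> 0 < tpvar g -> 0 < th ->
  (0 < size l)%N ->
  `|nf ^+ 2 - tpvar g| <= K ->
  avg A B (fun x => (fsum f xi l x - tpsum xi g l x) ^+ 2) <= K * (size l)%:R ->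
  avg A B (fun x => nsum xi g l x ^+ 2) <= 2 ->
  avg A B (fun x => `|1 / (nf * Num.sqrt (size l)%:R) * fsum f xi l x - nsum xi g l x|) <=
  (th + K / th) / (2 * nf) + K / nf ^+ 2 * (3 / 2).
Proof.
move=> nf0 v0 th0 l0 hK hd hY.
have N0 : 0 < (size l)%:R :> R by rewrite ltr0n.
have sN0 : 0 < Num.sqrt (size l)%:R :> R by rewrite sqrtr_gt0.
have si0 : 0 < Num.sqrt (tpvar g) by rewrite sqrtr_gt0.
pose d x := fsum f xi l x - tpsum xi g l x.
pose a := (size l)%:R^-1 / th / (2 * nf).
pose b := `|nf ^+ 2 - tpvar g| / nf ^+ 2 / 2.
have b0 : 0 <= b by rewrite divr_ge0// divr_ge0// exprn_ge0// ltW.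
have a0 : 0 <= a by rewrite divr_ge0 ?mulr_ge0 ?invr_ge0 ?(ltW th0) ?(ltW nf0)// ltW.
have bd : bmf d by apply: bmfB; [exact: bmf_fsum|exact: bmf_tpsum].
have bY := bmf_nsum g l.
have bI h : bmf h -> ig mu `[A, B] h by exact: bmf_ig.
have bdd : bmf (fun x => a * d x ^+ 2) by apply: bmfM; [exact: bmf_cst|exact: bmfX].
have bYY : bmf (fun x => b * nsum xi g l x ^+ 2) by apply: bmfM; [exact: bmf_cst|exact: bmfX].
have bc c : bmf (fun=> c : R) := bmf_cst c.
pose G x := (a * d x ^+ 2 + b * nsum xi g l x ^+ 2) + (th / (2 * nf) + b).
have bG : bmf G by apply: bmfD; [exact: bmfD|exact: bmf_cst].
apply: (@le_trans _ _ (avg A B G)).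
  apply: avg_le => [//||| x _]; [|exact: bI|].
    apply: ig_abs; apply: bI; apply: bmfB => //.
    by apply: bmfM; [exact: bmf_cst|exact: bmf_fsum].
  have := normalized_diff (d x) (tpsum xi g l x) nf0 si0 sN0 th0.
  rewrite /d (addrC (tpsum xi g l x)) subrK !sqr_sqrtr ?(ltW v0) ?(ltW N0)// => h.
  apply: (le_trans h); rewrite le_eqVlt; apply/orP; left; apply/eqP.
  by rewrite /G /a /b /d /nsum; field; rewrite !gt_eqF.
rewrite /G avgD; [|exact: bI (bmfD bdd bYY)|exact: bI].
rewrite avgD; [|exact: bI|exact: bI].
rewrite avgZ; last by apply: bI; exact: bmfX.
rewrite avgZ; last by apply: bI; exact: bmfX.
rewrite avg_cst//.
have h1 : a * avg A B (fun x => d x ^+ 2) <= K / th / (2 * nf).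
  apply: (le_trans (ler_wpM2l a0 hd)); rewrite /a le_eqVlt; apply/orP; left; apply/eqP.
  by field; rewrite !gt_eqF.
have h2 : b * avg A B (fun x => nsum xi g l x ^+ 2) <= b * 2 by exact: ler_wpM2l.
have h3 : b <= K / nf ^+ 2 / 2.
  by rewrite /b ler_wpM2r ?invr_ge0// ler_wpM2r// invr_ge0 exprn_ge0// ltW.
rewrite [(th + _) / _]mulrDl.
move: (K / th / (2 * nf)) (th / (2 * nf)) (K / nf ^+ 2) h1 h2 h3 => u v w; lra.
Qed.

End comparison.

Theorem theorem2 (R : realType) (f : R -> R)
    (f_periodic : forall x : R, f x = f (x + 1))
    (f_mean0 : (\int[lebesgue_measure]_(x in `[0%R, 1%R]) (f x)%:E = 0)%E)
    (f_var : (total_variation 0%R 1%R f <= 2%:E)%E)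
    (f_norm : 0 < L2norm_period f)
    (s : nat -> nat)
    (s_pos : forall n : nat, (1 <= n)%N -> (0 < s n)%N)
    (s_distinct : forall m n : nat,
      (1 <= m)%N -> (1 <= n)%N -> s m = s n -> m = n)
    (xi : R) (xi_pos : 0 < xi)
    (A B : R) (A_gt1 : 1 < A) (AB : A < B) :
  forall eps : R, 0 < eps ->
    exists N0 : nat, forall N : nat, (N0 <= N)%N -> forall t : R,
      `| normalized_lebesgue A B
           [set x : R | 1 / (L2norm_period f * Num.sqrt N%:R) *
                        (\sum_(1 <= n < N.+1) f (xi * x ^+ s n)) <= t]
         - std_normal_cdf t | < eps.
Proof.
move=> eps eps0; set nf := L2norm_period f in f_norm *.
have F2 : \int[lebesgue_measure]_(x in `[0, 1]) (f x ^+ 2) = nf ^+ 2.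
  rewrite /nf /L2norm_period sqr_sqrtr//.
  by move: f_norm; rewrite /nf /L2norm_period sqrtr_gt0 => /ltW.
have nf2 : 0 < nf ^+ 2 by rewrite exprn_gt0.
(* The final budget is [eps / 4] for the Lipschitz limit, [eps / 4] for the approximation of [f] and
   [eps / 8] for the width of the ramps. *)
pose de := eps / 8; have de0 : 0 < de by rewrite divr_gt0.
pose th := eps * de * nf / 8.
have th0 : 0 < th by rewrite divr_gt0// !mulr_gt0.
have [C [C0 HC]] := variance_bound f_periodic f_mean0 f_var A_gt1 AB xi_pos.
(* Three demands on the approximation error [K]: [K / th <= th], a variance of [g] that stays
   positive, and a small effect of the wrong normalisation. *)
pose m := Num.min (th ^+ 2) (Num.min (nf ^+ 2 / 2) (nf ^+ 2 * (eps * de / 16))).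
have m0 : 0 < m by rewrite !lt_min !mulr_gt0// !exprn_gt0.
pose D := (Num.bound (C / m)).+2.
have Dm : C / D%:R <= m.
  have D0 : 0 < D%:R :> R by rewrite ltr0n.
  rewrite ler_pdivrMr// mulrC -ler_pdivrMr//.
  have := archi_boundP (divr_ge0 C0 (ltW m0)) => /ltW h; apply: (le_trans h).
  by rewrite ler_nat /D; exact/leqW/leqnSn.
(* From here on [g] is fixed; the two thresholds for [N] depend on it but not on [t]. *)
have [g [g0 gF gd]] := HC D isT; rewrite F2 in gF.
set K := C / D%:R in Dm gF gd.
move: Dm; rewrite !le_min => /and3P[K1 K2 K3].
have v0 : 0 < tpvar g by move: gF; rewrite ler_norml => /andP[]; lra.
have e4 : 0 < eps / 4 by rewrite divr_gt0.
have L0 : 0 <= de^-1 by rewrite invr_ge0 ltW.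
have [n1 H1] := lipschitz_clt A_gt1 AB xi_pos g0 v0 L0 e4.
have [n2 H2] := moment_cvg A_gt1 AB xi_pos g0 2 v0 ltr01.
exists (maxn 1 (maxn n1 n2)) => N; rewrite !geq_max => /and3P[N0 N1 N2] t.
pose l := sort leq [seq s n | n <- iota 1 N].
have pl : path ltn 0 l := sorted_image N s_pos s_distinct.
have sl : size l = N by rewrite size_sort size_map size_iota.
have Sl x : \sum_(1 <= n < N.+1) f (xi * x ^+ s n) = fsum f xi l x.
  rewrite /fsum [RHS](perm_big [seq s n | n <- iota 1 N]) ?perm_sort// big_map.
  by rewrite /index_iota subn1.
have Y2 : avg A B (fun x => nsum xi g l x ^+ 2) <= 2.
  have := H2 l pl; rewrite sl => /(_ N2); rewrite ltr_norml /= mulr1 /nsum sl.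
  by move=> /andP[_ h]; move: h; rewrite ltrBlDr => /ltW.
have lN : (0 < size l)%N by rewrite sl.
have ZY := avg_normalized_diff f_periodic f_var AB f_norm v0 th0 lN gF (gd l pl) Y2.
have bZ : bmf (fun x => 1 / (nf * Num.sqrt (size l)%:R) * fsum f xi l x).
  by apply: bmfM; [exact: bmf_cst|exact: bmf_fsum].
have := H1 l pl; rewrite sl => /(_ N1) clt.
have := kolmogorov_smoothing AB t de0 bZ (bmf_nsum xi g l) clt ZY.
rewrite sl => h; under eq_set do rewrite Sl.
apply: (lt_le_trans h).
have b1 : (th + K / th) / (2 * nf) <= eps * de / 8.
  have h1 : K / th <= th by rewrite ler_pdivrMr// -expr2.
  apply: (@le_trans _ _ ((th + th) / (2 * nf))).
    by rewrite ler_wpM2r ?lerD2l// invr_ge0 mulr_ge0// ltW.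
  by rewrite le_eqVlt /th; apply/orP; left; apply/eqP; field; rewrite gt_eqF.
have b2 : K / nf ^+ 2 <= eps * de / 16 by rewrite ler_pdivrMr// mulrC.
have b3 : de^-1 * ((th + K / th) / (2 * nf) + K / nf ^+ 2 * (3 / 2)) <= eps / 4.
  rewrite mulrC ler_pdivrMr// (mulrAC eps).
  have : 0 <= eps * de by rewrite mulr_ge0 ?ltW.
  by move: (eps * de) b1 b2 => z; clear; lra.
by move: (de^-1 * _) b3; rewrite /de; clear -eps0 => z; lra.
Qed.
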